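(* Let $\mu<0$, $\sigma>0$ and $a>0$. As $\lambda\to\infty$, the processes $\{Y_\lambda(t):t\ge 0\}$ (the two-state flip-flop fluid queues with sticky boundary at zero, with parameters $\mu$, $\sigma$, $a$) converge weakly to the sticky Brownian motion $\{Y(t):t\ge 0\}$ with parameters $\mu$, $\sigma^2$ and $\omega=a\sigma$.
   Context: Sticky Brownian motion: let $\{X(t)\}$ be a Brownian motion with $X(0)=0$, drift $\mu<0$ and variance $\sigma^2>0$. Put $R(t)=|\inf_{0\le s\le t}X(s)|$ and $Z(t)=X(t)+R(t)$. For $\omega>0$ put $V(t)=t+R(t)/\omega$, which is continuous and strictly increasing, and let $\Gamma$ be the function such that $V(\Gamma(t))=t$ for all $t\ge 0$. The process $Y(t)=Z(\Gamma(t))$ is called the sticky Brownian motion with parameters $\mu,\sigma^2,\omega$. Flip-flop approximation: for $\lambda>0$ (large enough that $\mu+\sigma\sqrt\lambda>0$), let $\{\kappa_\lambda(t)\}$ be the continuous-time Markov chain on $\{1,2\}$ with generator $\begin{bmatrix}-\lambda&\lambda\\ \lambda&-\lambda\end{bmatrix}$, let $c_1=\mu+\sigma\sqrt\lambda$, $c_2=\mu-\sigma\sqrt\lambda$, and let $X_\lambda(t)=\int_0^t c_{\kappa_\lambda(s)}\,\mathrm{d}s$. Put $R_\lambda(t)=|\inf_{0\le s\le t}X_\lambda(s)|$ and $Z_\lambda(t)=X_\lambda(t)+R_\lambda(t)$. Let $L^0_\lambda(t)=\int_0^t \mathbb{1}\{Z_\lambda(s)=0\}\,\mathrm{d}s$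 be the time spent by $Z_\lambda$ at level $0$. For fixed $a>0$ put $$V_\lambda(t)=t-L^0_\lambda(t)+L^0_\lambda(t)\frac{\sqrt\lambda}{a}=t+R_\lambda(t)\,\frac{\sqrt\lambda-a}{a(\sigma\sqrt\lambda-\mu)},$$ let $\Gamma_\lambda$ be the function such that $V_\lambda(\Gamma_\lambda(t))=t$, and define $Y_\lambda(t)=Z_\lambda(\Gamma_\lambda(t))$. Weak convergence is that of processes with continuous paths on $[0,\infty)$ (uniform convergence on compact time intervals). *)

(* Defs.v *)
From HB Require Import structures.
From mathcomp Require Import all_boot all_order all_algebra.
From mathcomp Require Import all_classical all_reals all_analysis.

Set Implicit Arguments.
Unset Strict Implicit.
Unset Printing Implicit Defensive.

Import Order.TTheory GRing.Theory Num.Theory.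
Import numFieldNormedType.Exports.
Local Open Scope classical_set_scope.
Local Open Scope ring_scope.

(* A stochastic process is a function [X : R -> T -> R] of time and outcome; all
   conditions bear only on times [0 <= t]. *)

Notation halfline R := (set_type [set` `[(0 : R), +oo[]).

Section processes.
Context {R : realType} {d : measure_display} {T : measurableType d}.
Variable P : probability T R.

(* The Borel sigma-algebra of C[0,oo) is generated by the evaluations, so these
   are exactly the random elements of C[0,oo). *)
Definition continuous_process (X : R -> T -> R) : Prop :=
  (forall t, 0 <= t -> measurable_fun setT (X t)) /\
  (forall w, {within `[0, +oo[, continuous (X ^~ w)}).

(* [normal_prob] takes the standard deviation; [s2] is the variance per unit of
   time. *)
Definition brownian_motion (mu s2 : R) (X : R -> T -> R) : Prop :=
  [/\ continuous_process X,
      (forall w, X 0 w = 0),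
      (forall s t (B : set R), 0 <= s -> s < t -> measurable B ->
        P [set w | B (X t w - X s w)] =
        normal_prob (mu * (t - s)) (Num.sqrt (s2 * (t - s))) B) &
      (forall (n : nat) (t : nat -> R) (B : nat -> set R),
        0 <= t 0%N -> nondecreasing_seq t -> (forall k, measurable (B k)) ->
        P (\bigcap_(k < n) [set w | B k (X (t k.+1) w - X (t k) w)]) =
        (\prod_(k < n) P [set w | B k (X (t k.+1) w - X (t k) w)%R])%E)].

Definition mexp {n : nat} (A : 'M[R]_n.+1) : 'M[R]_n.+1 :=
  \matrix_(i, j) limn (series (fun k => (A ^+ k) i j / k`!%:R)).

(* Right-continuous Markov chain with transition matrices [exp (t Q)] and
   arbitrary initial law; the Markov property is written in product form to avoid
   conditioning on null events. *)
Definition markov_chain {n : nat} (Q : 'M[R]_n.+1) (kappa : R -> T -> 'I_n.+1)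
    : Prop :=
  [/\ (forall t i, 0 <= t -> measurable [set w | kappa t w = i]),
      (forall w t, 0 <= t -> \forall s \near t^'+, kappa s w = kappa t w) &
      (forall (m : nat) (t : nat -> R) (i : nat -> 'I_n.+1),
        0 <= t 0%N -> nondecreasing_seq t ->
        P (\bigcap_(k < m.+2) [set w | kappa (t k) w = i k]) =
        (P (\bigcap_(k < m.+1) [set w | kappa (t k) w = i k]) *
         (mexp ((t m.+1 - t m) *: Q) (i m) (i m.+1))%:E)%E)].

End processes.

Section paths.
Context {R : realType}.

Definition regulator (x : R -> R) (t : R) : R :=
  `| inf [set x s | s in `[0, t]] |.

Definition reflected (x : R -> R) (t : R) : R := x t + regulator x t.

(* The unique [s >= 0] with [v s = t], for [v] a continuous strictly increasing
   map of [0,oo) onto itself. *)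
Definition time_inverse (v : R -> R) (t : R) : R :=
  xget 0 [set s | 0 <= s /\ v s = t].

Definition sticky_clock (omega : R) (x : R -> R) (t : R) : R :=
  t + regulator x t / omega.

Definition sticky_path (omega : R) (x : R -> R) (t : R) : R :=
  reflected x (time_inverse (sticky_clock omega x) t).

(* The states 1 and 2 are [ord0] and [ord_max] in ['I_2]. *)
Definition flipflop_generator (l : R) : 'M[R]_2 :=
  \matrix_(i, j) if i == j then - l else l.

Definition flipflop_rate (mu sigma l : R) (i : 'I_2) : R :=
  if i == ord0 then mu + sigma * Num.sqrt l else mu - sigma * Num.sqrt l.

Definition flipflop_path (mu sigma l : R) (k : R -> 'I_2) (t : R) : R :=
  \int[lebesgue_measure]_(s in `[0, t]) flipflop_rate mu sigma l (k s).

Definition time_at_zero (z : R -> R) (t : R) : R :=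
  \int[lebesgue_measure]_(s in `[0, t]) \1_[set u | z u = 0] s.

Definition flipflop_clock (a l : R) (z : R -> R) (t : R) : R :=
  t - time_at_zero z t + time_at_zero z t * (Num.sqrt l / a).

Definition sticky_flipflop_path (mu sigma a l : R) (k : R -> 'I_2) (t : R) : R :=
  let z := reflected (flipflop_path mu sigma l k) in
  z (time_inverse (flipflop_clock a l z) t).

Definition halfline_path (x : R -> R) : halfline R -> R := fun t => x (set_val t).

End paths.

Definition sticky_process {R : realType} {T : Type} (omega : R)
    (X : R -> T -> R) : R -> T -> R :=
  fun t w => sticky_path omega (X ^~ w) t.

Definition sticky_flipflop_process {R : realType} {T : Type} (mu sigma a l : R)
    (kappa : R -> T -> 'I_2) : R -> T -> R :=
  fun t w => sticky_flipflop_path mu sigma a l (kappa ^~ w) t.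

(* Weak convergence in C[0,oo), as [l --> +oo], of processes that may live on
   different probability spaces.  C[0,oo) is the set of continuous functions on
   the half-line in the topology of uniform convergence on compact sets, and the
   test functions are the bounded continuous functions on C[0,oo). *)
Definition weak_cvg_pinfty {R : realType}
    {d_ : R -> measure_display} {T_ : forall l, measurableType (d_ l)}
    (P_ : forall l, probability (T_ l) R) (Y_ : forall l, R -> T_ l -> R)
    {d : measure_display} {T : measurableType d}
    (P : probability T R) (Y : R -> T -> R) : Prop :=
  [/\ (\forall l \near +oo, continuous_process (Y_ l)),
      continuous_process Y &
      forall F : {family compact, halfline R -> R} -> R,
        {within [set x : {family compact, halfline R -> R} |
                 continuous (x : halfline R -> R)], continuous F} ->
        (exists M, forall x, continuous (x : halfline R -> R) ->
                   `| F x | <= M) ->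
        ('E_(P_ l)[fun w => F (halfline_path ((Y_ l) ^~ w))])%E @[l --> +oo]
          --> ('E_P[fun w => F (halfline_path (Y ^~ w))])%E].

(* Main.v *)
(* Up to the drift, the flip-flop path is [sigma xi] with [xi = sqrt l * int eps],
   [eps = +-1] the state of the chain.  The reflecting term of a flip-flop path is
   [sigma sqrt l - mu] times the time its reflection spends at 0, because both are
   continuous with the same right derivative; hence the sticky fluid queue is the
   sticky path map applied to the flip-flop path, with stickiness
   [a (sigma sqrt l - mu) / (sqrt l - a)], which tends to [a sigma].  That map is
   continuous for uniform convergence on compact intervals, so what remains is
   that [xi] converges weakly to Brownian motion.

   Sampling the chain at a mesh [eta] turns [xi] into a correlated walk with
   [E[G eps_(i+1)] = rho E[G eps_i]] for every [G] depending on the past.  This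
   gives fourth moments [O(tau ^ 2)], hence tightness by dyadic chaining, and the
   corrected test function [u + eps / (2 sqrt l) * u'] telescopes against the heat
   semigroup up to [O(1 / sqrt l)], hence convergence of the increments for smooth
   products, then for continuous functions by spline approximation.

   Functionals that are Lipschitz for the sup norm on [0, k] reduce to finitely
   many increments by polygonal interpolation.  A bounded continuous functional is
   the increasing limit of its [k]-Lipschitz envelopes, and a liminf argument
   applied to [F] and [- F] concludes. *)
Require Import Defs.
From mathcomp Require Import all_boot all_order all_algebra.
From mathcomp Require Import all_classical all_reals all_analysis.
From mathcomp Require Import measurable_realfun.
From mathcomp Require Import ring lra zify.

Set Implicit Arguments.
Unset Strict Implicit.
Unset Printing Implicit Defensive.

Import Order.TTheory GRing.Theory Num.Theory.
Import numFieldNormedType.Exports.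
Local Open Scope classical_set_scope.
Local Open Scope ring_scope.


(** * Expectations of bounded variables *)

(** One approximation device serves throughout: finite sums of products of B-splines. Independence,
    the Markov property and the smooth test functions all act on such sums, so the device gives in
    turn a Fubini argument, the measurability of functions of increments, and the passage from
    smooth to continuous functions. Smoothness is expressed by Taylor estimates, which survive
    averaging, so no derivative is taken under an integral, and the heat semigroup is built from
    increments of the given Brownian motion itself.

    Two obstacles shape the rest. The probability space changes with [l], so each limit in [l] has a
    threshold fixed before the space, the measure and the chain. And [F] of a random path is not
    known to be measurable beforehand: it is reached as a limit of envelopes, each a limit of
    functions of finitely many increments.

    Second moments over a time tau are of order tau, too weak for a union over the 2^j intervals of
    length 2^-j; fourth moments gain the missing factor. For fixed [l] the mesh tends to 0 first,
    and only errors in 1 / sqrt l survive. *)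

Section bounded_expectation.
Context {R : realType} {d : measure_display} {T : measurableType d}.
Variable P : probability T R.
Implicit Types f g : T -> R.

(** Real-valued, so that ring and linear arithmetic apply; [expectation_Ex] links it to the
    extended-real expectation of integrable variables. *)
Definition Ex f : R := (\int[P]_w f w)%R.

Definition bmeas f := measurable_fun setT f /\ exists M : R, forall w, `|f w| <= M.

Definition intg f := P.-integrable setT (EFin \o f).

Lemma bmeas_ge0 f : bmeas f ->
  measurable_fun setT f /\ exists M, 0 <= M /\ forall w, `|f w| <= M.
Proof.
move=> [mf [M hM]]; split => //; exists `|M|; split => // w.
exact: le_trans (hM w) (ler_norm _).
Qed.

Lemma bmeas_intg f : bmeas f -> intg f.
Proof.
move=> [mf [M hM]]; apply: (@le_integrable _ _ _ _ _ measurableT _ (EFin \o cst M)).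
- exact/measurable_EFinP.
- by move=> w _ /=; rewrite lee_fin (le_trans (hM w)) ?ler_norm.
- exact: finite_measure_integrable_cst.
Qed.

Lemma bmeas_cst c : bmeas (fun=> c).
Proof. by split; [exact: measurable_cst|exists `|c|]. Qed.

Lemma bmeasD f g : bmeas f -> bmeas g -> bmeas (fun w => f w + g w).
Proof.
move=> [mf [M hM]] [mg [N hN]]; split; first exact: measurable_funD.
by exists (M + N) => w; rewrite (le_trans (ler_normD _ _)) ?lerD.
Qed.

Lemma bmeasM f g : bmeas f -> bmeas g -> bmeas (fun w => f w * g w).
Proof.
move=> [mf [M hM]] [mg [N hN]]; split; first exact: measurable_funM.
by exists (M * N) => w; rewrite normrM ler_pM.
Qed.

Lemma bmeasZ c f : bmeas f -> bmeas (fun w => c * f w).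
Proof. by move=> bf; apply: bmeasM => //; exact: bmeas_cst. Qed.

Lemma eq_bmeas f g : (forall w, f w = g w) -> bmeas f -> bmeas g.
Proof. by move=> h; rewrite (_ : f = g) //; exact/funext. Qed.

Lemma bmeasN f : bmeas f -> bmeas (fun w => - f w).
Proof.
by move=> /(bmeasZ (-1)); apply: eq_bmeas => w; rewrite mulN1r.
Qed.

Lemma bmeasB f g : bmeas f -> bmeas g -> bmeas (fun w => f w - g w).
Proof. by move=> bf bg; apply: bmeasD => //; exact: bmeasN. Qed.

Lemma bmeasX f n : bmeas f -> bmeas (fun w => f w ^+ n).
Proof.
move=> bf; elim: n => [|n IH].
  exact: bmeas_cst.
by apply: (eq_bmeas (fun w => esym (exprS (f w) n))); exact: bmeasM.
Qed.

Lemma bmeas_norm f : bmeas f -> bmeas (fun w => `|f w|).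
Proof.
move=> [mf [M hM]]; split; first exact: measurableT_comp.
by exists M => w; rewrite normr_id.
Qed.

Lemma bmeas_sum (I : Type) (r : seq I) (p : pred I) (F : I -> T -> R) :
  (forall i, bmeas (F i)) -> bmeas (fun w => \sum_(i <- r | p i) F i w).
Proof.
move=> h; elim: r => [|i r IH].
  by apply: (eq_bmeas _ (bmeas_cst 0)) => w; rewrite big_nil.
have h2 : bmeas (fun w => (if p i then F i w else 0) +
    \sum_(j <- r | p j) F j w).
  by apply: bmeasD => //; case: (p i) => //; exact: bmeas_cst.
by apply: (eq_bmeas _ h2) => w; rewrite big_cons; case: ifP => _ //; rewrite add0r.
Qed.

Lemma bmeas_prod (I : Type) (r : seq I) (p : pred I) (F : I -> T -> R) :
  (forall i, bmeas (F i)) -> bmeas (fun w => \prod_(i <- r | p i) F i w).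
Proof.
move=> h; elim: r => [|i r IH].
  by apply: (eq_bmeas _ (bmeas_cst 1)) => w; rewrite big_nil.
have h2 : bmeas (fun w => (if p i then F i w else 1) *
    \prod_(j <- r | p j) F j w).
  by apply: bmeasM => //; case: (p i) => //; exact: bmeas_cst.
by apply: (eq_bmeas _ h2) => w; rewrite big_cons; case: ifP => _ //; rewrite mul1r.
Qed.

Lemma bmeas_indic (A : set T) : measurable A -> bmeas (\1_A : T -> R).
Proof.
move=> mA; split; first exact: measurable_indic.
exists 1 => w; rewrite indicE; case: (w \in A); rewrite ?normr1 ?normr0//.
Qed.

Lemma intg_cst c : intg (fun=> c).
Proof. exact/bmeas_intg/bmeas_cst. Qed.

Lemma intgD f g : intg f -> intg g -> intg (fun w => f w + g w).
Proof.
move=> hf hg; rewrite /intg (_ : _ \o _ = (EFin \o f) \+ (EFin \o g))//.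
exact: integrableD.
Qed.

Lemma intgZ c f : intg f -> intg (fun w => c * f w).
Proof.
move=> hf; rewrite /intg (_ : _ \o _ = fun w => (c%:E * (f w)%:E)%E)//.
exact: (integrableZl measurableT).
Qed.

Lemma intg_le f g : measurable_fun setT f -> intg g ->
  (forall w, `|f w| <= g w) -> intg f.
Proof.
move=> mf ig h; apply: (le_integrable measurableT _ _ ig).
  exact/measurable_EFinP.
by move=> w _ /=; rewrite lee_fin (le_trans (h w)) ?ler_norm.
Qed.

Lemma Ex_cst c : Ex (fun=> c) = c.
Proof. by rewrite /Ex Rintegral_cst//; have /= -> := @probability_setT _ _ _ P; rewrite mulr1. Qed.

Lemma ExD f g : intg f -> intg g -> Ex (fun w => f w + g w) = Ex f + Ex g.
Proof. by move=> hf hg; rewrite /Ex RintegralD. Qed.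

Lemma ExZ c f : intg f -> Ex (fun w => c * f w) = c * Ex f.
Proof. by move=> hf; rewrite /Ex RintegralZl. Qed.

Lemma ExB f g : intg f -> intg g -> Ex (fun w => f w - g w) = Ex f - Ex g.
Proof. by move=> hf hg; rewrite /Ex RintegralB. Qed.

Lemma ExN f : intg f -> Ex (fun w => - f w) = - Ex f.
Proof.
move=> hf; rewrite -mulN1r -ExZ//; congr Ex.
by apply/funext => w; rewrite mulN1r.
Qed.

Lemma Ex_sum (I : Type) (r : seq I) (p : pred I) (F : I -> T -> R) :
  (forall i, bmeas (F i)) ->
  Ex (fun w => \sum_(i <- r | p i) F i w) = \sum_(i <- r | p i) Ex (F i).
Proof.
move=> h; elim: r => [|i r IH].
  rewrite big_nil -[RHS](Ex_cst 0); congr Ex.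
  by apply/funext => w; rewrite big_nil.
rewrite big_cons; case: ifP => pi; last first.
  by rewrite -IH; congr Ex; apply/funext => w; rewrite big_cons pi.
rewrite -IH -ExD; [|exact: bmeas_intg..|exact/bmeas_intg/bmeas_sum].
by congr Ex; apply/funext => w; rewrite big_cons pi.
Qed.

Lemma Ex_le f g : intg f -> intg g -> (forall w, f w <= g w) -> Ex f <= Ex g.
Proof. by move=> hf hg h; apply: le_Rintegral. Qed.

Lemma Ex_abs_le f g : intg f -> intg g -> (forall w, `|f w| <= g w) ->
  `|Ex f| <= Ex g.
Proof.
move=> hf hg h; rewrite ler_norml; apply/andP; split; last first.
  by apply: Ex_le => // w; exact: le_trans (ler_norm _) (h w).
rewrite -ExN//; apply: Ex_le => //.
  by have := intgZ (-1) hg; congr intg; apply/funext => w; rewrite mulN1r.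
by move=> w; rewrite lerNl (le_trans (ler_norm _))// normrN.
Qed.

Lemma Ex_abs_bound f M : bmeas f -> (forall w, `|f w| <= M) -> `|Ex f| <= M.
Proof.
move=> bf h; rewrite -(Ex_cst M); apply: Ex_abs_le => //.
  exact: bmeas_intg.
exact: intg_cst.
Qed.

Lemma Ex_dist f g M : bmeas f -> bmeas g ->
  (forall w, `|f w - g w| <= M) -> `|Ex f - Ex g| <= M.
Proof.
move=> bf bg h; rewrite -ExB; [|exact: bmeas_intg..].
by apply: Ex_abs_bound => //; exact: bmeasB.
Qed.

Lemma Ex_indic (A : set T) : measurable A -> Ex \1_A = fine (P A).
Proof. by move=> mA; rewrite /Ex /Rintegral integral_indic// setIT. Qed.

Lemma Ex_EFin f : intg f -> (\int[P]_w (f w)%:E)%E = (Ex f)%:E.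
Proof. by move=> h; rewrite /Ex /Rintegral fineK//; exact: integrable_fin_num. Qed.

Lemma expectation_Ex f : intg f -> ('E_P[f])%E = (Ex f)%:E.
Proof. by move=> h; rewrite unlock Ex_EFin. Qed.

Lemma Ex_eq f g : (forall w, f w = g w) -> Ex f = Ex g.
Proof. by move=> h; congr Ex; exact/funext. Qed.

(** Bounded convergence. Measurability of the limit is part of the conclusion because the path
    functionals below are known to be measurable only as such limits. *)
Lemma Ex_cvg (f_ : nat -> T -> R) f M : (forall n, measurable_fun setT (f_ n)) ->
  (forall n w, `|f_ n w| <= M) -> (forall w, f_ n w @[n --> \oo] --> f w) ->
  bmeas f /\ Ex (f_ n) @[n --> \oo] --> Ex f.
Proof.
move=> mf hM cf.
have mff : measurable_fun setT f.
  by apply: (measurable_fun_cvg (h := f_)) => // w _; exact: cf.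
have bf : bmeas f.
  split => //; exists M => w.
  by apply: (cvgr_to_le (cvg_norm (cf w))); exact: nearW.
split => //.
have := @dominated_convergence _ _ _ P setT measurableT (fun n => EFin \o f_ n)
  (EFin \o f) (EFin \o cst M).
case => //.
- by move=> n; exact/measurable_EFinP.
- exact/measurable_EFinP.
- by apply: aeW => w _; apply: cvg_EFin; [exact: nearW|exact: cf].
- exact/bmeas_intg/bmeas_cst.
- by apply: aeW => w n _ /=; rewrite lee_fin.
move=> _ _ h; apply/fine_cvg.
rewrite fineK; last exact/integrable_fin_num/bmeas_intg.
exact: h.
Qed.

End bounded_expectation.

(** * From events to bounded measurable functions *)

Section staircase.
Context {R : realType}.

(** The level sets of [f] in steps of 1 / (n + 1), starting at [- M]. The number of levels is an
    integer large enough to pass [M], whatever the fractional part of [M]. *)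
Definition stair (f : R -> R) (M : R) (n : nat) (x : R) : R :=
  \sum_(i < ((2 * Num.truncn M).+4 * n.+1)%N)
    (i%:R / n.+1%:R - M) *
    \1_(f @^-1` `[i%:R / n.+1%:R - M, i.+1%:R / n.+1%:R - M[) x.

Lemma stairE f M n x : (forall y, `|f y| <= M) ->
  `|stair f M n x - f x| <= n.+1%:R^-1.
Proof.
move=> hM; have n0 : 0 < n.+1%:R :> R by rewrite ltr0n.
have M0 : 0 <= M by apply: le_trans (hM 0).
pose y := (f x + M) * n.+1%:R.
have := hM x; rewrite ler_norml => /andP[h1 h2].
have y0 : 0 <= y by rewrite mulr_ge0 ?ler0n//; lra.
have /andP[j1 j2] := truncn_itv y0.
have jN : (Num.truncn y < (2 * Num.truncn M).+4 * n.+1)%N.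
  rewrite truncn_lt_nat// natrM /y ltr_pM2r//.
  by have := truncnS_gt M; rewrite -natr1 -[_.+4]addn4 natrD natrM; lra.
rewrite /stair (bigD1 (Ordinal jN))//= big1 ?addr0; last first.
  move=> i /eqP ij; rewrite indicE memNset ?mulr0//= in_itv/= => /andP[a1 a2].
  apply: ij; apply/val_inj => /=; apply/esym/truncn_def; rewrite /y.
  by rewrite -ler_pdivrMr// -ltr_pdivlMr// -lerBlDr -ltrBrDr a1 a2.
have e1 : (Num.truncn y)%:R / n.+1%:R <= f x + M by rewrite ler_pdivrMr.
have e2 : f x + M < (Num.truncn y).+1%:R / n.+1%:R by rewrite ltr_pdivlMr.
rewrite indicE mem_set/=; last by rewrite in_itv/= lerBlDr ltrBrDr e1 e2.
rewrite mulr1 ler_norml; move: e2; rewrite -natr1 mulrDl div1r; move: e1.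
set q := _%:R / _; set p := n.+1%:R^-1 => e1 e2.
by apply/andP; split; lra.
Qed.

(* Transfers to functions of [D] an identity known for events of [D]; it covers
   equality of laws ([G = 1], [c = 1]) as well as independence ([D' = D]). *)
Lemma Ex_of_events {d d'} {T : measurableType d} {T' : measurableType d'}
    (P : probability T R) (P' : probability T' R) (G D : T -> R) (D' : T' -> R)
    (c : R) (f : R -> R) :
  bmeas G -> measurable_fun setT D -> measurable_fun setT D' ->
  (forall B, measurable B ->
    Ex P (fun w => G w * \1_B (D w)) = c * Ex P' (fun w => \1_B (D' w))) ->
  measurable_fun setT f -> (exists M : R, forall x, `|f x| <= M) ->
  Ex P (fun w => G w * f (D w)) = c * Ex P' (fun w => f (D' w)).
Proof.
move=> bG mD mD' h mf [M hM].
have mind B : measurable B -> measurable_fun setT (\1_B : R -> R).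
  by move=> mB; exact: measurable_indic.
have bind B : exists M, forall x : R, `|\1_B x : R| <= M.
  by exists 1 => x; rewrite indicE; case: (_ \in _); rewrite ?normr1 ?normr0.
have mB n i : measurable
    (f @^-1` `[i%:R / n.+1%:R - M, i.+1%:R / n.+1%:R - M[).
  by rewrite -[X in measurable X]setTI; exact: mf.
have bD B : measurable B -> bmeas (fun w => \1_B (D w) : R).
  move=> mB'; split; first exact: (measurableT_comp (mind _ mB') mD).
  by have [N hN] := bind B; exists N => w; exact: hN.
have bD' B : measurable B -> bmeas (fun w => \1_B (D' w) : R).
  move=> mB'; split; first exact: (measurableT_comp (mind _ mB') mD').
  by have [N hN] := bind B; exists N => w; exact: hN.
have mst n : measurable_fun setT (stair f M n).
  by apply: measurable_sum => i; apply: measurable_funM => //; exact: mind.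
have sE n : Ex P (fun w => G w * stair f M n (D w)) =
            c * Ex P' (fun w => stair f M n (D' w)).
  under eq_fun do rewrite mulr_sumr.
  rewrite !Ex_sum; last 2 first.
  - by move=> i; apply/bmeasZ/bD'.
  - by move=> i; apply/bmeasM => //; apply/bmeasZ/bD.
  rewrite mulr_sumr; apply: eq_bigr => i _.
  rewrite [in RHS]ExZ; last exact/bmeas_intg/bD'.
  rewrite mulrCA -h// -ExZ; last exact/bmeas_intg/bmeasM/bD.
  by apply: Ex_eq => w; rewrite mulrCA.
have bst n x : `|stair f M n x| <= M + 1.
  rewrite -[stair _ _ _ _](subrK (f x)) (le_trans (ler_normD _ _))//.
  rewrite addrC lerD// (le_trans (stairE _ _ hM))//.
  by rewrite invf_le1 ?ltr0n// ler1n.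
have cst_ x : stair f M n x @[n --> \oo] --> f x.
  apply/cvgrPdist_le => e e0; near=> n.
  rewrite distrC (le_trans (stairE _ _ hM))//.
  by apply: ltW; near: n; exact: (near_infty_natSinv_lt (PosNum e0)).
have [N [N0 bG']] := (bmeas_ge0 bG).2.
have c1 : Ex P (fun w => G w * stair f M n (D w)) @[n --> \oo] -->
    Ex P (fun w => G w * f (D w)).
  apply: (proj2 (@Ex_cvg _ _ _ P _ _ (N * (M + 1)) _ _ _)).
  - by move=> n; apply: measurable_funM bG.1 (measurableT_comp (mst n) mD).
  - by move=> n w; rewrite normrM ler_pM.
  - by move=> w; apply: cvgMl_tmp; exact: cst_.
have c2 : Ex P' (fun w => stair f M n (D' w)) @[n --> \oo] -->
    Ex P' (fun w => f (D' w)).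
  apply: (proj2 (@Ex_cvg _ _ _ P' _ _ (M + 1) _ _ _)).
  - by move=> n; apply: measurableT_comp (mst n) mD'.
  - by move=> n w; exact: bst.
  - by move=> w; exact: cst_.
apply: (cvg_unique _ c1) => //.
rewrite (funext sE : (fun n => Ex P (fun w => G w * stair f M n (D w))) = _).
exact: cvgMl_tmp.
Unshelve. all: by end_near.
Qed.

End staircase.

Section independent_products.
Context {R : realType} {d : measure_display} {T : measurableType d}.
Variable P : probability T R.
Variables (m : nat) (D : nat -> T -> R).
Hypothesis mD : forall k, (k < m)%N -> measurable_fun setT (D k).

Definition bmfun (f : R -> R) :=
  measurable_fun setT f /\ exists M : R, forall x, `|f x| <= M.

Lemma bmfun_indic (B : set R) : measurable B -> bmfun \1_B.
Proof.
move=> mB; split; first exact: measurable_indic.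
by exists 1 => x; rewrite indicE; case: (_ \in _); rewrite ?normr1 ?normr0.
Qed.

Lemma bmfun_bmeas f (X : T -> R) : bmfun f -> measurable_fun setT X ->
  bmeas (fun w => f (X w)).
Proof.
move=> [mf [M hM]] mX; split; first exact: (measurableT_comp mf mX).
by exists M.
Qed.

Hypothesis indep : forall B : nat -> set R, (forall k, measurable (B k)) ->
  Ex P (fun w => \prod_(k < m) \1_(B k) (D k w)) =
  \prod_(k < m) Ex P (fun w => \1_(B k) (D k w)).

(** Indicators are replaced by general factors one coordinate at a time. In [key] the factors of
    index at least [j] are still indicators; the step to [j.+1] frees coordinate [j] through
    [Ex_of_events], with the product of the other factors as [G]. *)
Lemma Ex_indep_prod (f : nat -> R -> R) : (forall k, bmfun (f k)) ->
  Ex P (fun w => \prod_(k < m) f k (D k w)) =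
  \prod_(k < m) Ex P (fun w => f k (D k w)).
Proof.
move=> bf.
suff key j h : (forall k, bmfun (h k)) ->
    (forall k, (j <= k)%N -> (k < m)%N -> exists2 B, measurable B & h k = \1_B) ->
    Ex P (fun w => \prod_(k < m) h k (D k w)) =
    \prod_(k < m) Ex P (fun w => h k (D k w)).
  by apply: (key m) => // k mk km; lia.
elim: j h => [|j IH] h bh hB.
  have hB' k : exists B, measurable B /\ ((k < m)%N -> h k = \1_B).
    case: (ltnP k m) => km; last by exists set0.
    by have [B mB e] := hB k (leq0n _) km; exists B; split.
  have [B hB''] := choice hB'.
  transitivity (Ex P (fun w => \prod_(k < m) \1_(B k) (D k w))).
    apply: Ex_eq => w; apply: eq_bigr => k _.
    by rewrite (hB'' k).2.
  rewrite indep; last by move=> k; exact: (hB'' k).1.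
  by apply: eq_bigr => k _; rewrite (hB'' k).2.
case: (ltnP j m) => jm; last first.
  by apply: IH => // k jk km; lia.
pose J := Ordinal jm.
transitivity (Ex P (fun w => (\prod_(k < m | k != J) h k (D k w)) * h j (D j w))).
  by apply: Ex_eq => w; rewrite (bigD1 J)//= mulrC.
rewrite (@Ex_of_events _ _ _ _ _ P P _ (D j) (D j)
  (\prod_(k < m | k != J) Ex P (fun w => h k (D k w))) (h j)).
- by rewrite [RHS](bigD1 J)//= mulrC.
- apply: bmeas_prod => k; apply: bmfun_bmeas => //; exact: mD.
- exact: mD.
- exact: mD.
- move=> B mB; pose h' k := if k == j then \1_B else h k : R -> R.
  have := IH h'; rewrite (bigD1 J)//= => IH'.
  rewrite -[RHS]mulrC.
  have e (k : 'I_m) : k != J -> h' k = h k.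
    by rewrite /h' -val_eqE/= => /negbTE ->.
  have ej : h' j = \1_B by rewrite /h' eqxx.
  have e2 : \prod_(k < m | k != J) Ex P (fun w => h k (D k w)) =
      \prod_(k < m | k != J) Ex P (fun w => h' k (D k w)).
    by apply: eq_bigr => k /e ->.
  rewrite -ej e2 -IH'.
  + apply: Ex_eq => w; rewrite [RHS](bigD1 J)//= mulrC; congr (_ * _).
    by apply: eq_bigr => k /e ->.
  + move=> k; rewrite /h'; case: eqP => // _; exact: bmfun_indic.
  + move=> k jk km; rewrite /h'; case: eqP => kj; first by exists B.
    by apply: hB => //; lia.
- exact: (bh j).1.
- exact: (bh j).2.
Qed.

End independent_products.

(** * The sticky path map *)

Section paths.
Context {R : realType}.
Implicit Types (x y v : R -> R) (s t e : R).

Definition cpath x := {within `[0, +oo[, continuous x}.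

Lemma cpathP x : cpath x <-> forall t, 0 <= t -> forall e, 0 < e ->
  exists2 d, 0 < d & forall s, 0 <= s -> `|s - t| < d -> `|x s - x t| < e.
Proof.
split.
  move=> /continuous_within_itvcyP [c0 c1] t; rewrite le_eqVlt => /predU1P[<-|t0] e e0.
    have /cvgrPdist_lt/(_ _ e0) := c1.
    move=> [d /= d0 hd]; exists d => // s; rewrite le_eqVlt => /predU1P[<-|s0].
      by rewrite !subrr normr0.
    by move=> sd; rewrite distrC; apply: hd => //=; rewrite distrC.
  have /cvgrPdist_lt/(_ _ e0) := c0 t ltac:(by rewrite in_itv/= t0).
  move=> [d /= d0 hd]; exists d => // s s0 sd.
  by rewrite distrC; apply: hd => //=; rewrite distrC.
move=> h; apply/continuous_within_itvcyP; split.
  move=> t; rewrite in_itv/= andbT => t0; apply/cvgrPdist_lt => e e0.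
  have [d d0 hd] := h t (ltW t0) e e0.
  exists (Num.min d t) => /=; first by rewrite lt_min d0.
  move=> s /=; rewrite lt_min => /andP[sd st].
  rewrite distrC; apply: hd; last by rewrite distrC.
  by move: st; rewrite ltr_norml => /andP[]; lra.
apply/cvgrPdist_lt => e e0.
have [d d0 hd] := h 0 (lexx _) e e0.
exists d => //= s /= sd s0; rewrite distrC; apply: hd; first exact: ltW.
by rewrite distrC.
Qed.

Lemma cpath_sub x (a b : R) : cpath x -> 0 <= a -> {within `[a, b], continuous x}.
Proof.
move=> cx a0; apply: continuous_subspaceW cx => t /=.
by rewrite !in_itv/= => /andP[h _]; rewrite (le_trans a0 h).
Qed.

Lemma cpath_unif x (N e : R) : cpath x -> 0 < e -> exists2 d, 0 < d &
  forall s t, 0 <= s <= N -> 0 <= t <= N -> `|s - t| <= d -> `|x s - x t| <= e.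
Proof.
move=> /cpathP cx e0.
have /compact_near_coveringP := @segment_compact R 0 N.
move=> /(_ _ (0:R)^'+ (fun d s => 0 <= s -> forall t, 0 <= t <= N ->
   `|s - t| <= d -> `|x s - x t| <= e)).
case.
  move=> s /=; rewrite in_itv/= => /andP[s0 sN].
  have [d d0 hd] := cx s s0 (e / 2) ltac:(lra).
  exists (ball s (d / 2), `]0, (d / 2)[%classic); first split => /=.
  - by apply: nbhsx_ballx; lra.
  - near=> r => /=; rewrite in_itv/=; apply/andP; split; near: r; [exact: nbhs_right_gt|by apply: nbhs_right_lt; lra].
  move=> [s' r] /= []; rewrite /ball/= in_itv/= => b1 /andP[r0 rd] s'0 t /andP[t0 tN] st.
  have h1 : `|x s' - x s| < e / 2 by apply: hd => //; rewrite distrC; lra.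
  have h2 : `|x t - x s| < e / 2.
    apply: hd => //; move: b1 st; rewrite !ltr_norml ler_norml.
    by move=> /andP[? ?] /andP[? ?]; apply/andP; split; lra.
  move: h1 h2; rewrite !ltr_norml ler_norml.
  by move=> /andP[? ?] /andP[? ?]; apply/andP; split; lra.
move=> d /= d0 hd; exists (d / 2); first lra.
move=> s t /andP[s0 sN] tN st; apply: (hd (d / 2)) => //=.
- by rewrite sub0r normrN gtr0_norm; lra.
- by lra.
- by rewrite in_itv/= s0.
Unshelve. all: by end_near.
Qed.

Lemma cpathD x y : cpath x -> cpath y -> cpath (fun t => x t + y t).
Proof.
move=> /cpathP cx /cpathP cy; apply/cpathP => t t0 e e0.
have [a a0 ha] := cx t t0 (e / 2) ltac:(lra).
have [b b0 hb] := cy t t0 (e / 2) ltac:(lra).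
exists (Num.min a b); first by rewrite lt_min a0.
move=> s s0; rewrite lt_min => /andP[/(ha _ s0) h1 /(hb _ s0) h2].
rewrite opprD addrACA (le_lt_trans (ler_normD _ _))//; lra.
Qed.

Lemma cpathZ c x : cpath x -> cpath (fun t => c * x t).
Proof.
move=> /cpathP cx; apply/cpathP => t t0 e e0.
have c0 : 0 < `|c| + 1 by rewrite ltr_wpDl.
have [a a0 ha] := cx t t0 (e / (`|c| + 1)) ltac:(by rewrite divr_gt0).
exists a => // s s0 /(ha _ s0); rewrite ltr_pdivlMr// => h.
rewrite -mulrBr normrM (le_lt_trans _ h)// mulrC ler_wpM2l//; lra.
Qed.

Lemma cpath_cont x : continuous x -> cpath x.
Proof. by move=> cx; apply: continuous_subspaceT. Qed.

Lemma cpath_id : cpath id.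
Proof. by apply: cpath_cont => t; exact: cvg_id. Qed.

Definition path0 x := cpath x /\ x 0 = 0.

(** Since [x 0 = 0], the infimum is a nonpositive minimum, so the absolute value in [regulator] is a
    change of sign and the regulator is the running maximum of [- x]. *)
Lemma regulator_attained x t : path0 x -> 0 <= t ->
  exists2 s, 0 <= s <= t & regulator x t = - x s /\
    forall u : R, 0 <= u <= t -> x s <= x u.
Proof.
move=> [cx x0] t0.
have [c ct hc] := EVT_min t0 (cpath_sub (b := t) cx (lexx 0)).
move: ct; rewrite in_itv/= => ct.
exists c => //; split; last by move=> u ut; apply: hc; rewrite in_itv.
have -> : regulator x t = `|x c|.
  congr (`|_|); apply/eqP; rewrite eq_le; apply/andP; split.
    apply: ge_inf; last by exists c => //=; rewrite in_itv.
    by exists (x c) => _ [s /= st <-]; exact: hc.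
  apply: lb_le_inf; last by move=> _ [s /= st <-]; exact: hc.
  by exists (x c), c => //=; rewrite in_itv.
by rewrite ler0_norm// -x0; apply: hc; rewrite in_itv/= lexx.
Qed.

Lemma regulator_ge x s t : path0 x -> 0 <= s <= t -> - x s <= regulator x t.
Proof.
move=> px st; have [|c _ [-> h]] := regulator_attained (t := t) px.
  by case/andP: st => h1; exact: le_trans.
by rewrite lerN2 h.
Qed.

Lemma regulator_le x t M : path0 x -> 0 <= t ->
  (forall s, 0 <= s <= t -> - x s <= M) -> regulator x t <= M.
Proof. by move=> px t0 h; have [c /h hc [-> _]] := regulator_attained px t0. Qed.

Lemma regulator_dist x y t e : path0 x -> path0 y -> 0 <= t ->
  (forall s, 0 <= s <= t -> `|x s - y s| <= e) ->
  `|regulator x t - regulator y t| <= e.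
Proof.
move=> px py t0 h.
have h1 : regulator x t <= regulator y t + e.
  apply: regulator_le => // s st; have := regulator_ge py st.
  by have := h s st; rewrite ler_norml => /andP[]; lra.
have h2 : regulator y t <= regulator x t + e.
  apply: regulator_le => // s st; have := regulator_ge px st.
  by have := h s st; rewrite ler_norml => /andP[]; lra.
by rewrite ler_norml; apply/andP; split; lra.
Qed.

Lemma regulator_mono x s t : path0 x -> 0 <= s <= t ->
  regulator x s <= regulator x t.
Proof.
move=> px /andP[s0 st]; apply: regulator_le => // u /andP[u0 us].
by apply: regulator_ge => //; rewrite u0 (le_trans us).
Qed.

Lemma regulator_inc x s t e : path0 x -> 0 <= s <= t ->
  (forall u : R, s <= u <= t -> `|x u - x s| <= e) ->
  regulator x t <= regulator x s + e.
Proof.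
move=> px /andP[s0 st] h; have e0 : 0 <= e.
  by apply: le_trans (h s _); rewrite ?lexx.
apply: regulator_le => //; first exact: le_trans st.
move=> u /andP[u0 ut]; case: (leP u s) => us.
  by have := regulator_ge (s := u) (t := s) px; rewrite u0 us => /(_ isT); lra.
have := regulator_ge (s := s) (t := s) px; rewrite s0 lexx => /(_ isT).
by have := h u; rewrite ut (ltW us) ler_norml => /(_ isT)/andP[]; lra.
Qed.

Lemma regulator0 x : path0 x -> regulator x 0 = 0.
Proof.
move=> px; have [c h [-> _]] := regulator_attained px (lexx 0).
have -> : c = 0 by lra.
by rewrite px.2 oppr0.
Qed.

Lemma cpath_regulator x : path0 x -> cpath (regulator x).
Proof.
move=> px; apply/cpathP => t t0 e e0.
have [d d0 hd] := cpath_unif (t + 1) (px.1) (e := e / 4) ltac:(lra).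
exists (Num.min d 1); first by rewrite lt_min d0 ltr01.
move=> s s0; rewrite lt_min => /andP[sd s1].
have s2 : s <= t + 1 by move: s1; rewrite ltr_norml => /andP[]; lra.
have key a b : 0 <= a <= b -> b <= t + 1 -> `|a - b| < d ->
    `|regulator x b - regulator x a| < e.
  move=> /andP[a0 ab] bt abd.
  have h1 := regulator_mono (s := a) (t := b) px ltac:(by rewrite a0 ab).
  have h2 : regulator x b <= regulator x a + e / 4.
    apply: regulator_inc => //; first by rewrite a0.
    move=> u /andP[au ub]; apply: hd; [apply/andP; lra|apply/andP; lra|].
    move: abd; rewrite ltr_norml => /andP[? ?].
    by rewrite ler_norml; apply/andP; split; lra.
  by rewrite ltr_norml; apply/andP; split; lra.
case: (leP s t) => st.
  by rewrite distrC; apply: key; rewrite ?s0//; lra.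
by apply: key; rewrite ?t0 ?(ltW st)//; rewrite distrC.
Qed.

Lemma cpath_reflected x : path0 x -> cpath (reflected x).
Proof. by move=> px; apply: cpathD; [exact: px.1|exact: cpath_regulator]. Qed.

(** Slope at least 1, as for every sticky clock. It makes the inverse 1-Lipschitz in time, and also
    1-Lipschitz as a function of the clock in the sup norm. *)
Definition expanding v :=
  [/\ cpath v, v 0 = 0 & forall s t, 0 <= s <= t -> t - s <= v t - v s].

Lemma time_inverseP v t : expanding v -> 0 <= t ->
  [/\ 0 <= time_inverse v t, time_inverse v t <= t & v (time_inverse v t) = t].
Proof.
move=> [cv v0 hv] t0.
have [|||c] := @IVT R v 0 t t.
- exact: t0.
- exact: cpath_sub.
- rewrite v0; apply/andP; split; first by rewrite ge_min t0.
  by rewrite le_max; apply/orP; right; have := hv 0 t ltac:(lra); lra.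
rewrite in_itv/= => /andP[c0 ct] vc.
have : [set s | 0 <= s /\ v s = t] (time_inverse v t).
  by apply: (xgetPex 0); exists c.
move=> /= [h1 h2]; split => //.
by have := hv 0 (time_inverse v t) ltac:(lra); lra.
Qed.

(** If [v] reaches level [t] first, then from that instant until [u] reaches [t], the clock [u]
    gains at least the elapsed time; but at that instant [u] was already within [e] of [t]. *)
Lemma time_inverse_dist v (u : R -> R) t e : expanding v -> expanding u -> 0 <= t ->
  (forall s, 0 <= s <= t -> `|v s - u s| <= e) ->
  `|time_inverse v t - time_inverse u t| <= e.
Proof.
move=> ev eu t0 h.
have [a0 a1 a2] := time_inverseP ev t0.
have [b0 b1 b2] := time_inverseP eu t0.
have [_ _ hv] := ev; have [_ _ hu] := eu.
case: (leP (time_inverse v t) (time_inverse u t)) => c.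
  have := hu (time_inverse v t) (time_inverse u t) ltac:(lra).
  have := h (time_inverse v t) ltac:(lra).
  by rewrite !ler_norml => /andP[? ?] ?; apply/andP; split; lra.
have := hv (time_inverse u t) (time_inverse v t) ltac:(lra).
have := h (time_inverse u t) ltac:(lra).
by rewrite !ler_norml => /andP[? ?] ?; apply/andP; split; lra.
Qed.

Lemma time_inverse_lip v s t : expanding v -> 0 <= s -> 0 <= t ->
  `|time_inverse v s - time_inverse v t| <= `|s - t|.
Proof.
move=> ev s0 t0.
have [a0 a1 a2] := time_inverseP ev s0.
have [b0 b1 b2] := time_inverseP ev t0.
have [_ _ hv] := ev.
case: (leP (time_inverse v t) (time_inverse v s)) => c.
  have := hv (time_inverse v t) (time_inverse v s) ltac:(lra).
  by move=> ?; rewrite !ger0_norm; lra.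
have := hv (time_inverse v s) (time_inverse v t) ltac:(lra).
by move=> ?; rewrite !ler0_norm; lra.
Qed.

Lemma expanding_sticky_clock om x : 0 < om -> path0 x ->
  expanding (sticky_clock om x).
Proof.
move=> om0 px; split.
- apply: cpathD; first exact: cpath_id.
  have := cpathZ (c := om^-1) (cpath_regulator px).
  by congr cpath; apply/funext => t; rewrite mulrC.
- by rewrite /sticky_clock regulator0// mul0r addr0.
- move=> s t st; rewrite /sticky_clock.
  have := regulator_mono px st; rewrite -(ler_pM2r (x := om^-1)) ?invr_gt0//; lra.
Qed.

Lemma cpath_sticky om x : 0 < om -> path0 x -> cpath (sticky_path om x).
Proof.
move=> om0 px; have ev := expanding_sticky_clock om0 px.
apply/cpathP => t t0 e e0.
have [a0 a1 a2] := time_inverseP ev t0.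
have /cpathP/(_ _ a0 e e0) [d d0 hd] := cpath_reflected px.
exists d => // s s0 sd; have [b0 b1 b2] := time_inverseP ev s0.
by apply: hd => //; apply: le_lt_trans sd; exact: time_inverse_lip.
Qed.

(** Continuity of the sticky path map with an explicit modulus. Moving the changed time by [d] costs
    [e] for the path and [e] for its regulator; replacing [x] by [y] costs [e'] for each. The two
    stickiness parameters may differ, as the clocks depend on them only through regulator /
    stickiness. *)
Lemma sticky_dist om om' x y (N d e e' : R) : 0 < om -> 0 < om' ->
  path0 x -> path0 y ->
  (forall s t, 0 <= s <= N -> 0 <= t <= N -> `|s - t| <= d -> `|x s - x t| <= e) ->
  (forall t, 0 <= t <= N -> `|x t - y t| <= e') ->
  (forall t, 0 <= t <= N -> `|regulator x t / om - regulator y t / om'| <= d) ->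
  forall t, 0 <= t <= N ->
    `|sticky_path om x t - sticky_path om' y t| <= 2 * e + 2 * e'.
Proof.
move=> om0 om'0 px py hx hxy hR t /andP[t0 tN].
have ev := expanding_sticky_clock om0 px.
have eu := expanding_sticky_clock om'0 py.
have [a0 a1 a2] := time_inverseP ev t0.
have [b0 b1 b2] := time_inverseP eu t0.
have ab : `|time_inverse (sticky_clock om x) t - time_inverse (sticky_clock om' y) t| <= d.
  apply: time_inverse_dist => // s /andP[s0 st]; rewrite /sticky_clock.
  by rewrite opprD addrACA subrr add0r; apply: hR; rewrite s0 (le_trans st).
rewrite /sticky_path; set a := time_inverse _ _ in a0 a1 a2 ab *.
set b := time_inverse _ _ in b0 b1 b2 ab *.
have h1 := hx a b ltac:(lra) ltac:(lra) ab.
have h2 := hxy b ltac:(lra).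
have h3 : `|regulator x b - regulator y b| <= e'.
  by apply: regulator_dist => // s /andP[s0 sb]; apply: hxy; lra.
have h4 : `|regulator x a - regulator x b| <= e.
  have dab := ab; case: (leP a b) => c.
    have := regulator_mono (s := a) (t := b) px ltac:(lra).
    have : regulator x b <= regulator x a + e.
      apply: regulator_inc => //; first by apply/andP.
      move=> u /andP[u1 u2]; rewrite distrC; apply: hx; [lra..|].
      by move: ab; rewrite !ler_norml => /andP[? ?]; lra.
    by move=> ? ?; rewrite ler_norml; lra.
  have := regulator_mono (s := b) (t := a) px ltac:(lra).
  have : regulator x a <= regulator x b + e.
    apply: regulator_inc => //; first by lra.
    move=> u /andP[u1 u2]; apply: hx; [lra..|].
    by move: ab; rewrite !ler_norml => /andP[? ?]; lra.
  by move=> ? ?; rewrite ler_norml; lra.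
rewrite /reflected; move: h1 h2 h3 h4; rewrite !ler_norml.
by move=> /andP[? ?] /andP[? ?] /andP[? ?] /andP[? ?]; apply/andP; split; lra.
Qed.

End paths.

(** * Polygonal interpolation and dyadic chaining *)

Section interpolation.
Context {R : realType}.
Implicit Types (x : R -> R) (s t e h : R) (v : nat -> R).

Definition clamp (u : R) : R := Num.max 0 (Num.min 1 u).

(** The tent supported on [-1, 1], written as a difference so that sums of integer translates
    telescope. *)
Definition hat (u : R) : R := clamp (u + 1) - clamp u.

Lemma clampE (u : R) :
  (u <= 0 /\ clamp u = 0) \/ (0 <= u <= 1 /\ clamp u = u) \/ (1 <= u /\ clamp u = 1).
Proof.
rewrite /clamp; case: (leP 1 u) => u1.
  by right; right; rewrite max_r ?ler01.
by case: (leP 0 u) => u0; [right; left; split => //; lra|left; split => //; lra].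
Qed.

Lemma hat_ge0 u : 0 <= hat u.
Proof. by rewrite /hat; have := clampE u; have := clampE (u + 1); lra. Qed.

Lemma hat_le1 u : hat u <= 1.
Proof. by rewrite /hat; have := clampE u; have := clampE (u + 1); lra. Qed.

Lemma hat_eq0 u : 1 <= `|u| -> hat u = 0.
Proof.
rewrite /hat; have := clampE u; have := clampE (u + 1).
by case: (ger0P u); lra.
Qed.

Lemma clamp_lip (u v : R) : `|clamp u - clamp v| <= `|u - v|.
Proof.
have := clampE u; have := clampE v.
case: (ger0P (u - v)); case: (ger0P (clamp u - clamp v)); lra.
Qed.

Lemma hat_lip (u v : R) : `|hat u - hat v| <= 2 * `|u - v|.
Proof.
have := clamp_lip u v; have := clamp_lip (u + 1) (v + 1).
rewrite /hat opprD addrACA subrr addr0 !ler_norml.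
by move=> /andP[? ?] /andP[? ?]; apply/andP; split; lra.
Qed.

Lemma sum_hat M (u : R) : 0 <= u <= M%:R -> \sum_(i < M.+1) hat (u - i%:R) = 1.
Proof.
move=> uM; rewrite /hat -(big_mkord xpredT (fun i => clamp (u - i%:R + 1) - clamp (u - i%:R))).
transitivity (clamp (u + 1) - clamp (u - M%:R)); last first.
  by have := clampE (u + 1); have := clampE (u - M%:R); lra.
have {uM} -> : forall n, \sum_(0 <= i < n.+1) (clamp (u - i%:R + 1) - clamp (u - i%:R)) =
    clamp (u + 1) - clamp (u - n%:R) => //.
elim=> [|n IH]; first by rewrite big_nat1 subr0.
rewrite big_nat_recr//= IH (_ : u - n.+1%:R + 1 = u - n%:R); first by lra.
by rewrite -natr1; lra.
Qed.

(** The value [v i] sits at the node (i + 1) h. The value at time 0 is 0, and the function falls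
    back to 0 after time M h, so it is meant for [0, M h]. *)
Definition interp h M v t : R := \sum_(i < M) v i * hat (t / h - i.+1%:R).

Lemma interp_lip h M v K s t : 0 < h -> (forall i, (i < M)%N -> `|v i| <= K) ->
  `|interp h M v s - interp h M v t| <= M%:R * (K * (2 / h)) * `|s - t|.
Proof.
move=> h0 hv; rewrite /interp -sumrB (le_trans (ler_norm_sum _ _ _))//.
rewrite -mulrA mulr_natl -[M in leRHS]card_ord -sumr_const ler_sum// => i _.
rewrite -mulrBr normrM -mulrA ler_pM//; first exact: hv.
rewrite (le_trans (hat_lip _ _))// opprD addrACA subrr addr0 -mulrBl.
by rewrite normrM (ger0_norm (x := h^-1)) ?invr_ge0 ?(ltW h0)// [leLHS](_ : _ = 2 / h * `|s - t|)//; ring.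
Qed.

Lemma interp_dist h M v v' e t : (forall i, (i < M)%N -> `|v i - v' i| <= e) ->
  `|interp h M v t - interp h M v' t| <= M%:R * e.
Proof.
move=> hv; rewrite /interp -sumrB (le_trans (ler_norm_sum _ _ _))//.
rewrite mulr_natl -[M in leRHS]card_ord -sumr_const ler_sum// => i _.
rewrite -mulrBl normrM (ger0_norm (hat_ge0 _)) -[leRHS]mulr1.
by rewrite ler_pM// ?hat_ge0 ?hat_le1// hv.
Qed.

Lemma interp_path0 h M v : 0 < h -> path0 (interp h M v).
Proof.
move=> h0; split.
  pose K := \sum_(i < M) `|v i|.
  have hK i : (i < M)%N -> `|v i| <= K.
    move=> iM; rewrite /K (bigD1 (Ordinal iM))//= lerDl.
    by apply: sumr_ge0.
  have K0 : 0 <= K by apply: sumr_ge0.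
  apply/cpathP => t t0 e e0.
  pose L := M%:R * (K * (2 / h)) + 1.
  have L0 : 0 < L.
    by rewrite ltr_wpDl// !mulr_ge0// invr_ge0 ltW.
  exists (e / L); first by rewrite divr_gt0.
  move=> s s0; rewrite ltr_pdivlMr// => hs.
  rewrite (le_lt_trans (interp_lip s t h0 hK))// (le_lt_trans _ hs)//.
  by rewrite mulrC ler_wpM2l// lerDl.
rewrite /interp big1// => i _; rewrite mul0r sub0r hat_eq0 ?mulr0//.
by rewrite normrN ger0_norm// ler1n.
Qed.

Lemma interp_approx h M x e t : 0 < h -> x 0 = 0 -> 0 <= t <= M%:R * h ->
  (forall s, 0 <= s <= M%:R * h -> `|s - t| <= h -> `|x s - x t| <= e) ->
  `|interp h M (fun i => x (i.+1%:R * h)) t - x t| <= e.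
Proof.
move=> h0 x0 /andP[t0 tM] hx.
have -> : interp h M (fun i => x (i.+1%:R * h)) t =
    \sum_(i < M.+1) x (i%:R * h) * hat (t / h - i%:R).
  by rewrite big_ord_recl/= mul0r x0 mul0r add0r.
have s1 : \sum_(i < M.+1) hat (t / h - i%:R) = 1.
  by rewrite sum_hat// divr_ge0 ?(ltW h0)//= ler_pdivrMr.
rewrite -[x t]mulr1 -[in x t * 1]s1 mulr_sumr -sumrB.
rewrite (le_trans (ler_norm_sum _ _ _))// -[e]mulr1 -[X in _ <= e * X]s1 mulr_sumr.
apply: ler_sum => i _; rewrite -mulrBl normrM (ger0_norm (hat_ge0 _)).
have [hi|hi] := leP 1 `|t / h - i%:R|; first by rewrite hat_eq0// !mulr0.
rewrite ler_wpM2r ?hat_ge0// hx//.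
  rewrite mulr_ge0 ?(ltW h0)//= ler_pM2r// ler_nat -ltnS.
  exact: ltn_ord.
move: hi; rewrite -(ltr_pM2r h0) mul1r => /ltW; apply: le_trans.
rewrite -[X in _ <= _ * X](ger0_norm (ltW h0)) -normrM mulrBl divfK ?gt_eqF//.
by rewrite distrC.
Qed.

End interpolation.

Section chaining.
Context {R : realType}.
Implicit Types (x : R -> R) (s t e : R).

(* Any ratio [r < 1] with [1 < 2 * r ^+ 4] would do: the chaining sum and the
   fourth-moment tail sum then both converge geometrically. *)
Definition chain_ratio : R := 9 / 10.
Local Notation r := chain_ratio.

Definition dyadic_floor j s : nat := Num.truncn (s * 2 ^+ j).
Local Notation flr := dyadic_floor.

Let flrP j s : 0 <= s -> (flr j s)%:R <= s * 2 ^+ j < (flr j s).+1%:R.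
Proof. by move=> s0; apply: truncn_itv; rewrite mulr_ge0 ?exprn_ge0. Qed.

(** The constant is 19 = 9 + 9 + 1. With ratio 9/10 the steps finer than level [k] sum to K (r^(k+1)
    + r^(k+2) + ...) = 9 K r^k, once for each of the two times; the floors of the two times at level
    [k] are equal or neighbours, which costs one more step. *)
Lemma dyadic_chaining x (N : nat) K : cpath x -> 0 <= K ->
  (forall j i, (i < N * 2 ^ j)%N ->
    `|x (i.+1%:R / 2 ^+ j) - x (i%:R / 2 ^+ j)| <= K * r ^+ j) ->
  forall k s t, 0 <= s <= N%:R -> 0 <= t <= N%:R -> `|s - t| <= (2 ^+ k)^-1 ->
  `|x s - x t| <= 19 * K * r ^+ k.
Proof.
move=> /cpathP cx K0 hx k.
have r0 n : 0 <= r ^+ n by rewrite exprn_ge0// /chain_ratio; lra.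
have p0 n : 0 < 2 ^+ n :> R by rewrite exprn_gt0.
have step s j : 0 <= s <= N%:R ->
    `|x ((flr j.+1 s)%:R / 2 ^+ j.+1) - x ((flr j s)%:R / 2 ^+ j)| <= K * r ^+ j.+1.
  move=> /andP[s0 sN].
  have /andP[a1 a2] := flrP j s0; have /andP[b1 b2] := flrP j.+1 s0.
  rewrite exprS in b1 b2.
  have c1 : (2 * flr j s <= flr j.+1 s)%N.
    rewrite -ltnS -(ltr_nat R) natrM.
    by move: (2 ^+ j) a1 a2 b1 b2 => q a1 a2 b1 b2; lra.
  have c2 : (flr j.+1 s < 2 * (flr j s).+1)%N.
    rewrite -(ltr_nat R) natrM.
    by move: (2 ^+ j) a1 a2 b1 b2 => q a1 a2 b1 b2; lra.
  have e : (flr j s)%:R / 2 ^+ j = (2 * flr j s)%:R / 2 ^+ j.+1 :> R.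
    by rewrite natrM exprS; field; rewrite gt_eqF.
  have [c3|c3] : (flr j.+1 s = 2 * flr j s \/ flr j.+1 s = (2 * flr j s).+1)%N by clear -c1 c2; lia.
    by rewrite c3 e subrr normr0 mulr_ge0.
  rewrite c3 e; apply: hx; rewrite -ltnS -c3 ltnS -(ler_nat R) natrM natrX.
  by rewrite exprS (le_trans b1)// ler_wpM2r// mulr_ge0// ltW.
(* The difference [r ^+ k - r ^+ (k + m)] is the closed form of the geometric sum; with it the
   induction closes by linear arithmetic. *)
have chain s m : 0 <= s <= N%:R ->
    `|x ((flr (k + m) s)%:R / 2 ^+ (k + m)) - x ((flr k s)%:R / 2 ^+ k)| <=
    9 * K * (r ^+ k - r ^+ (k + m)).
  move=> sN; elim: m => [|m IH]; first by rewrite addn0 !subrr normr0 mulr0.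
  have := step s (k + m)%N sN; rewrite addnS => h1.
  rewrite -(subrKA (x ((flr (k + m) s)%:R / 2 ^+ (k + m)))).
  rewrite (le_trans (ler_normD _ _))// (le_trans (lerD h1 IH))//.
  by rewrite exprS; set q := r ^+ (k + m); rewrite /chain_ratio; lra.
have lim s : 0 <= s <= N%:R -> `|x s - x ((flr k s)%:R / 2 ^+ k)| <= 9 * K * r ^+ k.
  move=> sN; have /andP[s0 _] := sN; apply/ler_addgt0Pr => e e0.
  have [d d0 hd] := cx s s0 e e0.
  have [m hm] : exists m, (2 ^+ (k + m))^-1 < d.
    exists (Num.truncn d^-1).+1.
    rewrite invf_plt ?posrE//.
    rewrite (lt_le_trans (truncnS_gt _))// -natrX ler_nat.
    rewrite (leq_trans (ltnW (ltn_expl _ (ltnSn 1))))// leq_exp2l//.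
    exact: leq_addl.
  have /andP[a1 a2] := flrP (k + m) s0.
  have h1 : `|x ((flr (k + m) s)%:R / 2 ^+ (k + m)) - x s| < e.
    apply: hd; first by rewrite divr_ge0.
    rewrite (le_lt_trans _ hm)// distrC ger0_norm; last first.
      by rewrite subr_ge0 ler_pdivrMr.
    by rewrite lerBlDr -[X in X + _]div1r -mulrDl ler_pdivlMr// addrC natr1 ltW.
  have := chain s m sN; have := r0 (k + m)%N; move=> h2 h3.
  rewrite -(subrKA (x ((flr (k + m) s)%:R / 2 ^+ (k + m)))).
  rewrite (le_trans (ler_normD _ _))// distrC addrC lerD//; last exact: ltW.
  by rewrite (le_trans h3)// mulrBr lerBlDr lerDl !mulr_ge0.
move=> s t.
wlog st : s t / s <= t.
  move=> h; case: (leP s t) => st; first exact: h.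
  by move=> *; rewrite distrC; apply: h => //; [exact: ltW|rewrite distrC].
move=> sN tN; rewrite ler0_norm ?subr_le0// opprB => dst.
have /andP[s0 _] := sN; have /andP[t0 tN'] := tN.
have /andP[a1 a2] := flrP k s0; have /andP[b1 b2] := flrP k t0.
have d1 : t * 2 ^+ k <= s * 2 ^+ k + 1.
  by rewrite -lerBlDl -mulrBl -ler_pdivlMr// div1r.
have st2 : s * 2 ^+ k <= t * 2 ^+ k by rewrite ler_pM2r.
have c1 : (flr k s <= flr k t)%N by rewrite -ltnS -(ltr_nat R); lra.
have c2 : (flr k t < (flr k s).+2)%N.
  by rewrite -(ltr_nat R) -natr1; lra.
have mid : `|x ((flr k s)%:R / 2 ^+ k) - x ((flr k t)%:R / 2 ^+ k)| <= K * r ^+ k.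
  have [c3|c3] : flr k t = flr k s \/ flr k t = (flr k s).+1 by clear -c1 c2; lia.
    by rewrite c3 subrr normr0 mulr_ge0.
  rewrite c3 distrC; apply: hx; rewrite -ltnS -c3 ltnS -(ler_nat R) natrM natrX.
  by rewrite (le_trans b1)// ler_pM2r.
have := lim s sN; have := lim t tN; move: mid.
rewrite !ler_norml => /andP[? ?] /andP[? ?] /andP[? ?].
by apply/andP; split; lra.
Qed.

End chaining.

(** * Spline approximation of functions on boxes *)

Section splines.
Context {R : realType}.
Implicit Types (x y u : R).

Lemma eq_leq_real x y : x = y -> x <= y.
Proof. by move=> ->. Qed.

(** [f1] and [f2] stand for the first two derivatives of [f0]. As a family of uniform inequalities,
    the property passes through sums, shifts and expectations. *)
Definition taylor2 (C : R) (f0 f1 f2 : R -> R) : Prop :=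
  [/\ (forall x y, `|f0 (x + y) - f0 x - f1 x * y - f2 x * y ^+ 2 / 2| <= C * `|y| ^+ 3),
      (forall x y, `|f1 (x + y) - f1 x - f2 x * y| <= C * y ^+ 2) &
      (forall x y, `|f2 (x + y) - f2 x| <= C * `|y|)].

Definition bounded_by (C : R) (f0 f1 f2 : R -> R) : Prop :=
  [/\ (forall x, `|f0 x| <= C), (forall x, `|f1 x| <= C) & (forall x, `|f2 x| <= C)].

Definition smooth2 C f0 f1 f2 := bounded_by C f0 f1 f2 /\ taylor2 C f0 f1 f2.

Definition pos (x : R) : R := Num.max 0 x.

Lemma posE x : (x <= 0 /\ pos x = 0) \/ (0 <= x /\ pos x = x).
Proof.
by rewrite /pos; case: (leP 0 x) => x0; [right; split => //; lra|left; split => //; lra].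
Qed.

(** The cube of the positive part is twice continuously differentiable, and its second derivative is
    Lipschitz with constant 6. *)
Lemma taylor2_pos :
  taylor2 6 (fun x => pos x ^+ 3) (fun x => 3 * pos x ^+ 2) (fun x => 6 * pos x).
Proof.
split=> x y.
- have h0 (a b : R) : 0 <= a <= b -> `|b ^+ 3 - a ^+ 3| <= `|b| ^+ 3.
    move=> /andP[a0 ab]; have b0 := le_trans a0 ab.
    rewrite (ger0_norm b0) ger0_norm; first by rewrite lerBlDr lerDl exprn_ge0.
    by rewrite subr_ge0 ler_pXn2r// nnegrE.
  have h (a b : R) : b <= a <= 0 -> `|b ^+ 3 - a ^+ 3| <= `|b| ^+ 3.
    move=> /andP[ba a0]; have := h0 (- a) (- b) ltac:(lra).
    have e (c : R) : (- c) ^+ 3 = - c ^+ 3 by ring.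
    by rewrite !e opprK addrC distrC normrN.
  have le6 : `|y| ^+ 3 <= 6 * `|y| ^+ 3 by rewrite ler_peMl ?exprn_ge0// ler1n.
  apply: le_trans le6.
  case: (posE x) => -[x0 ->]; case: (posE (x + y)) => -[y0 ->].
  + rewrite [X in `|X|](_ : _ = 0); last by ring.
    by rewrite normr0 exprn_ge0.
  + rewrite [X in `|X|](_ : _ = y ^+ 3 - (y ^+ 3 - (x + y) ^+ 3)); last by ring.
    rewrite opprB addrC subrK normrX ler_pXn2r ?nnegrE//.
    by rewrite !ger0_norm; lra.
  + rewrite [X in `|X|](_ : _ = y ^+ 3 - (x + y) ^+ 3); last by field.
    by apply: h; apply/andP; split; lra.
  + by rewrite [X in `|X|](_ : _ = y ^+ 3) ?normrX//; field.
- case: (posE x) => -[x0 ->]; case: (posE (x + y)) => -[y0 ->];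
    rewrite !exprS expr0 !mulr1 ler_norml; apply/andP; split; nra.
- rewrite -mulrBr normrM ger0_norm// ler_wpM2l//.
  case: (posE x) => -[x0 ->]; case: (posE (x + y)) => -[y0 ->];
    by case: (ger0P y) => y1; rewrite ler_norml; apply/andP; split; lra.
Qed.

Lemma taylor2_le C C' f0 f1 f2 : C <= C' -> taylor2 C f0 f1 f2 -> taylor2 C' f0 f1 f2.
Proof.
move=> CC' [h0 h1 h2]; split => x y; [apply: le_trans (h0 x y) _|
  apply: le_trans (h1 x y) _|apply: le_trans (h2 x y) _]; rewrite ler_wpM2r//.
exact: sqr_ge0.
Qed.

Lemma taylor2D C C' f0 f1 f2 g0 g1 g2 :
  taylor2 C f0 f1 f2 -> taylor2 C' g0 g1 g2 ->
  taylor2 (C + C') (fun x => f0 x + g0 x) (fun x => f1 x + g1 x) (fun x => f2 x + g2 x).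
Proof.
move=> [h0 h1 h2] [k0 k1 k2]; split => x y; rewrite [leRHS]mulrDl.
- apply: (le_trans _ (lerD (h0 x y) (k0 x y))); apply: (le_trans _ (ler_normD _ _)).
  by apply: eq_leq_real; congr (`|_|); ring.
- apply: (le_trans _ (lerD (h1 x y) (k1 x y))); apply: (le_trans _ (ler_normD _ _)).
  by apply: eq_leq_real; congr (`|_|); ring.
- apply: (le_trans _ (lerD (h2 x y) (k2 x y))); apply: (le_trans _ (ler_normD _ _)).
  by apply: eq_leq_real; congr (`|_|); ring.
Qed.

Lemma taylor2Z c C f0 f1 f2 : taylor2 C f0 f1 f2 ->
  taylor2 (`|c| * C) (fun x => c * f0 x) (fun x => c * f1 x) (fun x => c * f2 x).
Proof.
move=> [h0 h1 h2]; split => x y; rewrite -[leRHS]mulrA.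
- apply: (le_trans _ (ler_wpM2l (normr_ge0 c) (h0 x y))); rewrite -normrM.
  by apply: eq_leq_real; congr (`|_|); ring.
- apply: (le_trans _ (ler_wpM2l (normr_ge0 c) (h1 x y))); rewrite -normrM.
  by apply: eq_leq_real; congr (`|_|); ring.
- apply: (le_trans _ (ler_wpM2l (normr_ge0 c) (h2 x y))); rewrite -normrM.
  by apply: eq_leq_real; congr (`|_|); ring.
Qed.

Lemma taylor2_shift s C f0 f1 f2 : taylor2 C f0 f1 f2 ->
  taylor2 C (fun x => f0 (x - s)) (fun x => f1 (x - s)) (fun x => f2 (x - s)).
Proof.
move=> [h0 h1 h2]; split => x y; rewrite (addrAC x y);
  by [exact: h0|exact: h1|exact: h2].
Qed.

Lemma smooth2_affine c s C f0 f1 f2 : smooth2 C f0 f1 f2 ->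
  smooth2 (C * (1 + `|c|) ^+ 3) (fun x => f0 (c * x + s))
    (fun x => c * f1 (c * x + s)) (fun x => c ^+ 2 * f2 (c * x + s)).
Proof.
move=> [[b0 b1 b2] [h0 h1 h2]].
have C0 : 0 <= C by apply: le_trans (b0 0).
set q := (1 + `|c|) ^+ 3.
have n0 : 0 <= `|c| by [].
have q0 : 1 <= q by rewrite /q exprn_ege1// lerDl.
have q1 : `|c| <= q by rewrite /q !exprS expr0 mulr1; nra.
have q2 : `|c| ^+ 2 <= q by rewrite /q !exprS expr0 !mulr1; nra.
have q3 : `|c| ^+ 3 <= q by rewrite /q ler_pXn2r ?nnegrE// ?lerDr// addr_ge0.
split; split.
- by move=> x; apply: le_trans (b0 _) _; rewrite ler_peMr.
- by move=> x; rewrite normrM mulrC ler_pM.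
- by move=> x; rewrite normrM mulrC ler_pM ?normrX.
- move=> x y; have := h0 (c * x + s) (c * y).
  rewrite (_ : c * x + s + c * y = c * (x + y) + s); last by ring.
  rewrite normrM [(`|c| * `|y|) ^+ 3]exprMn => h.
  apply: (le_trans (y := C * (`|c| ^+ 3 * `|y| ^+ 3))); last first.
    by rewrite mulrA ler_wpM2r ?exprn_ge0// ler_wpM2l.
  by apply: (le_trans _ h); apply: eq_leq_real; congr (`|_|); field.
- move=> x y; have := h1 (c * x + s) (c * y).
  rewrite (_ : c * x + s + c * y = c * (x + y) + s); last by ring.
  move=> h; rewrite (_ : _ - _ = c * (f1 (c * (x + y) + s) - f1 (c * x + s) -
    f2 (c * x + s) * (c * y))); last by ring.
  rewrite normrM (le_trans (ler_wpM2l (normr_ge0 c) h))//.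
  rewrite exprMn -(real_normK (num_real c)).
  rewrite (_ : _ * (C * _) = C * (`|c| ^+ 3 * y ^+ 2)); last by ring.
  by rewrite mulrA ler_wpM2r ?sqr_ge0// ler_wpM2l.
- move=> x y; have := h2 (c * x + s) (c * y).
  rewrite (_ : c * x + s + c * y = c * (x + y) + s); last by ring.
  move=> h; rewrite -mulrBr normrM (le_trans (ler_wpM2l (normr_ge0 _) h))//.
  rewrite normrX normrM (_ : _ * (C * _) = C * (`|c| ^+ 3 * `|y|)); last by ring.
  by rewrite mulrA ler_wpM2r// ler_wpM2l.
Qed.

(* Fourth finite difference; with [q = pos ^ 3] it is the cubic B-spline supported
   on [0, 4], whose integer translates sum to 1. *)
Definition bspline (q : R -> R) x : R :=
  6^-1 * (q x + (-4) * q (x - 1) + 6 * q (x - 2) + (-4) * q (x - 3) + 1 * q (x - 4)).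

Definition bump := bspline (fun x => pos x ^+ 3).

(** A generous constant. The Taylor part gives 1 + 4 + 6 + 4 + 1 = 16. For the values, beyond 4 the
    fourth difference of a cubic vanishes; before 4 each truncated power lies in [0, 64], and the
    positive and the negative coefficients each add up to 8 in absolute value, hence at most 8 * 64
    / 6. *)
Lemma smooth2_bump : smooth2 200 bump
  (bspline (fun x => 3 * pos x ^+ 2)) (bspline (fun x => 6 * pos x)).
Proof.
split; last first.
  have h := taylor2_pos.
  have := taylor2Z 6^-1 (taylor2D (taylor2D (taylor2D (taylor2D h
    (taylor2Z (-4) (taylor2_shift 1 h))) (taylor2Z 6 (taylor2_shift 2 h)))
    (taylor2Z (-4) (taylor2_shift 3 h))) (taylor2Z 1 (taylor2_shift 4 h))).
  apply: taylor2_le; rewrite normrN !ger0_norm//; lra.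
have e x (q : R -> R) (B : R) : (forall y, y <= 0 -> q y = 0) ->
    (forall y, 0 <= y <= 4 -> 0 <= q y <= B) ->
    (forall y, 0 <= y -> q (y + 4) + (-4) * q (y + 3) + 6 * q (y + 2) +
      (-4) * q (y + 1) + 1 * q y = 0) -> 0 <= B <= 64 ->
    `|bspline q x| <= 200.
  move=> q0 qB q4 /andP[B0 B1]; rewrite /bspline.
  case: (leP 4 x) => x4.
    have := q4 (x - 4) ltac:(lra); rewrite subrK.
    rewrite (_ : x - 4 + 3 = x - 1); last by lra.
    rewrite (_ : x - 4 + 2 = x - 2); last by lra.
    rewrite (_ : x - 4 + 1 = x - 3); last by lra.
    by move=> ->; rewrite mulr0 normr0.
  have qb y : y <= 4 -> 0 <= q y <= B.
    case: (leP y 0) => y0 y4; first by rewrite q0// lexx.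
    by apply: qB; rewrite ltW.
  have := qb x (ltW x4); have := qb (x - 1) ltac:(lra).
  have := qb (x - 2) ltac:(lra); have := qb (x - 3) ltac:(lra).
  have := qb (x - 4) ltac:(lra).
  move=> /andP[? ?] /andP[? ?] /andP[? ?] /andP[? ?] /andP[? ?].
  by rewrite ler_norml; apply/andP; split; lra.
have p0 y : y <= 0 -> pos y = 0 by case: (posE y) => -[]; lra.
have p1 y : 0 <= y -> pos y = y by case: (posE y) => -[]; lra.
split=> x.
- apply: (e x _ 64) => [y /p0 ->|y /andP[y0 y4]|y y0|]; first by ring.
  + rewrite p1// exprn_ge0//= (_ : 64 = 4 ^+ 3); last by ring.
    by rewrite ler_pXn2r// nnegrE.
  + by rewrite !p1; [ring|lra..].
  + by lra.
- apply: (e x _ 48) => [y /p0 ->|y /andP[y0 y4]|y y0|]; first by ring.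
  + rewrite p1// mulr_ge0 ?exprn_ge0//= (_ : 48 = 3 * 4 ^+ 2); last by ring.
    by rewrite ler_wpM2l// ler_pXn2r// nnegrE.
  + by rewrite !p1; [ring|lra..].
  + by lra.
- apply: (e x _ 24) => [y /p0 ->|y /andP[y0 y4]|y y0|]; first by ring.
  + by rewrite p1//; apply/andP; split; lra.
  + by rewrite !p1; [ring|lra..].
  + by lra.
Qed.

Lemma pos_le0 x : x <= 0 -> pos x = 0.
Proof. by case: (posE x) => -[]; lra. Qed.

Lemma pos_ge0 x : 0 <= x -> pos x = x.
Proof. by case: (posE x) => -[]; lra. Qed.

(** Only the first half of the spline is computed; the last case is its symmetry about 2. *)
Lemma bump_cases u :
  [\/ u <= 0 /\ bump u = 0, 0 <= u <= 1 /\ bump u = 6^-1 * u ^+ 3,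
     1 <= u <= 2 /\ bump u = 6^-1 * (u ^+ 3 - 4 * (u - 1) ^+ 3) |
     2 <= u /\ bump u = bump (4 - u)].
Proof.
have P0 := pos_le0; have P1 := pos_ge0.
rewrite /bump /bspline; case: (leP u 0) => u0.
  by constructor 1; split => //; rewrite !P0; [ring|lra..].
case: (leP u 1) => u1.
  constructor 2; split; first by lra.
  by rewrite (P1 u) ?P0; [ring|lra..].
case: (leP u 2) => u2.
  constructor 3; split; first by lra.
  by rewrite (P1 u) ?(P1 (u - 1)) ?P0; [ring|lra..].
constructor 4; split; first exact: ltW.
rewrite (P1 u) ?(P1 (u - 1)) ?(P1 (u - 2)) ?(P0 (4 - u - 2)) ?(P0 (4 - u - 3))
  ?(P0 (4 - u - 4)); [|lra..].
case: (leP u 3) => u3.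
  by rewrite (P1 (4 - u)) ?(P1 (4 - u - 1)) ?(P0 (u - 3)) ?(P0 (u - 4)); [field|lra..].
case: (leP u 4) => u4.
  by rewrite (P1 (4 - u)) ?(P0 (4 - u - 1)) ?(P1 (u - 3)) ?(P0 (u - 4)); [field|lra..].
by rewrite (P0 (4 - u)) ?(P0 (4 - u - 1)) ?(P1 (u - 3)) ?(P1 (u - 4)); [field|lra..].
Qed.

Lemma bump_ge0 u : 0 <= bump u.
Proof.
have key x : x <= 2 -> 0 <= bump x.
  move=> x2; have [[_ ->//]|[h ->]|[/andP[h1 h2] ->]|[h e]] := bump_cases x.
  - by rewrite mulr_ge0// exprn_ge0//; case/andP: h.
  - rewrite mulr_ge0// (_ : _ - _ = 1 + 3 * (x - 1) + 3 * (x - 1) ^+ 2 * (2 - x)); last by ring.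
    by rewrite !addr_ge0 ?mulr_ge0 ?sqr_ge0//; lra.
  - have -> : x = 2 by lra.
    by rewrite /bump /bspline !exprS expr0 (pos_ge0 (x := 2)) ?(pos_ge0 (x := 2 - 1)) ?pos_le0; lra.
case: (leP u 2) => u2; first exact: key.
by have [[h]|[h]|[h]|[h ->]] := bump_cases u; [lra..|apply: key; lra].
Qed.

Lemma bump_eq0 u : u <= 0 \/ 4 <= u -> bump u = 0.
Proof.
have key x : x <= 0 -> bump x = 0.
  by move=> x0; rewrite /bump /bspline !pos_le0; [ring|lra..].
move=> [|u4]; first exact: key.
by have [[h]|[h]|[h]|[h ->]] := bump_cases u; [lra..|apply: key; lra].
Qed.

(** The sum of all translates of [bump] by nonnegative integers, in closed form: its backward
    difference is [bump], so partial sums of translates telescope. *)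
Definition smoothstep u : R :=
  6^-1 * (pos u ^+ 3 - 3 * pos (u - 1) ^+ 3 + 3 * pos (u - 2) ^+ 3 - pos (u - 3) ^+ 3).

Lemma bump_smoothstep u : bump u = smoothstep u - smoothstep (u - 1).
Proof.
rewrite /bump /bspline /smoothstep.
rewrite (_ : u - 1 - 1 = u - 2); last by lra.
rewrite (_ : u - 1 - 2 = u - 3); last by lra.
rewrite (_ : u - 1 - 3 = u - 4); last by lra.
by ring.
Qed.

Lemma smoothstep0 u : u <= 0 -> smoothstep u = 0.
Proof. by move=> u0; rewrite /smoothstep !pos_le0; [ring|lra..]. Qed.

Lemma smoothstep1 u : 3 <= u -> smoothstep u = 1.
Proof. by move=> u0; rewrite /smoothstep !pos_ge0; [field|lra..]. Qed.

Lemma smoothstep_sum L u :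
  \sum_(i < L) bump (u - i%:R) = smoothstep u - smoothstep (u - L%:R).
Proof.
elim: L => [|L IH]; first by rewrite big_ord0 subr0 subrr.
rewrite big_ord_recr/= IH bump_smoothstep.
by rewrite (_ : u - L%:R - 1 = u - L.+1%:R); [ring|rewrite -natr1; ring].
Qed.

Lemma sum_bump1 L u : 3 <= u <= L%:R -> \sum_(i < L) bump (u - i%:R) = 1.
Proof.
by move=> uL; rewrite smoothstep_sum smoothstep1 ?smoothstep0 ?subr0//; lra.
Qed.

Lemma sum_bump_le1 L u : \sum_(i < L) bump (u - i%:R) <= 1.
Proof.
have ge0 x : 0 <= smoothstep x.
  have [n hn] : exists n : nat, x - n%:R <= 0.
    by exists (Num.truncn x).+1; have := truncnS_gt x; lra.
  have := smoothstep_sum n x; rewrite (smoothstep0 hn) subr0 => <-.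
  by apply: sumr_ge0 => i _; exact: bump_ge0.
have le1 x : smoothstep x <= 1.
  have [n hn] : exists n : nat, 3 <= x + n%:R.
    by exists (Num.truncn (3 - x)).+1; have := truncnS_gt (3 - x); lra.
  have := smoothstep_sum n (x + n%:R); rewrite (smoothstep1 hn) addrK => e.
  have : 0 <= \sum_(i < n) bump (x + n%:R - i%:R).
    by apply: sumr_ge0 => i _; exact: bump_ge0.
  by lra.
by rewrite smoothstep_sum; have := ge0 (u - L%:R); have := le1 u; lra.
Qed.

End splines.

(** * Tensor products of splines *)

Section quasi_interpolation.
Context {R : realType}.
Implicit Types (g : (nat -> R) -> R) (v : nat -> R).

Definition knot (J i : nat) (e : R) : R := (i%:R - J%:R) * e.

Definition knots M L J e (p : {ffun 'I_M -> 'I_L}) (k : nat) : R :=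
  oapp (fun i => knot J (p i) e) 0 (insub k).

(** The coefficients are the values of [g] at the knots of a grid with [L] knots per axis, shifted
    by [J] so as to surround the origin. Each term is a product of functions of one coordinate. *)
Definition quasi_interp M L J e g v : R :=
  \sum_(p : {ffun 'I_M -> 'I_L})
    g (knots J e p) * \prod_(k < M) bump (v k / e + J%:R - (p k)%:R).

Lemma knotsE M L J e (p : {ffun 'I_M -> 'I_L}) (k : 'I_M) :
  knots J e p k = knot J (p k) e.
Proof. by rewrite /knots valK. Qed.

Lemma quasi_interp_bound M L J e g v C : (forall v, `|g v| <= C) ->
  `|quasi_interp M L J e g v| <= C.
Proof.
move=> hg; have C0 : 0 <= C by apply: le_trans (hg (fun=> 0)).
apply: le_trans (ler_norm_sum _ _ _) _.
apply: (le_trans (y := \sum_(p : {ffun 'I_M -> 'I_L})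
    C * \prod_(k < M) bump (v k / e + J%:R - (p k)%:R))).
  apply: ler_sum => p _; rewrite normrM (@ger0_norm _ (\prod_(_ < _) _)).
    by rewrite ler_wpM2r// prodr_ge0// => k _; exact: bump_ge0.
  by rewrite prodr_ge0// => k _; exact: bump_ge0.
rewrite -mulr_sumr.
rewrite -(bigA_distr_bigA (fun (k : 'I_M) (i : 'I_L) => bump (v k / e + J%:R - i%:R))).
rewrite -[leRHS]mulr1 ler_wpM2l//; apply: prodr_ile1 => k _.
by rewrite sum_bump_le1 sumr_ge0// => i _; exact: bump_ge0.
Qed.

(** Inside the box the weights sum to 1, and a nonzero weight belongs to a knot within [4 * e] of
    [v], since [bump] lives on [0, 4]. The 3 in [J - 3] is the distance to the edge that [sum_bump1]
    asks for. *)
Lemma quasi_interp_close M J e g v K C : 0 < e -> K <= (J%:R - 3) * e ->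
  (forall k, (k < M)%N -> `|v k| <= K) ->
  (forall w, (forall k, (k < M)%N -> `|w k - v k| <= 4 * e) -> `|g w - g v| <= C) ->
  `|quasi_interp M (2 * J) J e g v - g v| <= C.
Proof.
move=> e0 KJ hv hg.
have sum1 : \sum_(p : {ffun 'I_M -> 'I_(2 * J)})
    \prod_(k < M) bump (v k / e + J%:R - (p k)%:R) = 1.
  rewrite -(bigA_distr_bigA (fun (k : 'I_M) (i : 'I_(2 * J)) => bump (v k / e + J%:R - i%:R))).
  rewrite big1// => k _; apply: sum_bump1.
  have : `|v k / e| <= J%:R - 3.
    by rewrite normrM (ger0_norm (x := e^-1)) ?invr_ge0 ?(ltW e0)// ler_pdivrMr// (le_trans (hv k _)).
  by rewrite ler_norml natrM => /andP[? ?]; apply/andP; split; lra.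
have p0 (p : {ffun 'I_M -> 'I_(2 * J)}) :
    0 <= \prod_(k < M) bump (v k / e + J%:R - (p k)%:R).
  by rewrite prodr_ge0// => k _; exact: bump_ge0.
rewrite /quasi_interp -[g v]mulr1 -[in X in _ - X]sum1 mulr_sumr -sumrB.
apply: le_trans (ler_norm_sum _ _ _) _.
rewrite -[C]mulr1 -[X in _ <= C * X]sum1 mulr_sumr; apply: ler_sum => p _.
rewrite -mulrBl normrM (ger0_norm (p0 p)).
have [[k hk]|h] := pselect (exists k : 'I_M, bump (v k / e + J%:R - (p k)%:R) = 0).
  by rewrite (bigD1 k)//= hk mul0r !mulr0.
rewrite ler_wpM2r//; apply: hg => k kM.
rewrite (knotsE J e p (Ordinal kM)) /knot.
have {}h : ~ (bump (v k / e + J%:R - (p (Ordinal kM))%:R) = 0).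
  by move=> hk; apply: h; exists (Ordinal kM).
set a : R := (p (Ordinal kM))%:R in h *.
have [h1|h1] := leP (v k / e + J%:R - a) 0.
  by exfalso; apply: h; apply: bump_eq0; left.
have [h2|h2] := leP 4 (v k / e + J%:R - a).
  by exfalso; apply: h; apply: bump_eq0; right.
have -> : (a - J%:R) * e - v k = - (v k / e + J%:R - a) * e.
  by field; rewrite gt_eqF.
by rewrite normrM normrN (ger0_norm (ltW h1)) (ger0_norm (ltW e0)) ler_wpM2r// ltW.
Qed.

(* Uniform continuity on boxes in the coordinates [k < M]; in particular [g]
   depends only on these coordinates. *)
Definition box_ucont (M : nat) g := forall K e, 0 < e -> exists2 d, 0 < d &
  forall v w, (forall k, (k < M)%N -> [/\ `|v k| <= K, `|w k| <= K & `|v k - w k| <= d]) ->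
  `|g v - g w| <= e.

(** With spacing 1 / (n + 1) and J = (n + 1)^2 + 3, the box on which the weights sum to 1 has
    half-width n + 1: it grows while the mesh shrinks. *)
Definition smooth_approx M g (n : nat) : (nat -> R) -> R :=
  quasi_interp M (2 * (n.+1 * n.+1 + 3)) (n.+1 * n.+1 + 3) n.+1%:R^-1 g.

Lemma smooth_approx_cvg M g K e : box_ucont M g -> 0 < e ->
  \forall n \near \oo, forall v, (forall k, (k < M)%N -> `|v k| <= K) ->
    `|smooth_approx M g n v - g v| <= e.
Proof.
move=> ug e0; have [d d0 hd] := ug (K + 4) e e0.
have d40 : 0 < d / 4 by lra.
near=> n => v hv; apply: (@quasi_interp_close _ _ _ _ _ K) => //.
- rewrite natrD addrK natrM mulfK//.
  apply: (@le_trans _ _ n%:R); last by rewrite ler_nat.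
  by near: n; exact: nbhs_infty_ger.
- move=> w hw; apply: hd => k kM; have := hw k kM; have := hv k kM.
  have i0 : n.+1%:R^-1 <= 1 :> R by rewrite invf_le1 ?ltr0n// ler1n.
  have i1 : n.+1%:R^-1 <= d / 4.
    by near: n; apply: filterS (near_infty_natSinv_lt (PosNum d40)) => m /ltW.
  move: (n.+1%:R^-1) i0 i1 => q i0 i1 h1 h2.
  split; [|by lra|by apply: le_trans h2 _; lra].
  by rewrite -(subrK (v k) (w k)) (le_trans (ler_normD _ _))//; lra.
Unshelve. all: by end_near.
Qed.

End quasi_interpolation.

(** * Gaussian moments and the heat semigroup *)

Section normal_moments.
Context {R : realType}.
Local Notation mu := (@lebesgue_measure R).
Import HBNNSimple.

(** Extension from indicators to simple functions and monotone limits. It serves the moment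
    generating function, from which all Gaussian moments are then drawn. *)
Lemma integral_normal_prob (m s : R) (f : measurableTypeR R -> \bar R) :
  measurable_fun setT f -> (forall x, 0 <= f x)%E ->
  (\int[normal_prob m s]_x f x = \int[mu]_x (f x * (normal_pdf m s x)%:E))%E.
Proof.
have mpdf : measurable_fun setT (fun x => (normal_pdf m s x)%:E).
  by apply/measurable_EFinP; apply: measurable_normal_pdf.
have pdf0 x : (0 <= (normal_pdf m s x)%:E)%E by rewrite lee_fin normal_pdf_ge0.
have ind E : measurable E -> (\int[normal_prob m s]_x (\1_E x)%:E =
    \int[mu]_x ((\1_E x)%:E * (normal_pdf m s x)%:E))%E.
  move=> mE; rewrite integral_indic//= setIT /normal_prob integral_mkcond.
  apply: eq_integral => x _; rewrite patchE indicE.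
  by case: ifPn => _; rewrite ?mul1e ?mul0e.
have nns (g : {nnsfun _ >-> R}) : (\int[normal_prob m s]_x (g x)%:E =
    \int[mu]_x ((g x)%:E * (normal_pdf m s x)%:E))%E.
  under [LHS]eq_integral do rewrite fimfunE -fsumEFin//.
  rewrite [LHS]ge0_integral_fsum//; last 2 first.
    - by move=> r; exact/measurable_EFinP/measurableT_comp.
    - by move=> n x _; rewrite EFinM nnfun_muleindic_ge0.
  under [RHS]eq_integral.
    move=> x xD; rewrite fimfunE -fsumEFin// muleC ge0_mule_fsumr; last first.
      by move=> r; rewrite EFinM nnfun_muleindic_ge0.
    over.
  rewrite [RHS]ge0_integral_fsum//; last 2 first.
    - move=> r; apply: emeasurable_funM => //.
      by apply/measurable_EFinP; apply/measurableT_comp.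
    - by move=> n x _; rewrite mule_ge0// EFinM nnfun_muleindic_ge0.
  apply: eq_fsbigr => r _.
  rewrite integralZl_indic_nnsfun//= ind//.
  have [r0|r0] := leP 0%R r.
    rewrite -ge0_integralZl//=.
    - by apply: eq_integral => x _; rewrite [RHS]muleC EFinM -muleA.
    - by apply: emeasurable_funM => //; exact/measurable_EFinP/measurable_indic.
    - by move=> x _; rewrite mule_ge0// lee_fin.
  rewrite preimage_nnfun0// indic0 !integral0_eq ?mule0// => x _.
  - by rewrite /= mulr0 mule0.
  - by rewrite mul0e.
move=> mf f0; pose f_ := nnsfun_approx measurableT mf.
transitivity (lim (\int[normal_prob m s]_x (f_ n x)%:E @[n --> \oo])%E).
  rewrite -monotone_convergence//=.
  - apply: eq_integral => ? _; apply/esym/cvg_lim => //=.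
    by apply: cvg_nnsfun_approx.
  - by move=> n; apply/measurable_EFinP.
  - by move=> n ? _; rewrite lee_fin.
  - by move=> ? _ ? ? mn; rewrite lee_fin; exact/lefP/nd_nnsfun_approx.
transitivity (lim (\int[mu]_x ((f_ n x)%:E * (normal_pdf m s x)%:E) @[n --> \oo])%E).
  by apply: congr_lim; apply/funext => n /=; exact: nns.
rewrite -monotone_convergence//=.
- apply: eq_integral => x _; apply/cvg_lim => //=.
  by apply: cvgeMr => //; apply: cvg_nnsfun_approx.
- by move=> n; apply: emeasurable_funM => //; apply: measurableT_comp.
- by move=> n x _; rewrite mule_ge0// lee_fin.
- move=> x _ n n' nn'; apply: lee_wpmul2r => //.
  by rewrite lee_fin; exact/lefP/nd_nnsfun_approx.
Qed.

Lemma measurable_expRM (t : R) : measurable_fun setT (fun x : R => expR (t * x)).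
Proof.
by apply: (measurable_comp (F := setT)) => //; exact: measurable_funM.
Qed.

(** Completing the square: the factor expR (t x) turns the density into a constant times the normal
    density of mean m + t s^2. *)
Lemma normal_mgf (m s t : R) : s != 0 ->
  (\int[normal_prob m s]_x (expR (t * x))%:E =
   (expR (t * m + t ^+ 2 * s ^+ 2 / 2))%:E)%E.
Proof.
move=> s0; rewrite integral_normal_prob; last 2 first.
- apply/measurable_EFinP; exact: measurable_expRM.
- by move=> x; rewrite lee_fin expR_ge0.
transitivity (\int[mu]_x ((expR (t * m + t ^+ 2 * s ^+ 2 / 2))%:E *
    (normal_pdf (m + t * s ^+ 2) s x)%:E))%E.
  apply: eq_integral => x _; rewrite -!EFinM; congr EFin.
  rewrite !normal_pdfE// /normal_fun mulrCA [RHS]mulrCA -!expRD.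
  congr (_ * expR _); field; exact: s0.
rewrite ge0_integralZl//.
- by rewrite integral_normal_pdf mule1.
- by apply/measurable_EFinP; apply: measurable_normal_pdf.
- by move=> x _; rewrite lee_fin normal_pdf_ge0.
Qed.

End normal_moments.

(** * Bounds on the hyperbolic cosine *)

Section exponential_bounds.
Context {R : realType}.
Implicit Types (x : R).

Lemma nonneg_of_derive (f f' : R -> R) : (forall x, is_derive x 1 f (f' x)) ->
  0 <= f 0 -> (forall x, 0 <= x -> 0 <= f' x) -> forall x, 0 <= x -> 0 <= f x.
Proof.
move=> df f0 df0 x x0.
have [|c] := @MVT_segment R f f' 0 x x0 (fun y _ => df y).
  apply: continuous_subspaceT => y.
    by apply/differentiable_continuous/derivable1_diffP; have := df y; case.
rewrite in_itv/= => /andP[c0 _] e.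
have : 0 <= f x - f 0 by rewrite e subr0 mulr_ge0// df0.
by lra.
Qed.

Let q x := expR x + expR (- x).
Let s x := expR x - expR (- x).

Let derN x : is_derive x 1 (fun y : R => expR (- y)) (- expR (- x)).
Proof.
have := @is_derive1_comp R expR (-%R) x (expR (- x)) (-1) _ _.
by rewrite mulrN1; apply.
Qed.

Let dq x : is_derive x 1 q (s x).
Proof. exact: is_deriveD. Qed.

Let ds x : is_derive x 1 s (q x).
Proof.
have h : is_derive x 1 s (expR x - (- expR (- x))) by exact: is_deriveB.
by rewrite opprK in h.
Qed.

Let dlin x : is_derive x 1 (fun y : R => 2 * y) 2.
Proof.
have h : is_derive x 1 (2 \*: (@id R)) (2 *: 1) by exact: is_deriveZ.
by rewrite /GRing.scale/= mulr1 in h.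
Qed.

Let dsqr x : is_derive x 1 (fun y : R => y ^+ 2) (2 * x).
Proof.
have h : is_derive x 1 (fun y : R => y * y) (x *: 1 + x *: 1).
  exact: is_deriveM.
rewrite /GRing.scale/= mulr1 in h.
by rewrite mulr2n mulrDl mul1r.
Qed.

Let ds2 x : is_derive x 1 (fun y => s y - 2 * y) (q x - 2).
Proof. exact: is_deriveB. Qed.

Let dq2 x : is_derive x 1 (fun y => q y - 2) (s x).
Proof.
have h : is_derive x 1 (fun y => q y - 2) (s x - 0) by exact: is_deriveB.
by rewrite subr0 in h.
Qed.

Let dq4 x : is_derive x 1 (fun y => q y - 2 - y ^+ 2) (s x - 2 * x).
Proof. exact: is_deriveB. Qed.

Let le_of_derive (f f' : R -> R) (c X : R) n : (forall x, is_derive x 1 f (f' x)) ->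
  0 <= c -> f 0 <= 0 -> (forall x, 0 <= x <= X -> f' x <= c * x ^+ n) ->
  forall x, 0 <= x <= X -> f x <= c * x ^+ n.+1.
Proof.
move=> df c0 f0 df0 x /andP[x0 xX].
have [|y] := @MVT_segment R f f' 0 x x0 (fun y _ => df y).
  apply: continuous_subspaceT => y.
  by apply/differentiable_continuous/derivable1_diffP; have := df y; case.
rewrite in_itv/= => /andP[y0 yx] e.
have h : f' y <= c * x ^+ n.
  apply: (le_trans (df0 y _)); first by rewrite y0 (le_trans yx).
  by rewrite ler_wpM2l// lerXn2r// nnegrE.
have : f x - f 0 <= c * x ^+ n.+1 by rewrite e subr0 exprSr mulrA ler_wpM2r.
by lra.
Qed.

Let s0 : s 0 = 0. Proof. by rewrite /s oppr0 subrr. Qed.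
Let q0 : q 0 = 2. Proof. by rewrite /q oppr0 expR0; lra. Qed.

Let q_ge0 x : 0 <= q x.
Proof. by rewrite /q addr_ge0// expR_ge0. Qed.

Let s_ge0 x : 0 <= x -> 0 <= s x.
Proof. by apply: (nonneg_of_derive ds) => [|y _]; rewrite ?s0//. Qed.

Let q_ge2 x : 0 <= x -> 0 <= q x - 2.
Proof.
by apply: (nonneg_of_derive dq2) => [|y y0]; [rewrite q0; lra|exact: s_ge0].
Qed.

Let s_ge2 x : 0 <= x -> 0 <= s x - 2 * x.
Proof.
by apply: (nonneg_of_derive ds2) => [|y y0]; [rewrite s0; lra|exact: q_ge2].
Qed.

(** The functions [q] and [s] are derivatives of each other. From [q <= q x] on [0, x], four uses of
    the mean value theorem give the upper bound, each adding one power; the factorials are given up,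
    as only the order x^4 of the remainder matters. *)
Lemma cosh_bounds x :
  x ^+ 2 <= expR x + expR (- x) - 2 <= x ^+ 2 + x ^+ 4 * (expR x + expR (- x)).
Proof.
rewrite -/(q x).
wlog x0 : x / 0 <= x.
  move=> h; case: (leP 0 x) => [|/ltW x0]; first exact: h.
  have e4 : (- x) ^+ 4 = x ^+ 4 by rewrite -[4%N]/(2 * 2)%N !exprM sqrrN.
  have eq' : q (- x) = q x by rewrite /q opprK addrC.
  have x0' : 0 <= - x by rewrite oppr_ge0.
  by have := h (- x) x0'; rewrite eq' sqrrN e4.
apply/andP; split.
  have : 0 <= q x - 2 - x ^+ 2; last by lra.
  apply: (nonneg_of_derive dq4) => [|y y0|//]; last exact: s_ge2.
  by rewrite q0 expr0n/=; lra.
have qQ y : 0 <= y <= x -> q y <= q x * y ^+ 0.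
  move=> /andP[y0 yx]; rewrite expr0 mulr1.
  have [|c] := @MVT_segment R q s y x yx (fun z _ => dq z).
    apply: continuous_subspaceT => z.
    by apply/differentiable_continuous/derivable1_diffP; have := dq z; case.
  rewrite in_itv/= => /andP[yc cx] e.
  have : 0 <= q x - q y by rewrite e mulr_ge0//; [exact/s_ge0/(le_trans y0)|rewrite subr_ge0].
  by lra.
have h1 := le_of_derive ds (q_ge0 x) (eq_leq_real s0) qQ.
have q20 : q 0 - 2 <= 0 by rewrite q0 subrr.
have s20 : s 0 - 2 * 0 <= 0 by rewrite s0 mulr0 subrr.
have q40 : q 0 - 2 - 0 ^+ 2 <= 0 by rewrite q0 subrr expr0n subrr.
have h2 := le_of_derive dq2 (q_ge0 x) q20 h1.
have h3 := le_of_derive ds2 (q_ge0 x) s20 h2.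
have h4 := le_of_derive dq4 (q_ge0 x) q40 h3.
by have := h4 x; rewrite x0 lexx (mulrC (q x)) => /(_ isT); lra.
Qed.

Lemma expR_abs_bound x n : `|x| ^+ n.+1 <= n.+1`!%:R * (expR x + expR (- x)).
Proof.
have h (y : R) : 0 <= y -> y ^+ n.+1 <= n.+1`!%:R * expR y.
  move=> y0; have := expR_ge1Dxn n y0; rewrite -ler_pdivrMl ?ltr0n ?fact_gt0//.
  by rewrite mulrC; lra.
case: (ger0P x) => x0.
  by rewrite (le_trans (h _ x0))// ler_wpM2l// lerDl expR_ge0.
rewrite (le_trans (h _ _))// ?ler_wpM2l ?lerDr ?expR_ge0//.
by rewrite oppr_ge0 ltW.
Qed.

Lemma expR_le1D2x x : 0 <= x <= 1 / 2 -> expR x <= 1 + 2 * x.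
Proof.
move=> /andP[x0 x1]; have := expR_ge1Dx (- x); rewrite expRN => h.
have e0 := expR_gt0 x.
have : (1 - x) * expR x <= 1 by rewrite -ler_pdivlMr// div1r.
by nra.
Qed.

End exponential_bounds.

(** * Gaussian moments *)

Section gaussian_moments.
Context {R : realType} {d : measure_display} {T : measurableType d}.
Variable P : probability T R.
Implicit Types (D : T -> R) (t v : R).

(** The centred Gaussian law of variance [v], seen through its moment generating function alone. *)
Definition gaussian_mgf D v := measurable_fun setT D /\
  forall t, intg P (fun w => expR (t * D w)) /\
    Ex P (fun w => expR (t * D w)) = expR (t ^+ 2 * v / 2).

Lemma gaussian_mgfN D v : gaussian_mgf D v -> gaussian_mgf (fun w => - D w) v.
Proof.
move=> [mD h]; split; first exact: measurableT_comp.
move=> t; have [h1 h2] := h (- t); rewrite sqrrN in h2; rewrite -h2.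
have e : (fun w => expR (t * - D w)) = (fun w => expR (- t * D w)).
  by apply/funext => w; rewrite mulrN mulNr.
by rewrite e.
Qed.

Let qf D t w : R := expR (t * D w) + expR (- (t * D w)).

Let iqf D v t : gaussian_mgf D v -> intg P (qf D t).
Proof.
move=> gD.
apply: intgD; first exact: (gD.2 t).1.
rewrite (_ : (fun w => _) = (fun w => expR (- t * D w))); first exact: (gD.2 (- t)).1.
by apply/funext => w; rewrite mulNr.
Qed.

Let Eqf D v t : gaussian_mgf D v -> Ex P (qf D t) = 2 * expR (t ^+ 2 * v / 2).
Proof.
move=> gD.
have e : (fun w => expR (- (t * D w))) = (fun w => expR (- t * D w)).
  by apply/funext => w; rewrite mulNr.
rewrite /qf ExD; last 2 first.
- exact: (gD.2 t).1.
- by rewrite e; exact: (gD.2 (- t)).1.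
by rewrite e (gD.2 t).2 (gD.2 (- t)).2 sqrrN; lra.
Qed.

Lemma gaussian_intg_abs D v n : gaussian_mgf D v -> intg P (fun w => `|D w| ^+ n.+1).
Proof.
move=> gD; apply: (@intg_le _ _ _ P _ (fun w => n.+1`!%:R * qf D 1 w)).
- by apply: measurable_funX; apply: measurableT_comp => //; exact: gD.1.
- exact/intgZ/(iqf 1 gD).
- by move=> w; rewrite ger0_norm ?exprn_ge0// /qf mul1r expR_abs_bound.
Qed.

Lemma gaussian_intg D v : gaussian_mgf D v -> intg P D.
Proof.
by move=> gD; apply: (intg_le gD.1 (gaussian_intg_abs 0 gD)) => w; rewrite expr1.
Qed.

Lemma gaussian_intg_sqr D v : gaussian_mgf D v -> intg P (fun w => D w ^+ 2).
Proof.
move=> gD; apply: (intg_le _ (gaussian_intg_abs 1 gD)) => [|w].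
  by apply: measurable_funX; exact: gD.1.
by rewrite normrX.
Qed.

(** From 1 + t E[D] <= exp (t^2 v / 2), divided by t, as t tends to 0 from above. Applied to - D it
    gives the other sign in [gaussian_mean]. *)
Lemma gaussian_mean_le0 D v : 0 < v -> gaussian_mgf D v -> Ex P D <= 0.
Proof.
move=> v0 gD.
apply/ler_addgt0Pr => e e0; rewrite add0r.
have v1 : 0 < 1 + v by lra.
pose t := Num.min (1 / (1 + v)) (e / (1 + v)).
have t0 : 0 < t by rewrite lt_min !divr_gt0.
have tv : t * (1 + v) <= 1.
  by rewrite -ler_pdivlMr// ge_min lexx.
have te : t * (1 + v) <= e.
  by rewrite -ler_pdivlMr// ge_min lexx orbT.
clearbody t.
have h : 1 + t * Ex P D <= expR (t ^+ 2 * v / 2).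
  rewrite -(gD.2 t).2 -ExZ; last exact: (gaussian_intg gD).
  rewrite -{1}(Ex_cst P 1) -ExD; [|exact: intg_cst|exact/intgZ/(gaussian_intg gD)].
  apply: Ex_le => [||w]; [|exact: (gD.2 t).1|exact: expR_ge1Dx].
  by apply: intgD; [exact: intg_cst|exact/intgZ/(gaussian_intg gD)].
have h2 := @expR_le1D2x _ (t ^+ 2 * v / 2).
have t1 : t * v <= 1 by nra.
have t2 : t <= 1 by nra.
have h3 : 0 <= t ^+ 2 * v / 2 <= 1 / 2.
  by rewrite expr2; apply/andP; split; nra.
have {h2} h2 := h2 h3.
have : t * Ex P D <= t * (t * v).
  by rewrite mulrA -expr2; lra.
by rewrite ler_pM2l// => h4; nra.
Qed.

(** [cosh_bounds] at t D puts 2 exp (t^2 v / 2) - 2 between t^2 E[D^2] and t^2 E[D^2] + K t^4;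
    dividing by t^2 and letting t tend to 0 identifies the variance. *)
Lemma gaussian_var D v : 0 < v -> gaussian_mgf D v -> Ex P (fun w => D w ^+ 2) = v.
Proof.
move=> v0 gD; pose q := qf D.
have iq t : intg P (q t) by exact: (iqf t gD).
have Eq t : Ex P (q t) = 2 * expR (t ^+ 2 * v / 2) by exact: (Eqf t gD).
have isq := gaussian_intg_sqr gD.
have v1 : 0 < 1 + v by lra.
move E2 : (Ex P _) => m2.
have small t : 0 < t -> t * (1 + v) <= 1 -> 0 <= t ^+ 2 * v / 2 <= 1 / 2.
  move=> t0 t1; have t2 : t * v <= 1 by nra.
  have t3 : t <= 1 by nra.
  by rewrite expr2; apply/andP; split; nra.
(* For t <= 1, D^4 <= 24 q 1 and q t <= 2 q 1, while (q 1)^2 = q 2 + 2: hence the dominating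
   variable 48 (q 2 + 2), whose expectation does not depend on t. *)
have [K K0 KE] : exists2 K, 0 <= K & K = Ex P (fun w => 48 * (q 2 w + 2)).
  exists (48 * (2 * expR (2 ^+ 2 * v / 2) + 2)).
    by have := expR_gt0 (2 ^+ 2 * v / 2); lra.
  rewrite ExZ; last by apply: intgD; [exact: iq|exact: intg_cst].
  by rewrite ExD; [|exact: iq|exact: intg_cst]; rewrite Eq Ex_cst.
have up t : 0 < t -> t * (1 + v) <= 1 -> m2 <= v + t ^+ 2 * v ^+ 2.
  move=> t0 t1; have h1 : t ^+ 2 * m2 <= 2 * expR (t ^+ 2 * v / 2) - 2.
    rewrite -Eq -E2 -ExZ; last exact: isq.
    rewrite -(Ex_cst P 2) -ExB; [|exact: iq|exact: intg_cst].
    apply: Ex_le => [||w]; first exact/intgZ/isq.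
      by apply: intgD; [exact: iq|exact: intg_cst].
    by have /andP[+ _] := cosh_bounds (t * D w); rewrite exprMn.
  have /andP[s1 s2] := small t t0 t1.
  have h2 : expR (t ^+ 2 * v / 2) <= 1 + t ^+ 2 * v / 2 + 2 * (t ^+ 2 * v / 2) ^+ 2.
    move: (t ^+ 2 * v / 2) s1 s2 => x s1 s2.
    have := expR_ge1Dx (- x); rewrite expRN => h; have e0 := expR_gt0 x.
    have h3 : (1 - x) * expR x <= 1 by rewrite -ler_pdivlMr// div1r.
    by rewrite expr2; nra.
  have t20 : 0 < t ^+ 2 by rewrite exprn_gt0.
  rewrite -(ler_pM2l t20) (le_trans h1)//.
  by move: (t ^+ 2) h2 => y h2; move: h2; rewrite !exprMn expr2; lra.
have lo t : 0 < t -> t * (1 + v) <= 1 -> v <= m2 + t ^+ 2 * K.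
  move=> t0 t1.
  have t3 : t <= 1 by nra.
  have t20 : 0 < t ^+ 2 by rewrite exprn_gt0.
  have h0 w : q t w - 2 <= t ^+ 2 * D w ^+ 2 + t ^+ 4 * (48 * (q 2 w + 2)).
    have /andP[_ h] := cosh_bounds (t * D w); apply: (le_trans h).
    rewrite !exprMn lerD2l -mulrA ler_wpM2l ?exprn_ge0 ?(ltW t0)//.
    have h4 : D w ^+ 4 <= 24 * q 1 w.
      have := expR_abs_bound (D w) 3; rewrite /q /qf mul1r.
      by rewrite -normrX ger0_norm// ?exprn_even_ge0.
    have h5 : q t w <= 2 * q 1 w.
      have e1 : expR (t * D w) <= q 1 w.
        rewrite /q /qf mul1r; have p1 := expR_gt0 (D w); have p2 := expR_gt0 (- D w).
        case: (leP 0 (D w)) => Dw.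
          have : expR (t * D w) <= expR (D w) by rewrite ler_expR; nra.
          by lra.
        have : expR (t * D w) <= expR (- D w) by rewrite ler_expR; nra.
        by lra.
      have e2 : expR (- (t * D w)) <= q 1 w.
        rewrite /q /qf mul1r; have p1 := expR_gt0 (D w); have p2 := expR_gt0 (- D w).
        case: (leP 0 (D w)) => Dw.
          have : expR (- (t * D w)) <= expR (D w) by rewrite ler_expR; nra.
          by lra.
        have : expR (- (t * D w)) <= expR (- D w) by rewrite ler_expR; nra.
        by lra.
      by rewrite {1}/q /qf; lra.
    have h6 : q 1 w * q 1 w = q 2 w + 2.
      rewrite /q /qf mul1r mulrDl !mulrDr -!expRD subrr addNr expR0.
      have e1 : D w + D w = 2 * D w by lra.
      rewrite -opprD e1; move: (expR _) (expR _) => a b; lra.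
    have q0 s : 0 <= q s w by rewrite addr_ge0 ?expR_ge0.
    apply: (@le_trans _ _ ((24 * q 1 w) * (2 * q 1 w))).
      by rewrite ler_pM// ?exprn_even_ge0.
    by rewrite mulrACA h6; lra.
  have h1 : 2 * expR (t ^+ 2 * v / 2) - 2 <= t ^+ 2 * m2 + t ^+ 4 * K.
    have i48 : intg P (fun w => 48 * (q 2 w + 2)).
      by apply: intgZ; apply: intgD; [exact: iq|exact: intg_cst].
    rewrite -Eq -E2 -ExZ; last exact: isq.
    rewrite -(Ex_cst P 2) -ExB; [|exact: iq|exact: intg_cst].
    rewrite KE -ExZ// -ExD; [|exact/intgZ/isq|exact: intgZ].
    apply: Ex_le => [||w]; [|apply: intgD; [exact/intgZ/isq|exact: intgZ]|exact: h0].
    by apply: intgD; [exact: iq|exact: intg_cst].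
  have h2 := expR_ge1Dx (t ^+ 2 * v / 2).
  have : t ^+ 2 * v <= t ^+ 2 * (m2 + t ^+ 2 * K).
    by rewrite mulrDr mulrA -exprD; lra.
  by rewrite ler_pM2l.
have pick e C : 0 < e -> 0 <= C -> exists2 t, 0 < t & t * (1 + v) <= 1 /\ t ^+ 2 * C <= e.
  move=> e0 C0; have C1 : 0 < 1 + C by lra.
  pose t := Num.min (1 / (1 + v)) (e / (1 + C)).
  have t0 : 0 < t by rewrite lt_min !divr_gt0.
  have tv : t * (1 + v) <= 1 by rewrite -ler_pdivlMr// ge_min lexx.
  have te : t * (1 + C) <= e by rewrite -ler_pdivlMr// ge_min lexx orbT.
  clearbody t; exists t => //; split => //; have t1 : t <= 1 by nra.
  by rewrite expr2; nra.
apply/eqP; rewrite eq_le; apply/andP; split; apply/ler_addgt0Pr => e e0.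
  have [|t t0 [t1 t2]] := pick e (v ^+ 2) e0; first exact: sqr_ge0.
  by rewrite (le_trans (up t t0 t1))// lerD2l.
have [t t0 [t1 t2]] := pick e K e0 K0.
by rewrite (le_trans (lo t t0 t1))// lerD2l.
Qed.

(** Interpolation y^3 <= (r / 2) y^2 + y^4 / (2 r) with r = sqrt v. The fourth power is dominated by
    a variable of mean at most 24 * 2 * exp (1/2) * v^2 <= 96 v^2, and 1/2 + 48 <= 49. *)
Lemma gaussian_abs3 D v : 0 < v -> gaussian_mgf D v ->
  Ex P (fun w => `|D w| ^+ 3) <= 49 * v * Num.sqrt v.
Proof.
move=> v0 gD; pose q := qf D.
have iq t : intg P (q t) by exact: (iqf t gD).
have Eq t : Ex P (q t) = 2 * expR (t ^+ 2 * v / 2) by exact: (Eqf t gD).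
have isq := gaussian_intg_sqr gD.
have : 0 < Num.sqrt v by rewrite sqrtr_gt0.
have : Num.sqrt v * Num.sqrt v = v by rewrite -expr2 sqr_sqrtr// ltW.
move: (Num.sqrt v) => r rr r0.
have D4 w : `|D w| ^+ 4 <= (v * v) * (24 * q r^-1 w).
  have := expR_abs_bound (r^-1 * D w) 3; rewrite normrM exprMn.
  rewrite (ger0_norm (x := r^-1)) ?invr_ge0 ?(ltW r0)// => h.
  rewrite -ler_pdivrMl ?mulr_gt0//; apply: le_trans h; rewrite -rr.
  by rewrite (_ : (r * r * (r * r))^-1 = r^-1 ^+ 4)//; field; rewrite gt_eqF.
have E4 : Ex P (fun w => v * v * (24 * q r^-1 w)) <= 96 * (v * v).
  rewrite ExZ; last exact/intgZ/iq.
  rewrite ExZ; last exact: iq.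
  have := @expR_le1D2x R (1 / 2); rewrite Eq expr2.
  rewrite (_ : r^-1 * r^-1 * v / 2 = 1 / 2); last first.
    by rewrite -rr; field; rewrite gt_eqF.
  have vv : 0 < v * v by rewrite mulr_gt0.
  move: (v * v) vv => u u0 h.
  have h12 : 0 <= 1 / 2 :> R by lra.
  have := h; rewrite h12 lexx => /(_ isT); move: (expR _) => b b2.
  have : (96 - 48 * b) * u >= 0 by rewrite mulr_ge0 ?(ltW u0)//; lra.
  by lra.
have i1 : intg P (fun w => (r / 2) * D w ^+ 2) by exact/intgZ/isq.
have i2 : intg P (fun w => (r^-1 / 2) * (v * v * (24 * q r^-1 w))).
  exact/intgZ/intgZ/intgZ/iq.
apply: (@le_trans _ _ (Ex P (fun w => (r / 2) * D w ^+ 2 +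
    (r^-1 / 2) * (v * v * (24 * q r^-1 w))))).
  apply: Ex_le => [||w]; [exact: (gaussian_intg_abs 2 gD)|exact: intgD|].
  apply: (@le_trans _ _ ((r / 2) * D w ^+ 2 + (r^-1 / 2) * `|D w| ^+ 4)); last first.
    by rewrite lerD2l ler_wpM2l// mulr_ge0// invr_ge0 ltW.
  rewrite -(real_normK (num_real (D w))); move: `|D w| (normr_ge0 (D w)) => y y0.
  rewrite -subr_ge0 (_ : _ - _ = (y ^+ 2 * (r - y) ^+ 2) / (2 * r)); last first.
    by field; rewrite gt_eqF.
  by apply: divr_ge0; [rewrite mulr_ge0 ?sqr_ge0|rewrite mulr_ge0// ltW].
rewrite ExD// ExZ; last exact: isq.
rewrite (gaussian_var v0 gD) ExZ; last exact/intgZ/intgZ/iq.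
apply: (@le_trans _ _ (r / 2 * v + r^-1 / 2 * (96 * (v * v)))).
  by rewrite lerD2l ler_wpM2l// mulr_ge0// invr_ge0 ltW.
rewrite (_ : r^-1 / 2 * (96 * (v * v)) = 48 * r * v); last first.
  by rewrite -rr; field; rewrite gt_eqF.
by have := mulr_ge0 (ltW r0) (ltW v0); rewrite (mulrC (49 * v)) mulrCA (mulrC r v); lra.
Qed.


Lemma gaussian_mean D v : 0 < v -> gaussian_mgf D v -> Ex P D = 0.
Proof.
move=> v0 gD; apply/eqP; rewrite eq_le (gaussian_mean_le0 v0 gD)/=.
have := gaussian_mean_le0 v0 (gaussian_mgfN gD).
by rewrite ExN ?oppr_le0//; exact: (gaussian_intg gD).
Qed.

End gaussian_moments.

Section smooth_functions.
Context {R : realType}.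
Implicit Types (x y : R).

Lemma lip_continuous (f : R -> R) K : (forall x y, `|f y - f x| <= K * `|y - x|) ->
  continuous f.
Proof.
move=> h x; apply/cvgrPdist_le => e e0.
have K1 : 0 < `|K| + 1 by rewrite ltr_wpDl.
near=> y.
rewrite (le_trans (h y x))// (@le_trans _ _ ((`|K| + 1) * `|x - y|))//.
  by rewrite ler_wpM2r//; have := ler_norm K; lra.
rewrite -ler_pdivlMl// mulrC; near: y.
by apply: cvgr_dist_le => //; rewrite divr_gt0.
Unshelve. all: by end_near.
Qed.

Lemma smooth2_lip C (f0 f1 f2 : R -> R) : smooth2 C f0 f1 f2 ->
  [/\ (forall x y, `|f0 y - f0 x| <= 3 * C * `|y - x|),
      (forall x y, `|f1 y - f1 x| <= 3 * C * `|y - x|) &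
      (forall x y, `|f2 y - f2 x| <= 3 * C * `|y - x|)].
Proof.
move=> [[b0 b1 b2] [h0 h1 h2]].
have C0 : 0 <= C by apply: le_trans (b0 0).
have far (f : R -> R) x y : (forall x, `|f x| <= C) -> 1 <= `|y - x| ->
    `|f y - f x| <= 3 * C * `|y - x|.
  move=> b xy; rewrite (le_trans (ler_normB _ _))//.
  by have := b x; have := b y; have := ler_wpM2l C0 xy; lra.
split=> x y.
- have [xy|xy] := leP 1 `|y - x|; first exact: far.
  have := h0 x (y - x); rewrite subrKC => h.
  rewrite -(subrK (f1 x * (y - x) + f2 x * (y - x) ^+ 2 / 2) (f0 y - f0 x)).
  rewrite (le_trans (ler_normD _ _))// [X in `|X| + _](_ : _ =
    f0 y - f0 x - f1 x * (y - x) - f2 x * (y - x) ^+ 2 / 2); last by ring.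
  have e1 : `|f1 x * (y - x) + f2 x * (y - x) ^+ 2 / 2| <=
      C * `|y - x| + C * `|y - x| ^+ 2 / 2.
    rewrite (le_trans (ler_normD _ _))// lerD//.
      by rewrite normrM ler_wpM2r.
    by rewrite 2!normrM normrX (ger0_norm (x := 2^-1))// ler_wpM2r// ler_wpM2r.
  rewrite (le_trans (lerD h e1))//.
  move: (`|y - x|) (normr_ge0 (y - x)) xy => z z0 z1.
  have z2 : z ^+ 2 <= z by rewrite expr2; nra.
  have z3 : z ^+ 3 <= z by rewrite exprS; have := exprn_ge0 2 z0; nra.
  by have := ler_wpM2l C0 z2; have := ler_wpM2l C0 z3; have := mulr_ge0 C0 z0; lra.
- have [xy|xy] := leP 1 `|y - x|; first exact: far.
  have := h1 x (y - x); rewrite subrKC => h.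
  rewrite -(subrK (f2 x * (y - x)) (f1 y - f1 x)) (le_trans (ler_normD _ _))//.
  have e1 : `|f2 x * (y - x)| <= C * `|y - x| by rewrite normrM ler_wpM2r.
  rewrite (le_trans (lerD h e1))// -(real_normK (num_real (y - x))).
  move: (`|y - x|) (normr_ge0 (y - x)) xy => z z0 z1.
  have z2 : z ^+ 2 <= z by rewrite expr2; nra.
  by have := ler_wpM2l C0 z2; have := mulr_ge0 C0 z0; lra.
- have := h2 x (y - x); rewrite subrKC => h; rewrite (le_trans h)//.
  by have := mulr_ge0 C0 (normr_ge0 (y - x)); lra.
Qed.

Lemma smooth2_bmfun C (f0 f1 f2 : R -> R) : smooth2 C f0 f1 f2 ->
  [/\ bmfun f0, bmfun f1 & bmfun f2].
Proof.
move=> sf; have [[b0 b1 b2] _] := sf; have [l0 l1 l2] := smooth2_lip sf.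
have m (f : R -> R) : (forall x y, `|f y - f x| <= 3 * C * `|y - x|) -> measurable_fun setT f.
  move=> /lip_continuous; exact: continuous_measurable_fun.
by split; split; [exact: m|exists C|exact: m|exists C|exact: m|exists C].
Qed.

Lemma bmfun_bump (e s : R) : bmfun (fun x => bump (x / e + s)).
Proof.
have [h _ _] := smooth2_bmfun (smooth2_affine e^-1 s (@smooth2_bump R)).
by rewrite (_ : (fun x => _) = (fun x => bump (e^-1 * x + s)))//; apply/funext => x; rewrite mulrC.
Qed.

End smooth_functions.

Section averaging.
Context {R : realType} {d : measure_display} {T : measurableType d}.
Variable P : probability T R.
Implicit Types (D : T -> R) (f : R -> R).

Lemma intgB (f g : T -> R) : intg P f -> intg P g -> intg P (fun w => f w - g w).
Proof.
move=> hf /(intgZ (-1)) hg; have := intgD hf hg; congr intg.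
by apply/funext => w; rewrite mulN1r.
Qed.

Definition avg D f (x : R) : R := Ex P (fun w => f (x + D w)).

Lemma bmeas_shift D f x : bmfun f -> measurable_fun setT D -> bmeas (fun w => f (x + D w)).
Proof.
move=> bf mD; apply: (@bmfun_bmeas _ _ _ f (fun w => x + D w)) => //.
exact: measurable_funD.
Qed.

Lemma avg_smooth2 D C (f0 f1 f2 : R -> R) : measurable_fun setT D ->
  smooth2 C f0 f1 f2 -> smooth2 C (avg D f0) (avg D f1) (avg D f2).
Proof.
move=> mD sf; have [[b0 b1 b2] [h0 h1 h2]] := sf.
have [m0 m1 m2] := smooth2_bmfun sf.
have B0 x := bmeas_shift x m0 mD.
have B1 x := bmeas_shift x m1 mD.
have B2 x := bmeas_shift x m2 mD.
split; split=> x.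
- exact: Ex_abs_bound.
- exact: Ex_abs_bound.
- exact: Ex_abs_bound.
- move=> y; rewrite (_ : _ - _ - _ - _ = Ex P (fun w => f0 (x + D w + y) -
      f0 (x + D w) - f1 (x + D w) * y - f2 (x + D w) * y ^+ 2 / 2)).
    apply: Ex_abs_bound => //; apply: bmeasB; first apply: bmeasB; first apply: bmeasB => //.
    + by have := B0 (x + y); apply: eq_bmeas => w; rewrite addrAC.
    + by have := bmeasZ y (B1 x); apply: eq_bmeas => w; rewrite mulrC.
    + by have := bmeasZ (y ^+ 2 / 2) (B2 x); apply: eq_bmeas => w; rewrite mulrC mulrA.
  rewrite /avg -mulrA [_ * y]mulrC [_ * (y ^+ 2 / 2)]mulrC -!ExZ; [|exact: bmeas_intg..].
  rewrite -!ExB; try by [apply: bmeas_intg; repeat apply: bmeasB => //; exact: bmeasZ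
    |apply: bmeas_intg; exact: bmeasZ|exact: bmeas_intg].
  by apply: Ex_eq => w; rewrite [x + D w + y]addrAC; ring.
- move=> y; rewrite (_ : _ - _ - _ = Ex P (fun w => f1 (x + D w + y) -
      f1 (x + D w) - f2 (x + D w) * y)).
    apply: Ex_abs_bound => //; apply: bmeasB; first apply: bmeasB => //.
    + by have := B1 (x + y); apply: eq_bmeas => w; rewrite addrAC.
    + by have := bmeasZ y (B2 x); apply: eq_bmeas => w; rewrite mulrC.
  rewrite /avg [_ * y]mulrC -!ExZ; [|exact: bmeas_intg..].
  rewrite -!ExB; try by [apply: bmeas_intg; repeat apply: bmeasB => //; exact: bmeasZ
    |apply: bmeas_intg; exact: bmeasZ|exact: bmeas_intg].
  by apply: Ex_eq => w; rewrite [x + D w + y]addrAC; ring.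
- move=> y; rewrite /avg -ExB; [|exact: bmeas_intg..].
  apply: Ex_abs_bound; first exact: bmeasB.
  by move=> w; rewrite addrAC.
Qed.

(** Taylor expansion under the expectation: centring kills the linear term, the variance gives v /
    2, and the third absolute moment bounds the remainder. Over a time step eta the error is of
    order eta^(3/2), so the h / eta steps of a block together contribute an error that vanishes with
    eta. *)
Lemma avg_expand D v C (f0 f1 f2 : R -> R) x : 0 < v -> gaussian_mgf P D v ->
  smooth2 C f0 f1 f2 ->
  `|avg D f0 x - f0 x - v / 2 * f2 x| <= C * (49 * v * Num.sqrt v) /\
  `|avg D f1 x - f1 x| <= C * v.
Proof.
move=> v0 gD sf; have [[b0 b1 b2] [h0 h1 h2]] := sf.
have C0 : 0 <= C by apply: le_trans (b0 0).
have [m0 m1 m2] := smooth2_bmfun sf.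
have iD := gaussian_intg gD; have iD2 := gaussian_intg_sqr gD.
have iD3 := gaussian_intg_abs 2 gD.
have B0 := bmeas_intg P (bmeas_shift x m0 gD.1).
have B1 := bmeas_intg P (bmeas_shift x m1 gD.1).
have ED := gaussian_mean v0 gD; have ED2 := gaussian_var v0 gD.
have ED3 := gaussian_abs3 v0 gD.
have ic c := intg_cst P c.
split.
- rewrite (_ : _ - _ = Ex P (fun w => f0 (x + D w) - f0 x - f1 x * D w - (f2 x / 2) * D w ^+ 2)).
    rewrite (le_trans (Ex_abs_le (g := fun w => C * `|D w| ^+ 3) _ _ _))//.
    + by apply: intgB; [apply: intgB; [exact: intgB|exact: intgZ]|exact: intgZ].
    + exact: intgZ.
    + by move=> w; have := h0 x (D w); rewrite [f2 x / 2 * _]mulrAC.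
    + by rewrite ExZ// ler_wpM2l.
  have i1 : intg P (fun w => f1 x * D w) by exact: intgZ.
  have i2 : intg P (fun w => f2 x / 2 * D w ^+ 2) by exact: intgZ.
  have i3 : intg P (fun w => f0 (x + D w) - f0 x) by exact: intgB.
  have i4 : intg P (fun w => f0 (x + D w) - f0 x - f1 x * D w) by exact: intgB.
  rewrite (ExB i4 i2) (ExB i3 i1) (ExB B0 (ic _)) !ExZ// Ex_cst ED ED2 /avg.
  by ring.
- rewrite (_ : _ - _ = Ex P (fun w => f1 (x + D w) - f1 x - f2 x * D w)).
    rewrite (le_trans (Ex_abs_le (g := fun w => C * D w ^+ 2) _ _ _))//.
    + by apply: intgB; [exact: intgB|exact: intgZ].
    + exact: intgZ.
    + by rewrite ExZ// ED2.
  have i1 : intg P (fun w => f2 x * D w) by exact: intgZ.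
  have i3 : intg P (fun w => f1 (x + D w) - f1 x) by exact: intgB.
  by rewrite (ExB i3 i1) (ExB B1 (ic _)) ExZ// Ex_cst ED /avg mulr0 subr0.
Qed.

(* Fubini, obtained by approximating [g] by finite sums of products. *)
Lemma Ex_indep2 (D0 D1 : T -> R) (g : R -> R -> R) (C L : R) :
  measurable_fun setT D0 -> measurable_fun setT D1 ->
  (forall f0 f1, bmfun f0 -> bmfun f1 -> Ex P (fun w => f0 (D0 w) * f1 (D1 w)) =
    Ex P (fun w => f0 (D0 w)) * Ex P (fun w => f1 (D1 w))) ->
  0 < L ->
  (forall a b, `|g a b| <= C) ->
  (forall a b a' b', `|g a b - g a' b'| <= L * (`|a - a'| + `|b - b'|)) ->
  Ex P (fun w => g (D0 w) (D1 w)) = Ex P (fun w => Ex P (fun w' => g (D0 w) (D1 w'))).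
Proof.
move=> mD0 mD1 hI L0 gC gL.
(* The pair is seen as a vector of two coordinates, to which the spline approximation applies. *)
pose G (v : nat -> R) := g (v 0%N) (v 1%N).
have uG : box_ucont 2 G.
  move=> K e e0; exists (e / (2 * L)); first by rewrite divr_gt0// mulr_gt0.
  move=> v w h; have [_ _ h0] := h 0%N isT; have [_ _ h1] := h 1%N isT.
  rewrite (le_trans (gL _ _ _ _))// -ler_pdivlMl// (le_trans (lerD h0 h1))//.
  by apply: eq_leq_real; field; rewrite gt_eqF.
pose V (a b : R) (k : nat) := if k == 0%N then a else b.
pose Gn n a b := smooth_approx 2 G n (V a b).
have GnC n a b : `|Gn n a b| <= C.
  by apply: quasi_interp_bound => v; exact: gC.
have Gnc a b : Gn n a b @[n --> \oo] --> g a b.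
  apply/cvgrPdist_le => e e0.
  have := smooth_approx_cvg (`|a| + `|b|) uG e0; apply: filterS => n h.
  rewrite distrC; apply: (h (V a b)) => k _; rewrite /V.
  by case: eqP => _; rewrite ?lerDl ?lerDr.
pose e n : R := n.+1%:R^-1; pose J n := (n.+1 * n.+1 + 3)%N.
have GnE n a b : Gn n a b = \sum_(p : {ffun 'I_2 -> 'I_(2 * J n)})
    G (knots (J n) (e n) p) * (bump (a / e n + ((J n)%:R - (p ord0)%:R)) *
      bump (b / e n + ((J n)%:R - (p ord_max)%:R))).
  apply: eq_bigr => p _; rewrite big_ord_recl big_ord1 !addrA.
  by congr (_ * (_ * bump (_ - (p _)%:R))); apply/val_inj.
have b0 n p := bmfun_bmeas (bmfun_bump (e n) p) mD0.
have b1 n p := bmfun_bmeas (bmfun_bump (e n) p) mD1.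
have hG n : bmeas (fun w => Gn n (D0 w) (D1 w)).
  apply: (eq_bmeas (fun w => esym (GnE n _ _))).
  by apply: bmeas_sum => p; apply/bmeasZ/bmeasM.
have hG1 n a : bmeas (fun w => Gn n a (D1 w)).
  apply: (eq_bmeas (fun w => esym (GnE n _ _))).
  by apply: bmeas_sum => p; apply/bmeasZ/bmeasZ.
have [_ c1] : bmeas (fun w => g (D0 w) (D1 w)) /\
    Ex P (fun w => Gn n (D0 w) (D1 w)) @[n --> \oo] --> Ex P (fun w => g (D0 w) (D1 w)).
  apply: (@Ex_cvg _ _ _ P _ _ C) => //.
  by move=> n; exact: (hG n).1.
have inner n a : Ex P (fun w => Gn n a (D1 w)) =
    \sum_(p : {ffun 'I_2 -> 'I_(2 * J n)})
    G (knots (J n) (e n) p) * (bump (a / e n + ((J n)%:R - (p ord0)%:R)) *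
      Ex P (fun w => bump (D1 w / e n + ((J n)%:R - (p ord_max)%:R)))).
  under eq_fun do rewrite GnE.
  rewrite Ex_sum; last by move=> p; apply/bmeasZ/bmeasZ.
  apply: eq_bigr => p _; rewrite ExZ; last exact/bmeas_intg/bmeasZ.
  by rewrite ExZ//; exact: bmeas_intg.
have icv a : bmeas (fun w => g a (D1 w)) /\
    Ex P (fun w => Gn n a (D1 w)) @[n --> \oo] --> Ex P (fun w => g a (D1 w)).
  apply: (@Ex_cvg _ _ _ P _ _ C) => //.
  by move=> n; exact: (hG1 n a).1.
have inb n a : `|Ex P (fun w => Gn n a (D1 w))| <= C.
  exact: Ex_abs_bound.
have mout n : bmeas (fun w => Ex P (fun w' => Gn n (D0 w) (D1 w'))).
  under eq_fun do rewrite inner.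
  apply: bmeas_sum => p; apply: bmeasZ.
  have := bmeasZ (Ex P (fun w => bump (D1 w / e n + ((J n)%:R - (p ord_max)%:R))))
    (b0 n ((J n)%:R - (p ord0)%:R)).
  by apply: eq_bmeas => w; rewrite mulrC.
have [_ c2] : bmeas (fun w => Ex P (fun w' => g (D0 w) (D1 w'))) /\
    Ex P (fun w => Ex P (fun w' => Gn n (D0 w) (D1 w'))) @[n --> \oo] -->
    Ex P (fun w => Ex P (fun w' => g (D0 w) (D1 w'))).
  apply: (@Ex_cvg _ _ _ P _ _ C) => //; first by move=> n; exact: (mout n).1.
  by move=> w; exact: (icv _).2.
apply: (cvg_unique _ c1) => //.
rewrite (_ : (fun n => Ex P (fun w => Gn n (D0 w) (D1 w))) =
  (fun n => Ex P (fun w => Ex P (fun w' => Gn n (D0 w) (D1 w')))))//.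
apply/funext => n.
under eq_fun do rewrite GnE.
under [in RHS]eq_fun do rewrite inner.
rewrite !Ex_sum; last 2 first.
- move=> p; apply: bmeasZ.
  have := bmeasZ (Ex P (fun w => bump (D1 w / e n + ((J n)%:R - (p ord_max)%:R))))
    (b0 n ((J n)%:R - (p ord0)%:R)).
  by apply: eq_bmeas => w; rewrite mulrC.
- by move=> p; apply/bmeasZ/bmeasM.
apply: eq_bigr => p _.
rewrite ExZ; last exact/bmeas_intg/bmeasM.
rewrite (hI _ _ (bmfun_bump (e n) ((J n)%:R - (p ord0)%:R))
  (bmfun_bump (e n) ((J n)%:R - (p ord_max)%:R))).
set E1 := Ex P (fun w => bump (D1 w / _ + _)).
transitivity (Ex P (fun w => G (knots (J n) (e n) p) *
    (E1 * bump (D0 w / e n + ((J n)%:R - (p ord0)%:R))))).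
  rewrite ExZ; last exact/bmeas_intg/bmeasZ.
  by rewrite ExZ; [rewrite [X in _ * X]mulrC|exact: bmeas_intg].
by apply: Ex_eq => w; rewrite [X in _ * X]mulrC.
Qed.

End averaging.

(** * Brownian increments and the heat semigroup *)

Section brownian_increments.
Context {R : realType} {d : measure_display} {T : measurableType d}.
Variable P : probability T R.
Implicit Types (s t mu sigma : R) (X : R -> T -> R).

Lemma Ex_indic_preimage (D : T -> R) (B : set R) : measurable_fun setT D ->
  measurable B -> Ex P (fun w => \1_B (D w)) = fine (P [set w | B (D w)]).
Proof.
move=> mD mB; rewrite -Ex_indic//.
by rewrite -[X in measurable X]setTI; exact: mD.
Qed.

Definition normalized mu sigma X t w : R := (X t w - mu * t) / sigma.

Definition increment mu sigma X s t w : R :=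
  normalized mu sigma X t w - normalized mu sigma X s w.

Lemma incrementE mu sigma X s t w : increment mu sigma X s t w =
  sigma^-1 * (X t w - X s w) - mu / sigma * (t - s).
Proof. by rewrite /increment /normalized; ring. Qed.

Lemma bm_measurable mu sigma X t : brownian_motion P mu (sigma ^+ 2) X -> 0 <= t ->
  measurable_fun setT (X t).
Proof. by move=> [[h _] _ _ _] t0; exact: h. Qed.

Lemma increment_measurable mu sigma X s t : brownian_motion P mu (sigma ^+ 2) X ->
  0 <= s -> 0 <= t -> measurable_fun setT (increment mu sigma X s t).
Proof.
move=> bm s0 t0; apply: measurable_funB; apply: measurable_funM => //;
  by apply: measurable_funB => //; exact: (bm_measurable bm).
Qed.

Lemma bm_mgf mu sigma X s t theta : 0 < sigma -> brownian_motion P mu (sigma ^+ 2) X ->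
  0 <= s -> s < t ->
  (\int[P]_w (expR (theta * (X t w - X s w)))%:E =
   (expR (theta * (mu * (t - s)) + theta ^+ 2 * (sigma ^+ 2 * (t - s)) / 2))%:E)%E.
Proof.
move=> sig0 bm s0 st; have t0 : 0 <= t by rewrite (le_trans s0)// ltW.
have [_ _ law _] := bm.
have mX : measurable_fun setT (fun w => X t w - X s w).
  by apply: measurable_funB; exact: (bm_measurable bm).
have v0 : 0 < sigma ^+ 2 * (t - s) by rewrite mulr_gt0 ?exprn_gt0// subr_gt0.
have := @normal_mgf R (mu * (t - s)) (Num.sqrt (sigma ^+ 2 * (t - s))) theta.
rewrite sqr_sqrtr ?(ltW v0)// => <-; last by rewrite gt_eqF// sqrtr_gt0.
have mX' : @measurable_fun _ _ T (measurableTypeR R) setT (fun w => X t w - X s w).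
  exact: mX.
pose De : {RV P >-> measurableTypeR R} :=
  @mfun_Sub _ _ T (measurableTypeR R) _ (mem_set mX').
transitivity (\int[distribution P De]_x (expR (theta * x))%:E)%E.
  apply/esym/ge0_integral_distribution => [|y]; last by rewrite lee_fin expR_ge0.
  by apply/measurable_EFinP; exact: measurable_expRM.
by apply: eq_measure_integral => A mA _; exact: law.
Qed.

Lemma increment_gaussian mu sigma X s t : 0 < sigma ->
  brownian_motion P mu (sigma ^+ 2) X -> 0 <= s -> s < t ->
  gaussian_mgf P (increment mu sigma X s t) (t - s).
Proof.
move=> sig0 bm s0 st; have t0 : 0 <= t by rewrite (le_trans s0)// ltW.
split; first exact: (increment_measurable bm).
move=> th.
have e : (fun w => expR (th * increment mu sigma X s t w)) =
    (fun w => expR (- (th * (mu / sigma * (t - s)))) * expR (th / sigma * (X t w - X s w))).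
  apply/funext => w; rewrite -expRD incrementE; congr expR; ring.
have mX : measurable_fun setT (fun w => expR (th / sigma * (X t w - X s w))).
  apply: measurableT_comp => //; apply: measurable_funM => //.
  by apply: measurable_funB; exact: (bm_measurable bm).
have h := bm_mgf (th / sigma) sig0 bm s0 st.
have i : intg P (fun w => expR (th / sigma * (X t w - X s w))).
  apply/integrableP; split; first exact/measurable_EFinP.
  under eq_integral do rewrite /= ger0_norm ?expR_ge0//.
  by rewrite h ltry.
rewrite e; split; first exact: intgZ.
rewrite ExZ// /Ex /Rintegral h /= -expRD; congr expR.
by field; rewrite gt_eqF.
Qed.

Lemma increment_law mu sigma X s t s' t' (f : R -> R) : 
  brownian_motion P mu (sigma ^+ 2) X -> 0 <= s -> s < t -> 0 <= s' -> t - s = t' - s' ->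
  bmfun f ->
  Ex P (fun w => f (increment mu sigma X s t w)) =
  Ex P (fun w => f (increment mu sigma X s' t' w)).
Proof.
move=> bm s0 st s'0 e bf.
have st' : s' < t' by rewrite -subr_gt0 -e subr_gt0.
have t0 : 0 <= t by rewrite (le_trans s0)// ltW.
have t'0 : 0 <= t' by rewrite (le_trans s'0)// ltW.
have [_ _ law _] := bm.
pose g x := f (sigma^-1 * x - mu / sigma * (t - s)).
have mg : measurable_fun setT g.
  apply: (measurableT_comp bf.1).
  by apply: measurable_funB => //; apply: measurable_funM.
have bg : exists M, forall x, `|g x| <= M.
  by have [M hM] := bf.2; exists M => x; exact: hM.
have mX a b : 0 <= a -> 0 <= b -> measurable_fun setT (fun w => X b w - X a w).
  by move=> a0 b0; apply: measurable_funB; exact: (bm_measurable bm).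
transitivity (Ex P (fun w => g (X t w - X s w))).
  by apply: Ex_eq => w; rewrite incrementE.
transitivity (Ex P (fun w => g (X t' w - X s' w))); last first.
  by apply: Ex_eq => w; rewrite incrementE -e.
have := @Ex_of_events _ _ _ _ _ P P (fun=> 1) (fun w => X t w - X s w)
  (fun w => X t' w - X s' w) 1 g.
rewrite mul1r => <- //.
- by apply: Ex_eq => w; rewrite mul1r.
- exact: bmeas_cst.
- exact: mX.
- exact: mX.
- move=> B mB; rewrite mul1r.
  under eq_fun do rewrite mul1r.
  rewrite !Ex_indic_preimage//; [|exact: mX..].
  by congr fine; rewrite (law s t B s0 st mB) (law s' t' B s'0 st' mB) e.
Qed.

Lemma increments_indep mu sigma X (m : nat) (t : nat -> R) (f : nat -> R -> R) :
  brownian_motion P mu (sigma ^+ 2) X -> 0 <= t 0%N -> nondecreasing_seq t ->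
  (forall k, bmfun (f k)) ->
  Ex P (fun w => \prod_(k < m) f k (increment mu sigma X (t k) (t k.+1) w)) =
  \prod_(k < m) Ex P (fun w => f k (increment mu sigma X (t k) (t k.+1) w)).
Proof.
move=> bm t0 nt bf; have [_ _ _ ind] := bm.
have tk k : 0 <= t k by rewrite (le_trans t0)// nt.
pose D k w := X (t k.+1) w - X (t k) w.
have mD k : measurable_fun setT (D k).
  by apply: measurable_funB; exact: (bm_measurable bm).
pose g k x := f k (sigma^-1 * x - mu / sigma * (t k.+1 - t k)).
have bg k : bmfun (g k).
  split; last by have [M hM] := (bf k).2; exists M => x; exact: hM.
  apply: (measurableT_comp (bf k).1).
  by apply: measurable_funB => //; apply: measurable_funM.
have e k w : f k (increment mu sigma X (t k) (t k.+1) w) = g k (D k w).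
  by rewrite incrementE.
transitivity (Ex P (fun w => \prod_(k < m) g k (D k w))).
  by apply: Ex_eq => w; apply: eq_bigr => k _; exact: e.
transitivity (\prod_(k < m) Ex P (fun w => g k (D k w))); last first.
  by apply: eq_bigr => k _; apply: Ex_eq => w; rewrite e.
apply: Ex_indep_prod => // B mB.
have pB k : measurable [set w | B k (D k w)].
  by rewrite -[X in measurable X]setTI; exact: mD.
have mBb : measurable (\bigcap_(k < m) [set w | B k (D k w)]).
  by apply: bigcap_measurableType => k _; exact: pB.
transitivity (fine (P (\bigcap_(k < m) [set w | B k (D k w)]))).
  rewrite -Ex_indic//; apply: Ex_eq => w; rewrite [RHS]indicE.
  case: (pselect ((\bigcap_(k < m) [set w | B k (D k w)]) w)) => [h|h].
    rewrite mem_set// big1// => k _; rewrite indicE mem_set//.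
    by apply: h => /=; exact: ltn_ord.
  rewrite memNset//.
  have [k hk] : exists k : 'I_m, ~ B k (D k w).
    apply: contrapT => hN; apply: h => k /= km.
    by apply: contrapT => hk; apply: hN; exists (Ordinal km).
  by rewrite (bigD1 k)//= indicE memNset// mul0r.
rewrite ind//.
transitivity (fine (\prod_(k < m) (Ex P (fun w => \1_(B k) (D k w)))%:E)%E); last first.
  by rewrite prodEFin.
congr fine; apply: eq_bigr => k _.
rewrite Ex_indic_preimage// fineK//.
exact: fin_num_measure.
Qed.

(** The heat semigroup at time n h, realised by an increment of the given Brownian motion, so that
    its semigroup law comes from independence and stationarity instead of a convolution of
    kernels. *)
Definition heat mu sigma X (h : R) (n : nat) (f : R -> R) (x : R) : R :=
  avg P (increment mu sigma X 0 (n%:R * h)) f x.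

Lemma heat0 mu sigma X h f x : heat mu sigma X h 0 f x = f x.
Proof.
rewrite /heat /avg -[RHS](Ex_cst P); apply: Ex_eq => w.
by rewrite /increment mul0r subrr addr0.
Qed.

(** The increment over [0, (n + 1) h] is split at time h; the second part is integrated out by
    independence, then moved to [0, n h] by stationarity. *)
Lemma heatS mu sigma X h n C (f0 f1 f2 : R -> R) f x : 0 < h -> 
  brownian_motion P mu (sigma ^+ 2) X -> smooth2 C f0 f1 f2 ->
  f \in [:: f0; f1; f2] ->
  heat mu sigma X h n.+1 f x = avg P (increment mu sigma X 0 h) (heat mu sigma X h n f) x.
Proof.
move=> h0 bm sf.
have C0 : 0 <= C by have [[b0 _ _] _] := sf; apply: le_trans (b0 0).
have key g : bmfun g -> (forall y, `|g y| <= C) ->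
    (forall x y, `|g y - g x| <= 3 * C * `|y - x|) ->
    heat mu sigma X h n.+1 g x = avg P (increment mu sigma X 0 h) (heat mu sigma X h n g) x.
  move=> bg gC gL; have nh0 : 0 <= n.+1%:R * h by rewrite mulr_ge0// ltW.
  transitivity (Ex P (fun w => (fun a b => g (x + (a + b))) (increment mu sigma X 0 h w)
     (increment mu sigma X h (n.+1%:R * h) w))).
    by apply: Ex_eq => w; congr g; rewrite /increment; ring.
  rewrite (@Ex_indep2 _ _ _ P (increment mu sigma X 0 h)
    (increment mu sigma X h (n.+1%:R * h)) (fun a b => g (x + (a + b))) C (3 * C + 1)).
  - apply: Ex_eq => w.
    rewrite /heat /avg.
    (* For n = 0 the second increment is over an empty interval, which [increment_law] does not
       cover. *)
    case: n nh0 => [|n] nh0.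
      have i0 s w' : increment mu sigma X s s w' = 0 by rewrite /increment subrr.
      by apply: Ex_eq => w'; rewrite mul1r mul0r !i0 !addr0.
    have := @increment_law mu sigma X h (n.+2%:R * h) 0 (n.+1%:R * h)
      (fun y => g (x + increment mu sigma X 0 h w + y)) bm.
    move=> <-.
    + by apply: Ex_eq => w'; rewrite addrA.
    + exact: ltW.
    + by rewrite ltr_pMl// ltr1n.
    + by [].
    + by rewrite subr0 -natr1; ring.
    + split; last by exists C.
      by apply: (measurableT_comp bg.1); exact: measurable_funD.
  - by apply: (increment_measurable bm) => //; exact: ltW.
  - by apply: (increment_measurable bm) => //; exact: ltW.
  - move=> g0 g1 bg0 bg1.
    pose t k : R := if k is k'.+1 then (if k' is _.+1 then n.+1%:R * h else h) else 0.
    pose gg k := if k is 0%N then g0 else g1.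
    have := @increments_indep mu sigma X 2 t gg bm.
    rewrite !big_ord_recl !big_ord0 /=.
    have -> : (fun w => \prod_(k < 2) gg k (increment mu sigma X (t k) (t k.+1) w)) =
      (fun w => g0 (increment mu sigma X 0 h w) * g1 (increment mu sigma X h (n.+1%:R * h) w)).
      by apply/funext => w; rewrite !big_ord_recl !big_ord0 /= mulr1.
    rewrite mulr1; apply => //.
    + apply/nondecreasing_seqP => -[|[|k]] //=; first exact: ltW.
      by rewrite ler_peMl ?ler1n// ltW.
    + by move=> [|k].
  - by rewrite ltr_wpDl// mulr_ge0.
  - by move=> a b; exact: gC.
  - move=> a b a' b'; rewrite (le_trans (gL _ _))//.
    apply: (@le_trans _ _ ((3 * C + 1) * `|x + (a + b) - (x + (a' + b'))|)).
      by rewrite ler_wpM2r// lerDl.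
    rewrite ler_wpM2l//; first by rewrite addr_ge0// mulr_ge0.
    rewrite (_ : _ - _ = (a - a') + (b - b')); last by ring.
    exact: ler_normD.
have [m0 m1 m2] := smooth2_bmfun sf; have [l0 l1 l2] := smooth2_lip sf.
have [[b0 b1 b2] _] := sf.
by rewrite !inE => /or3P[] /eqP ->; exact: key.
Qed.

Lemma heat_smooth2 mu sigma X h n C (f0 f1 f2 : R -> R) : 0 < h ->
  brownian_motion P mu (sigma ^+ 2) X -> smooth2 C f0 f1 f2 ->
  smooth2 C (heat mu sigma X h n f0) (heat mu sigma X h n f1) (heat mu sigma X h n f2).
Proof.
move=> h0 bm; apply: avg_smooth2; apply: (increment_measurable bm) => //.
by rewrite mulr_ge0// ltW.
Qed.

End brownian_increments.

(** * The two-state chain: moments and corrected test functions *)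

Section moment_recursion.
Context {R : realType}.

(** For the walk W with steps [s * eta] times a sign e, the sequences are E[W e], E[W^2], E[W^3 e]
    and E[W^4]. The bound has to be uniform in s = sqrt l, which is unbounded, so it is the products
    [s * m] and [s * q] that are controlled, through the contraction rho (1 + 2 s^2 eta) <= 1. The
    final 32 is 24 + 8 in [VE], with n eta and eta at most tau. *)
Lemma moment_recursion (s eta rho tau : R) (n : nat) (m a q z : nat -> R) :
  0 < s -> 0 < eta -> s ^+ 2 * eta <= 1 ->
  0 <= rho -> rho * (1 + 2 * s ^+ 2 * eta) <= 1 -> n%:R * eta <= tau -> eta <= tau ->
  (forall k, m k.+1 = rho * (m k + s * eta)) ->
  (forall k, a k.+1 = a k + 2 * (s * eta) * m k + (s * eta) ^+ 2) ->
  (forall k, q k.+1 = rho * (q k + 3 * (s * eta) * a k + 3 * (s * eta) ^+ 2 * m k +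
    (s * eta) ^+ 3)) ->
  (forall k, z k.+1 = z k + 4 * (s * eta) * q k + 6 * (s * eta) ^+ 2 * a k +
    4 * (s * eta) ^+ 3 * m k + (s * eta) ^+ 4) ->
  m 0%N = 0 -> a 0%N = 0 -> q 0%N = 0 -> z 0%N = 0 ->
  z n <= 32 * tau ^+ 2.
Proof.
move=> s0 eta0 se rho0 rho1 ntau etau mE aE qE zE m0 a0 q0 z0.
have tau0 : 0 < tau by lra.
have s20 : 0 < s ^+ 2 by rewrite exprn_gt0.
have ms k : s * m k <= 1 / 2.
  elim: k => [|k IH]; first by rewrite m0 mulr0; lra.
  rewrite mE mulrCA mulrDr mulrA -expr2.
  apply: (@le_trans _ _ (rho * (1 / 2 + s ^+ 2 * eta))).
    by rewrite ler_wpM2l// lerD2r.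
  by move: (s ^+ 2) rho1 => u; lra.
have ak k : a k <= 2 * k%:R * eta.
  elim: k => [|k IH]; first by rewrite a0 mulr0 mul0r.
  rewrite aE -[k.+1%:R]natr1.
  have h1 : eta * (s * m k) <= eta * (1 / 2) by rewrite ler_wpM2l// ltW.
  have h2 : (s ^+ 2 * eta) * eta <= 1 * eta by rewrite ler_wpM2r// ltW.
  by move: IH; rewrite exprMn expr2 [X in _ + X](_ : _ = s ^+ 2 * eta * eta); [lra|ring].
have an k : (k <= n)%N -> a k <= 2 * tau.
  move=> kn; rewrite (le_trans (ak k))// -mulrA ler_wpM2l//.
  by rewrite (le_trans _ ntau)// ler_wpM2r ?(ltW eta0)// ler_nat.
(* [q k <= V / s], where [rho] contracts towards the fixed point [V / s] *)
pose U := 6 * tau * eta + 5 / 2 * eta ^+ 2.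
have e0 := ltW eta0.
have qk k : (k <= n)%N -> s * q k <= U / (2 * eta).
  elim: k => [|k IH] kn.
    rewrite q0 mulr0 divr_ge0//; last by rewrite mulr_ge0.
    by rewrite /U addr_ge0// !mulr_ge0 ?exprn_ge0// ltW.
  have {}IH := IH (ltnW kn); have h1 := an k (ltnW kn); have h2 := ms k.
  rewrite qE mulrCA.
  have h3 : s * (q k + 3 * (s * eta) * a k + 3 * (s * eta) ^+ 2 * m k + (s * eta) ^+ 3) <=
      U / (2 * eta) + s ^+ 2 * U.
    rewrite (_ : s * (_ + _) = s * q k + s ^+ 2 * (3 * eta * a k + 3 * eta ^+ 2 * (s * m k) +
      (s ^+ 2 * eta) * eta ^+ 2)); last by ring.
    rewrite lerD// ler_wpM2l ?(ltW s20)// /U.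
    have k1 : eta * a k <= eta * (2 * tau) by rewrite ler_wpM2l.
    have k2 : eta ^+ 2 * (s * m k) <= eta ^+ 2 * (1 / 2) by rewrite ler_wpM2l ?exprn_ge0.
    have k3 : s ^+ 2 * eta * eta ^+ 2 <= 1 * eta ^+ 2 by rewrite ler_wpM2r ?exprn_ge0.
    lra.
  apply: (le_trans (ler_wpM2l rho0 h3)).
  have U0 : 0 <= U / (2 * eta).
    rewrite divr_ge0//; last by rewrite mulr_ge0.
    by rewrite /U addr_ge0// !mulr_ge0 ?exprn_ge0// ltW.
  rewrite (_ : _ + _ = (1 + 2 * s ^+ 2 * eta) * (U / (2 * eta))); last first.
    by field; rewrite gt_eqF.
  by have := ler_wpM2r U0 rho1; rewrite mul1r (mulrA rho).
pose V := 2 * U + 12 * eta * tau + 2 * eta ^+ 2 + eta ^+ 2.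
have zk k : (k <= n)%N -> z k <= k%:R * V.
  elim: k => [|k IH] kn; first by rewrite z0 mul0r.
  have {}IH := IH (ltnW kn); have h1 := an k (ltnW kn); have h2 := ms k.
  have h3 := qk k (ltnW kn).
  rewrite zE -[k.+1%:R]natr1 [leRHS]mulrDl mul1r.
  rewrite (_ : _ + _ = z k + (4 * eta * (s * q k) + 6 * (s ^+ 2 * eta) * eta * a k +
    4 * (s ^+ 2 * eta) * eta ^+ 2 * (s * m k) + (s ^+ 2 * eta) ^+ 2 * eta ^+ 2)); last by ring.
  rewrite lerD// /V !lerD//.
  - have := ler_wpM2l e0 h3; rewrite (_ : eta * (U / _) = U / 2); first by lra.
    by field; rewrite gt_eqF.
  - have g1 : eta * a k <= eta * (2 * tau) by rewrite ler_wpM2l.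
    have g2 : (s ^+ 2 * eta) * (eta * (2 * tau)) <= 1 * (eta * (2 * tau)).
      by rewrite ler_wpM2r// !mulr_ge0// ltW.
    have g3 : (s ^+ 2 * eta) * (eta * a k) <= (s ^+ 2 * eta) * (eta * (2 * tau)).
      by rewrite ler_wpM2l// mulr_ge0// ltW.
    by lra.
  - have g0 : 0 <= s ^+ 2 * eta by rewrite mulr_ge0// ltW.
    have g1 : 0 <= s ^+ 2 * eta * eta ^+ 2 by rewrite mulr_ge0// exprn_ge0.
    have g2 : s ^+ 2 * eta * eta ^+ 2 <= 1 * eta ^+ 2 by rewrite ler_wpM2r ?exprn_ge0.
    have := ler_wpM2l g1 h2; lra.
  - rewrite -[leRHS]mul1r ler_wpM2r ?exprn_ge0// exprn_ile1//.
    by rewrite mulr_ge0// ltW.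
rewrite (le_trans (zk n (leqnn n)))//.
have VE : V = eta * (24 * tau + 8 * eta) by rewrite /V /U; field.
rewrite VE mulrA (@le_trans _ _ (tau * (32 * tau)))//; last by rewrite mulrCA expr2.
by rewrite ler_pM ?mulr_ge0//; lra.
Qed.

End moment_recursion.

Section one_step.
Context {R : realType}.

(* One step of the corrected test function [u0 + y / (2 s) * u1]: the corrector
   cancels the drift [s * eta * y * u1] and produces the second derivative. *)
Lemma corrector_step (C s eta rho x y : R) (f0 f1 f2 g0 g1 : R -> R) :
  0 < s -> 0 < eta -> 0 <= rho <= 1 -> y * y = 1 ->
  `|2 * s ^+ 2 * eta - (1 - rho)| <= (2 * s ^+ 2 * eta) ^+ 2 ->
  1 - rho <= 2 * s ^+ 2 * eta ->
  smooth2 C f0 f1 f2 ->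
  `|g0 x - f0 x - eta / 2 * f2 x| <= C * (49 * eta * Num.sqrt eta) ->
  `|g1 x - f1 x| <= C * eta ->
  `|f0 (x + s * eta * y) + rho * y / (2 * s) * f1 (x + s * eta * y) -
    (g0 x + y / (2 * s) * g1 x)| <=
  C * (2 * s ^+ 3 * eta ^+ 2 + 2 * s ^+ 2 * eta ^+ 2 + s ^+ 3 * eta ^+ 3 +
    s * eta ^+ 2 / 2 + 49 * eta * Num.sqrt eta + eta / (2 * s)).
Proof.
move=> s0 eta0 /andP[rho0 rho1] yy hr hr2 [[b0 b1 b2] [t0 t1 _]] h0 h1.
have C0 : 0 <= C by apply: le_trans (b0 0).
have y1 : `|y| = 1.
  have := congr1 Num.norm yy; rewrite normrM normr1 -expr2 => /eqP.
  by rewrite sqrp_eq1// => /eqP.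
have T0 := t0 x (s * eta * y); have T1 := t1 x (s * eta * y).
have B1 := b1 x; have B2 := b2 x.
have se : 0 < s * eta by rewrite mulr_gt0.
rewrite normrM y1 mulr1 ger0_norm ?(ltW se)// in T0.
have ny : (s * eta * y) ^+ 2 = (s * eta) ^+ 2 by rewrite exprMn expr2 (expr2 y) yy mulr1.
rewrite ny in T0 T1.
move: (f0 (x + _)) (f1 (x + _)) (f0 x) (f1 x) (f2 x) (g0 x) (g1 x) B1 B2 h0 h1 T0 T1.
move=> F0 F1 u0 u1 u2 v0 v1 B1 B2 h0 h1.
set r1 := F0 - _ - _ - _ => T0; set r2 := F1 - _ - _ => T1.
(* An identity up to [y * y = 1]. Its terms are the mismatch between [1 - rho] and
   [2 * s ^+ 2 * eta], the second-order leftovers, the two Taylor remainders, and the errors of [g0]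
   and [g1] as one heat step. *)
have -> : F0 + rho * y / (2 * s) * F1 - (v0 + y / (2 * s) * v1) =
  y * u1 * ((2 * s ^+ 2 * eta - (1 - rho)) / (2 * s)) +
  u2 * (s ^+ 2 * eta ^+ 2 / 2 - (1 - rho) * eta / 2) + r1 + rho * y / (2 * s) * r2 -
  (v0 - u0 - eta / 2 * u2) - y / (2 * s) * (v1 - u1).
  apply/eqP; rewrite -subr_eq0 /r1 /r2; apply/eqP.
  transitivity ((y * y - 1) * (rho * eta * u2 / 2)); last by rewrite yy subrr mul0r.
  by field; rewrite gt_eqF.
have s20 : 0 < 2 * s by rewrite mulr_gt0.
have N1 : `|y * u1 * ((2 * s ^+ 2 * eta - (1 - rho)) / (2 * s))| <= C * (2 * s ^+ 3 * eta ^+ 2).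
  rewrite normrM normrM y1 mul1r ler_pM//.
  rewrite normrM (ger0_norm (x := (2 * s)^-1)) ?invr_ge0 ?(ltW s20)//.
  rewrite ler_pdivrMr// (le_trans hr)//; apply: eq_leq_real; ring.
have N2 : `|u2 * (s ^+ 2 * eta ^+ 2 / 2 - (1 - rho) * eta / 2)| <= C * (2 * s ^+ 2 * eta ^+ 2).
  have n1 : 0 <= s ^+ 2 * eta ^+ 2 / 2 by rewrite divr_ge0// mulr_ge0// exprn_ge0// ltW.
  have n2 : 0 <= (1 - rho) * eta / 2.
    by apply: divr_ge0 => //; apply: mulr_ge0; [rewrite subr_ge0|exact: ltW].
  rewrite normrM ler_pM// (le_trans (ler_normB _ _))// (ger0_norm n1) (ger0_norm n2).
  have := ler_wpM2r (ltW eta0) hr2; rewrite expr2 (expr2 eta).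
  have : 0 <= s * s * (eta * eta) by rewrite !mulr_ge0// ltW.
  by move=> *; lra.
have N4 : `|rho * y / (2 * s) * r2| <= C * (s * eta ^+ 2 / 2).
  rewrite !normrM y1 mulr1 (ger0_norm rho0) (ger0_norm (x := (2 * s)^-1)) ?invr_ge0 ?(ltW s20)//.
  apply: (@le_trans _ _ (1 / (2 * s) * (C * (s * eta) ^+ 2))).
    apply: ler_pM => //; first by rewrite mulr_ge0// invr_ge0 ltW.
    by rewrite ler_wpM2r// invr_ge0 ltW.
  by apply: eq_leq_real; field; rewrite gt_eqF.
have N6 : `|y / (2 * s) * (v1 - u1)| <= C * (eta / (2 * s)).
  rewrite !normrM y1 mul1r (ger0_norm (x := (2 * s)^-1)) ?invr_ge0 ?(ltW s20)//.
  by rewrite mulrC mulrA ler_wpM2r// invr_ge0 ltW.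
rewrite !(mulrDr C).
rewrite (le_trans (ler_normB _ _))// lerD//.
rewrite (le_trans (ler_normB _ _))// lerD//.
rewrite (le_trans (ler_normD _ _))// lerD//.
rewrite (le_trans (ler_normD _ _))// lerD//.
  by rewrite (le_trans (ler_normD _ _))// lerD.
by rewrite -exprMn.
Qed.

End one_step.

Section discrete_chain.
Context {R : realType} {d : measure_display} {T : measurableType d}.
Variable P : probability T R.
Variable c : nat -> T -> 'I_2.
Hypothesis mc : forall i j, measurable [set w | c i w = j].

Definition spin (i : 'I_2) : R := if i == ord0 then 1 else -1.

Lemma spin_sqr i : spin i * spin i = 1.
Proof. by rewrite /spin; case: ifP => _; rewrite ?mulr1 ?mulrNN ?mulr1. Qed.

Lemma spin_norm i : `|spin i| = 1.
Proof. by rewrite /spin; case: ifP => _; rewrite ?normrN normr1. Qed.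

Local Notation e := (fun i w => spin (c i w)).

(** Dependence on the states of index at most [i] is stated on functions of state sequences instead
    of through a sigma-algebra. With two states such a variable is a finite combination of
    indicators of cylinders, hence measurable and bounded. *)
Definition past (i : nat) (G : T -> R) := exists2 g : (nat -> 'I_2) -> R,
  (forall a b, (forall k, (k <= i)%N -> a k = b k) -> g a = g b) &
  forall w, G w = g (c ^~ w).

Lemma past_comp2 i G H (f : R -> R -> R) : past i G -> past i H ->
  past i (fun w => f (G w) (H w)).
Proof.
move=> [g hg gE] [h hh hE]; exists (fun a => f (g a) (h a)).
  by move=> a b ab; rewrite (hg a b ab) (hh a b ab).
by move=> w; rewrite gE hE.
Qed.

Lemma past_comp i G (f : R -> R) : past i G -> past i (fun w => f (G w)).
Proof. by move=> pG; exact: (past_comp2 (fun x _ => f x) pG pG). Qed.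

Lemma past_le i j G : (i <= j)%N -> past i G -> past j G.
Proof.
move=> ij [g hg gE]; exists g => // a b ab; apply: hg => k ki.
by apply: ab; exact: leq_trans ij.
Qed.

Lemma past_spin i j : (j <= i)%N -> past i (e j).
Proof. by move=> ji; exists (fun a => spin (a j)) => // a b ab; rewrite ab. Qed.

Lemma past_sum i (n : nat) (F : nat -> T -> R) :
  (forall k, (k < n)%N -> past i (F k)) -> past i (fun w => \sum_(k < n) F k w).
Proof.
elim: n => [|n IH] h.
  by exists (fun=> 0) => // w; rewrite big_ord0.
have [g hg gE] : past i (fun w => \sum_(k < n) F k w + F n w).
  apply: (past_comp2 (fun x y => x + y)); last exact: h.
  by apply: IH => k kn; apply: h; exact: ltnW.
by exists g => // w; rewrite big_ord_recr -gE.
Qed.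

Lemma past_prod i (n : nat) (F : nat -> T -> R) :
  (forall k, (k < n)%N -> past i (F k)) -> past i (fun w => \prod_(k < n) F k w).
Proof.
elim: n => [|n IH] h.
  by exists (fun=> 1) => // w; rewrite big_ord0.
have [g hg gE] : past i (fun w => \prod_(k < n) F k w * F n w).
  apply: (past_comp2 (fun x y => x * y)); last exact: h.
  by apply: IH => k kn; apply: h; exact: ltnW.
by exists g => // w; rewrite big_ord_recr -gE.
Qed.

Lemma past_cylinders i g : (forall a b : nat -> 'I_2, (forall k, (k <= i)%N -> a k = b k) ->
    g a = g b) ->
  forall w, g (c ^~ w) = \sum_(p : {ffun 'I_i.+1 -> 'I_2})
    g (fun k => p (inord k)) * \1_(\bigcap_(k < i.+1) [set w | c k w = p (inord k)]) w :> R.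
Proof.
move=> hg w; pose q := [ffun k : 'I_i.+1 => c k w].
rewrite (bigD1 q)//= big1 ?addr0; last first.
  move=> p /eqP pq; rewrite indicE memNset ?mulr0// => h; apply: pq.
  apply/ffunP => k; rewrite ffunE; have /= := h k (ltn_ord k).
  by rewrite inord_val.
rewrite indicE mem_set; last by move=> k /= ki; rewrite ffunE inordK.
rewrite mulr1; apply: hg => k ki.
by rewrite ffunE inordK.
Qed.

Lemma measurable_cylinder i (p : nat -> 'I_2) :
  measurable (\bigcap_(k < i) [set w | c k w = p k]).
Proof. by apply: bigcap_measurableType => k _; exact: mc. Qed.

Lemma past_bmeas i G : past i G -> bmeas G.
Proof.
move=> [g hg gE].
apply: (eq_bmeas (fun w => esym (etrans (gE w) (past_cylinders hg w)))).
apply: bmeas_sum => p; apply: bmeasZ; apply: bmeas_indic.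
exact: (measurable_cylinder i.+1 (fun k => p (inord k))).
Qed.

Variable rho : R.
Hypothesis markov : forall i G, past i G ->
  Ex P (fun w => G w * e i.+1 w) = rho * Ex P (fun w => G w * e i w).

Definition walk (del : R) (i k : nat) (w : T) : R := \sum_(j < k) del * e (i + j)%N w.

Lemma walkS del i k w : walk del i k.+1 w = walk del i k w + del * e (i + k)%N w.
Proof. by rewrite /walk big_ord_recr. Qed.

Lemma walk_past_le del i k n : (forall j, (j < k)%N -> (i + j <= n)%N) ->
  past n (walk del i k).
Proof.
move=> h; apply: (@past_sum n k (fun j w => del * e (i + j)%N w)) => j jk.
exact: (@past_comp n (e (i + j)%N) (fun x => del * x) (past_spin (h j jk))).
Qed.

Lemma walk_past del i k : past (i + k)%N (walk del i k).
Proof. by apply: walk_past_le => j jk; rewrite leq_add2l ltnW. Qed.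

(** An off-by-one that matters: the last state read has index i + k, so the state of index i + k + 1
    is still to come and [markov] applies to it. *)
Lemma walk_pastS del i k : past (i + k)%N (walk del i k.+1).
Proof. by apply: walk_past_le => j jk; rewrite leq_add2l. Qed.

Lemma Ex_markov i G : past i G ->
  Ex P (fun w => G w * e i.+1 w) = rho * Ex P (fun w => G w * e i w).
Proof. exact: markov. Qed.

(** Expanding the powers and reducing with e^2 = 1 leaves a closed system of four sequences; the
    Markov identity brings in [rho] whenever a newer sign multiplies the walk. *)
Lemma walk_moments (s eta tau : R) i n : 0 < s -> 0 < eta -> s ^+ 2 * eta <= 1 ->
  0 <= rho -> rho * (1 + 2 * s ^+ 2 * eta) <= 1 -> n%:R * eta <= tau -> eta <= tau ->
  Ex P (fun w => walk (s * eta) i n w ^+ 4) <= 32 * tau ^+ 2.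
Proof.
move=> s0 eta0 se rho0 rho1 ntau etau.
have tau0 : 0 < tau by lra.
pose del := s * eta; pose W := walk del i.
have pW k : past (i + k)%N (W k) by exact: walk_past.
have bW k : bmeas (W k) by exact: (past_bmeas (pW k)).
have be k : bmeas (e k) by exact: (past_bmeas (past_spin (leqnn k))).
have mS k p : Ex P (fun w => W k.+1 w ^+ p * e (i + k.+1)%N w) =
    rho * Ex P (fun w => W k.+1 w ^+ p * e (i + k)%N w).
  rewrite addnS; apply: Ex_markov.
  exact: (@past_comp _ _ (fun x => x ^+ p) (walk_pastS _ _ _)).
have ee k w : e k w * e k w = 1 by exact: spin_sqr.
pose m k := Ex P (fun w => W k w * e (i + k)%N w).
pose a k := Ex P (fun w => W k w ^+ 2).
pose q k := Ex P (fun w => W k w ^+ 3 * e (i + k)%N w).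
pose z k := Ex P (fun w => W k w ^+ 4).
have bWe k p : bmeas (fun w => W k w ^+ p * e (i + k)%N w).
  by apply: bmeasM => //; exact: bmeasX.
have i1 k := bmeas_intg P (bmeasX 2 (bW k)).
have i2 k := bmeas_intg P (bmeasM (bW k) (be (i + k)%N)).
have i3 k := bmeas_intg P (bWe k 3).
have i4 k := bmeas_intg P (bmeasX 4 (bW k)).
have ic x := intg_cst P x.
have mE k : m k.+1 = rho * (m k + del).
  transitivity (Ex P (fun w => W k.+1 w ^+ 1 * e (i + k.+1)%N w)).
    by apply: Ex_eq => w; rewrite expr1.
  rewrite mS; congr (_ * _).
  transitivity (Ex P (fun w => W k w * e (i + k)%N w + del)).
    apply: Ex_eq => w; rewrite expr1 /W walkS mulrDl -mulrA ee mulr1 //.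
  by rewrite ExD// Ex_cst.
have aE k : a k.+1 = a k + 2 * del * m k + del ^+ 2.
  transitivity (Ex P (fun w => W k w ^+ 2 + (2 * del) * (W k w * e (i + k)%N w) + del ^+ 2)).
    apply: Ex_eq => w; rewrite /W walkS; move: (ee (i + k)%N w).
    move: (walk _ _ _ _) (e _ _) => x y y2.
    rewrite (_ : (x + del * y) ^+ 2 = x ^+ 2 + 2 * del * (x * y) + del ^+ 2 * (y * y)); last by ring.
    by rewrite y2; ring.
  by rewrite !ExD ?ExZ ?Ex_cst//; repeat first [exact: intgZ|apply: intgD].
have qE k : q k.+1 = rho * (q k + 3 * del * a k + 3 * del ^+ 2 * m k + del ^+ 3).
  rewrite /q mS; congr (_ * _).
  transitivity (Ex P (fun w => W k w ^+ 3 * e (i + k)%N w + (3 * del) * W k w ^+ 2 +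
    (3 * del ^+ 2) * (W k w * e (i + k)%N w) + del ^+ 3)).
    apply: Ex_eq => w; rewrite /W walkS; move: (ee (i + k)%N w).
    move: (walk _ _ _ _) (e _ _) => x y y2.
    have y22 : y ^+ 2 = 1 by rewrite expr2.
    have y4 : y ^+ 4 = 1 by rewrite (exprM y 2 2) y22 expr1n.
    have y3 : y ^+ 3 = y by rewrite exprS y22 mulr1.
    rewrite (_ : (x + del * y) ^+ 3 * y = x ^+ 3 * y + 3 * del * x ^+ 2 * (y * y) +
      3 * del ^+ 2 * x * y ^+ 3 + del ^+ 3 * y ^+ 4); last by ring.
    by rewrite y4 y3 y2; ring.
  by rewrite !ExD ?ExZ ?Ex_cst//; repeat first [exact: intgZ|apply: intgD].
have zE k : z k.+1 = z k + 4 * del * q k + 6 * del ^+ 2 * a k + 4 * del ^+ 3 * m k + del ^+ 4.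
  transitivity (Ex P (fun w => W k w ^+ 4 + (4 * del) * (W k w ^+ 3 * e (i + k)%N w) +
    (6 * del ^+ 2) * W k w ^+ 2 + (4 * del ^+ 3) * (W k w * e (i + k)%N w) + del ^+ 4)).
    apply: Ex_eq => w; rewrite /W walkS; move: (ee (i + k)%N w).
    move: (walk _ _ _ _) (e _ _) => x y y2.
    have y22 : y ^+ 2 = 1 by rewrite expr2.
    have y4 : y ^+ 4 = 1 by rewrite (exprM y 2 2) y22 expr1n.
    have y3 : y ^+ 3 = y by rewrite exprS y22 mulr1.
    rewrite (_ : (x + del * y) ^+ 4 = x ^+ 4 + 4 * del * (x ^+ 3 * y) +
      6 * del ^+ 2 * x ^+ 2 * (y * y) + 4 * del ^+ 3 * x * y ^+ 3 + del ^+ 4 * y ^+ 4); last by ring.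
    by rewrite y4 y3 y2; ring.
  by rewrite !ExD ?ExZ ?Ex_cst//; repeat first [exact: intgZ|apply: intgD].
have W0 w : W 0%N w = 0 by rewrite /W /walk big_ord0.
have m0 : m 0%N = 0.
  by rewrite /m -(Ex_cst P 0); apply: Ex_eq => w; rewrite W0 mul0r.
have a0 : a 0%N = 0.
  by rewrite /a -(Ex_cst P 0); apply: Ex_eq => w; rewrite W0 expr0n.
have q0 : q 0%N = 0.
  by rewrite /q -(Ex_cst P 0); apply: Ex_eq => w; rewrite W0 expr0n mul0r.
have z0 : z 0%N = 0.
  by rewrite /z -(Ex_cst P 0); apply: Ex_eq => w; rewrite W0 expr0n.
exact: (moment_recursion s0 eta0 se rho0 rho1 ntau etau mE aE qE zE m0 a0 q0 z0).
Qed.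

(** Telescoping in the manner of Lindeberg: [V k] is the corrected heat function with n - k steps
    left, evaluated at the walk after k steps, so one walk step is traded for one heat step. The
    corrector is at most C / (2 s), and removing it at both ends costs M C / s. The start [i] and
    the weight [G] leave room for earlier blocks. *)
Lemma walk_clt (C M s eta : R) (n i : nat) (G : T -> R) (U0 U1 U2 : nat -> R -> R) :
  0 < s -> 0 < eta -> 0 <= rho <= 1 ->
  `|2 * s ^+ 2 * eta - (1 - rho)| <= (2 * s ^+ 2 * eta) ^+ 2 ->
  1 - rho <= 2 * s ^+ 2 * eta ->
  (forall k, smooth2 C (U0 k) (U1 k) (U2 k)) ->
  (forall k x, `|U0 k.+1 x - U0 k x - eta / 2 * U2 k x| <= C * (49 * eta * Num.sqrt eta)) ->
  (forall k x, `|U1 k.+1 x - U1 k x| <= C * eta) ->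
  past i G -> (forall w, `|G w| <= M) ->
  `|Ex P (fun w => G w * U0 0%N (walk (s * eta) i n w)) - Ex P G * U0 n 0| <=
  M * (C / s) + n%:R * (M * (C * (2 * s ^+ 3 * eta ^+ 2 + 2 * s ^+ 2 * eta ^+ 2 +
    s ^+ 3 * eta ^+ 3 + s * eta ^+ 2 / 2 + 49 * eta * Num.sqrt eta + eta / (2 * s)))).
Proof.
move=> s0 eta0 rho01 hr hr2 sU hU0 hU1 pG GM.
have M0 : 0 <= M by apply: le_trans (GM point).
have C0 : 0 <= C by have [[b0 _ _] _] := sU 0%N; apply: le_trans (b0 0).
set err := C * (_ + eta / (2 * s)).
pose W := walk (s * eta) i.
pose V k w := U0 (n - k)%N (W k w) + e (i + k)%N w / (2 * s) * U1 (n - k)%N (W k w).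
have s20 : 0 < 2 * s by rewrite mulr_gt0.
have pW k : past (i + k)%N (W k) by exact: walk_past.
have pGk k : past (i + k)%N G by apply: past_le pG; exact: leq_addr.
have bG := past_bmeas pG.
have pV k : past (i + k)%N (V k).
  apply: (@past_comp2 _ _ _ (fun x y => U0 (n - k)%N x + y / (2 * s) * U1 (n - k)%N x)) => //.
  by apply: past_spin.
have bV k : bmeas (V k) := past_bmeas (pV k).
have step k : (k < n)%N ->
    `|Ex P (fun w => G w * V k.+1 w) - Ex P (fun w => G w * V k w)| <= M * err.
  move=> kn; have [m mE] : exists m, (n - k = m.+1)%N.
    by exists (n - k.+1)%N; rewrite -subSn.
  have mE' : (n - k.+1 = m)%N by rewrite subnS mE.
  pose A w := U0 m (W k.+1 w); pose B w := U1 m (W k.+1 w).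
  have pA : past (i + k)%N A by exact: (@past_comp _ _ (U0 m) (walk_pastS _ _ _)).
  have pB : past (i + k)%N B by exact: (@past_comp _ _ (U1 m) (walk_pastS _ _ _)).
  have be : bmeas (e (i + k)%N) := past_bmeas (past_spin (leqnn _)).
  have bA := past_bmeas pA; have bB := past_bmeas pB.
  have be' : bmeas (e (i + k.+1)%N) := past_bmeas (past_spin (leqnn _)).
  (* The Markov identity replaces the new sign in the corrector by [rho] times the previous one, the
     only sign left in the step. *)
  have -> : Ex P (fun w => G w * V k.+1 w) =
      Ex P (fun w => G w * (A w + rho * e (i + k)%N w / (2 * s) * B w)).
    transitivity (Ex P (fun w => G w * A w) +
        (2 * s)^-1 * Ex P (fun w => (G w * B w) * e (i + k).+1 w)).
      rewrite -ExZ; last by apply/bmeas_intg; apply: bmeasM; [exact: bmeasM|rewrite -addnS].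
      rewrite -ExD.
      - by apply: Ex_eq => w; rewrite /V mE' /A /B addnS; ring.
      - exact/bmeas_intg/bmeasM.
      - apply/bmeas_intg/bmeasZ; apply: bmeasM; first exact: bmeasM.
        by rewrite -addnS.
    rewrite Ex_markov; last exact: (@past_comp2 _ _ _ (fun x y => x * y)).
    rewrite mulrA -ExZ; last by apply/bmeas_intg/bmeasM => //; exact: bmeasM.
    rewrite -ExD.
    - by apply: Ex_eq => w; ring.
    - exact/bmeas_intg/bmeasM.
    - by apply/bmeas_intg/bmeasZ; apply: bmeasM => //; exact: bmeasM.
  apply: Ex_dist; last 1 first.
  - move=> w; rewrite -mulrBr normrM ler_pM//.
    rewrite /A /B /V mE /W walkS.
    apply: corrector_step => //; exact: spin_sqr.
  - apply: bmeasM => //; apply: bmeasD => //; apply: bmeasM => //.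
    by have := bmeasZ (rho / (2 * s)) be; apply: eq_bmeas => w; ring.
  - exact: bmeasM.
have tel k : (k <= n)%N ->
    `|Ex P (fun w => G w * V k w) - Ex P (fun w => G w * V 0%N w)| <= k%:R * (M * err).
  elim: k => [|k IH] kn; first by rewrite subrr normr0 mul0r.
  rewrite -(subrKA (Ex P (fun w => G w * V k w))) (le_trans (ler_normD _ _))//.
  rewrite -[k.+1%:R]natr1 mulrDl mul1r addrC lerD//; [exact/IH/ltnW|exact: step].
have corr k w : `|e (i + k)%N w / (2 * s) * U1 (n - k)%N (W k w)| <= C / (2 * s).
  rewrite !normrM spin_norm mul1r (ger0_norm (x := (2 * s)^-1)) ?invr_ge0 ?(ltW s20)//.
  rewrite mulrC ler_wpM2r ?invr_ge0 ?(ltW s20)//.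
  by have [[_ b1 _] _] := sU (n - k)%N; exact: b1.
have h1 : `|Ex P (fun w => G w * U0 0%N (W n w)) - Ex P (fun w => G w * V n w)| <= M * (C / (2 * s)).
  apply: Ex_dist; [|exact: bmeasM|].
    by apply: bmeasM => //; apply: past_bmeas; exact: (@past_comp _ _ (U0 0%N) (pW n)).
  move=> w; rewrite -mulrBr normrM ler_pM// /V subnn opprD addNKr.
  by rewrite normrN; have := corr n w; rewrite subnn.
have h2 : `|Ex P (fun w => G w * V 0%N w) - Ex P G * U0 n 0| <= M * (C / (2 * s)).
  rewrite mulrC -ExZ; last exact: bmeas_intg.
  apply: Ex_dist; [exact: bmeasM|exact: bmeasZ|].
  move=> w; rewrite [U0 n 0 * _]mulrC -mulrBr normrM ler_pM// /V subn0.
  have W0 : W 0%N w = 0 by rewrite /W /walk big_ord0.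
  rewrite W0 addrC addKr; have := corr 0%N w; rewrite subn0 W0.
  by [].
have h3 := tel n (leqnn n).
have -> : M * (C / s) = M * (C / (2 * s)) + M * (C / (2 * s)).
  by field; rewrite gt_eqF.
have -> : Ex P (fun w => G w * U0 0%N (walk (s * eta) i n w)) - Ex P G * U0 n 0 =
  (Ex P (fun w => G w * U0 0%N (W n w)) - Ex P (fun w => G w * V n w)) +
  (Ex P (fun w => G w * V 0%N w) - Ex P G * U0 n 0) +
  (Ex P (fun w => G w * V n w) - Ex P (fun w => G w * V 0%N w)).
  by ring.
rewrite (le_trans (ler_normD _ _))// lerD//.
by rewrite (le_trans (ler_normD _ _))// lerD.
Qed.

End discrete_chain.

(** * Transition matrices and sampling of the chain *)

Section flipflop_generator_exponential.
Context {R : realType}.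

Lemma ord2E (i : 'I_2) : i = ord0 \/ i = ord_max.
Proof. by case: i => -[|[|//]] h; [left|right]; apply/val_inj. Qed.

Lemma spinM (i j : 'I_2) : spin i * spin j = (if i == j then 1 else -1) :> R.
Proof.
by rewrite /spin; case: (ord2E i) => ->; case: (ord2E j) => -> /=;
  rewrite ?eqxx ?mulr1 ?mulrN1 ?mul1r ?opprK.
Qed.

(** The matrix is - 2 l h times the rank-one projection with entries spin i * spin j / 2. The zeroth
    power, the identity, is the exception. *)
Lemma flipflop_powers (l h : R) k (i j : 'I_2) :
  ((h *: flipflop_generator l) ^+ k.+1) i j =
  spin i * spin j * (- (2 * l * h)) ^+ k.+1 / 2.
Proof.
have A i' j' : (h *: flipflop_generator l) i' j' = spin i' * spin j' * (- (2 * l * h)) / 2.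
  by rewrite !mxE spinM; case: ifP => _; field.
elim: k i j => [|k IH] i j; first by rewrite !expr1 A.
rewrite exprS mxE big_ord_recl big_ord1 !IH !A.
set y := - (2 * l * h); rewrite [y ^+ k.+2]exprS.
have e0 : lift ord0 (ord0 : 'I_1) = ord_max :> 'I_2 by apply/val_inj.
rewrite e0; move: (y ^+ k.+1) => yk.
rewrite (_ : spin ord0 = 1 :> R)// (_ : spin ord_max = -1 :> R)//.
by field.
Qed.

Lemma mexp_flipflop (l h : R) (i j : 'I_2) :
  mexp (h *: flipflop_generator l) i j =
  (1 + spin i * spin j * expR (- (2 * l * h))) / 2.
Proof.
rewrite mxE; set y := - (2 * l * h).
(* The identity matrix has entries (1 + spin i * spin j) / 2, so the case k = 0 carries an
   additional 1. *)
have e (k : nat) : ((h *: flipflop_generator l) ^+ k) i j / k`!%:R =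
    ((k == 0)%N%:R + spin i * spin j * exp_coeff y k) / 2.
  case: k => [|k]; last first.
    rewrite flipflop_powers add0r /exp_coeff /= -/y.
    by rewrite [in RHS]mulrA [RHS]mulrAC.
  rewrite expr0 fact0 divr1 /exp_coeff /= expr0 fact0 divr1 mulr1 spinM mxE.
  by case: (i == j); rewrite /=; field.
rewrite (_ : (fun k => _) = (fun k : nat => ((k == 0)%N%:R + spin i * spin j * exp_coeff y k) / 2)); last first.
  by apply/funext => k; exact: e.
apply/cvg_lim => //.
have c1 : series (fun k : nat => (k == 0)%N%:R : R) @ \oo --> (1 : R).
  apply: cvg_near_cst; exists 1%N => // -[//|n] _.
  by rewrite /series /= big_nat_recl//= big1_seq ?addr0// => k _.
have c2 : series (exp_coeff y) @ \oo --> expR y by exact: is_cvg_series_exp_coeff.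
have c3 := cvgMr_tmp (b := 2^-1) (cvgD c1 (cvgMl_tmp (a := spin i * spin j) c2)).
rewrite (_ : series _ = (fun n => (series (fun k : nat => (k == 0)%N%:R : R) n +
  spin i * spin j * series (exp_coeff y) n) / 2)); first exact: c3.
apply/funext => n; rewrite /series /= mulr_sumr -big_split/= mulr_suml.
by apply: eq_bigr => k _.
Qed.

End flipflop_generator_exponential.

Section markov_discretization.
Context {R : realType} {d : measure_display} {T : measurableType d}.
Variable P : probability T R.
Implicit Types (l eta : R) (kappa : R -> T -> 'I_2).

(** Given a cylinder that fixes the states up to index i, the next state has probabilities (1 + rho)
    / 2 of being the same and (1 - rho) / 2 of being the other, so its mean spin is rho times the
    current one. Every [G] of the past is a combination of cylinders. *)
Lemma markov_chain_past l eta kappa i (G : T -> R) : 0 <= eta ->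
  markov_chain P (flipflop_generator l) kappa ->
  past (fun k => kappa (k%:R * eta)) i G ->
  Ex P (fun w => G w * spin (kappa (i.+1%:R * eta) w)) =
  expR (- (2 * l * eta)) * Ex P (fun w => G w * spin (kappa (i%:R * eta) w)).
Proof.
move=> eta0 [mk _ mp] [g hg gE].
pose c k := kappa (k%:R * eta).
have mc k j : measurable [set w | c k w = j] by apply: mk; rewrite mulr_ge0.
have nt : nondecreasing_seq (fun k : nat => k%:R * eta).
  by move=> a b ab; rewrite ler_wpM2r// ler_nat.
pose cyl n (p : nat -> 'I_2) := \bigcap_(k < n) [set w | c k w = p k].
have mcyl n p : measurable (cyl n p) by apply: (measurable_cylinder mc).
have cylS n p w : (cyl n.+1 p) w <-> (cyl n p) w /\ c n w = p n.
  split=> [h|[h1 h2] k /=]; first by split=> [k kn|]; apply: h => //=; exact: ltnW.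
  by rewrite ltnS leq_eqVlt => /predU1P[->//|kn]; exact: h1.
have law p : Ex P (fun w => \1_(cyl i.+2 p) w) =
    Ex P (fun w => \1_(cyl i.+1 p) w) * ((1 + spin (p i) * spin (p i.+1) * expR (- (2 * l * eta))) / 2).
  rewrite !Ex_indic//.
  have := mp i (fun k => k%:R * eta) p _ nt; rewrite mul0r lexx => /(_ isT) ->.
  rewrite fineM; [|exact/fin_num_measure/mcyl|by []].
  congr (_ * _) => /=.
  rewrite mexp_flipflop -mulrBl; congr (_ / _); congr (_ + _ * expR _).
  by rewrite -[i.+1%:R]natr1; ring.
have key p : Ex P (fun w => \1_(cyl i.+1 p) w * spin (c i.+1 w)) =
    expR (- (2 * l * eta)) * Ex P (fun w => \1_(cyl i.+1 p) w * spin (c i w)).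
  (* The prescribed states [p] up to index i, continued by the state [j]. *)
  pose q j (k : nat) : 'I_2 := if (k <= i)%N then p k else j.
  have cq j : cyl i.+1 (q j) = cyl i.+1 p.
    apply/seteqP; split=> w h k /= ki; have := h k ki; rewrite /q /=.
      by rewrite -ltnS ki.
    by rewrite -ltnS ki.
  have qi j : q j i = p i by rewrite /q leqnn.
  have qS j : q j i.+1 = j by rewrite /q ltnn.
  transitivity (Ex P (fun w => \1_(cyl i.+2 (q ord0)) w) - Ex P (fun w => \1_(cyl i.+2 (q ord_max)) w)).
    rewrite -ExB; [|exact/bmeas_intg/bmeas_indic..].
    apply: Ex_eq => w; rewrite !indicE.
    case: (pselect (cyl i.+1 p w)) => h; last first.
      rewrite !memNset ?mul0r ?subr0//.
      - by move=> /cylS []; rewrite cq.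
      - by move=> /cylS []; rewrite cq.
    rewrite [w \in cyl i.+1 p]mem_set// mul1r.
    case: (ord2E (c i.+1 w)) => h2.
      rewrite mem_set; last by apply/cylS; rewrite cq qS.
      rewrite memNset; first by rewrite h2 /spin eqxx subr0.
      by move=> /cylS []; rewrite qS h2.
    rewrite memNset; last by move=> /cylS []; rewrite qS h2.
    rewrite mem_set; first by rewrite h2 /spin/= sub0r.
    by apply/cylS; rewrite cq qS.
  rewrite !law !cq !qi !qS.
  transitivity (expR (- (2 * l * eta)) * (Ex P (fun w => \1_(cyl i.+1 p) w) * spin (p i))).
    by rewrite (_ : spin ord0 = 1 :> R)// (_ : spin ord_max = -1 :> R)//; field.
  congr (_ * _); rewrite mulrC -ExZ; last exact/bmeas_intg/bmeas_indic.
  apply: Ex_eq => w; rewrite indicE.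
  case: (pselect (cyl i.+1 p w)) => h; last by rewrite memNset// mul0r mulr0.
  by rewrite mulrC mem_set// !mul1r; have /= := h i (ltnSn i) => ->.
have mspin k : bmeas (fun w => spin (c k w) : R).
  exact: (past_bmeas mc (past_spin c (leqnn k))).
have expand k : Ex P (fun w => G w * spin (c k w)) =
    \sum_(p : {ffun 'I_i.+1 -> 'I_2}) g (fun k => p (inord k)) *
      Ex P (fun w => \1_(cyl i.+1 (fun k => p (inord k))) w * spin (c k w)).
  transitivity (Ex P (fun w => \sum_(p : {ffun 'I_i.+1 -> 'I_2}) g (fun k => p (inord k)) *
      (\1_(cyl i.+1 (fun k => p (inord k))) w * spin (c k w)))).
    apply: Ex_eq => w; rewrite gE [g _](past_cylinders c hg w) mulr_suml.
    by apply: eq_bigr => p _; rewrite mulrA.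
  rewrite Ex_sum; last first.
    by move=> p; apply: bmeasZ; apply: bmeasM => //; exact: bmeas_indic.
  apply: eq_bigr => p _; rewrite ExZ//.
  by apply: bmeas_intg; apply: bmeasM => //; exact: bmeas_indic.
rewrite -/(c i) -/(c i.+1) !expand mulr_sumr.
by apply: eq_bigr => p _; rewrite key mulrCA.
Qed.

End markov_discretization.

(** * Paths of the flip-flop fluid queue *)

Section riemann_sums.
Context {R : realType}.
Local Notation mu := (@lebesgue_measure R).
Implicit Types (a b t : R) (k : R -> 'I_2).

(** Turns integrals over [a, b] into expectations, so that Riemann sums converge by [Ex_cvg]. The
    proof shifts [f] by [M] because the formula for the uniform law is applied to nonnegative
    functions. *)
Lemma Ex_uniform a b (ab : a < b) (f : R -> R) : bmfun f ->
  Ex (uniform_prob ab) f = (b - a)^-1 * (\int[mu]_(x in `[a, b]) f x)%R.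
Proof.
move=> [mf [M hM]].
have ba : 0 < b - a by rewrite subr_gt0.
have i_ (g : R -> R) N : measurable_fun setT g -> (forall x, `|g x| <= N) ->
    mu.-integrable `[a, b] (EFin \o g).
  move=> mg hN; apply: measurable_bounded_integrable => //.
  - by rewrite /= lebesgue_measure_itv/= lte_fin ab -EFinD ltry.
  - exact: measurable_funS mg.
  - by exists N; split; [exact: num_real|move=> x Nx y _; apply: le_trans (hN y) _; exact: ltW].
have mfM : measurable_fun setT (fun x => f x + M) by exact: measurable_funD.
have e : Ex (uniform_prob ab) (fun x => f x + M) =
    (b - a)^-1 * (\int[mu]_(x in `[a, b]) (f x + M))%R.
  rewrite /Ex /Rintegral integral_uniform.
  - rewrite fineM//; apply: (integrable_fin_num (mu := mu)) => //.
    apply: (i_ (fun x => f x + M) (M + M)) => // x.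
    by rewrite (le_trans (ler_normD _ _))// lerD// ger0_norm// (le_trans _ (hM x)).
  - exact/measurable_EFinP.
  - by move=> x; rewrite lee_fin; have := hM x; rewrite ler_norml => /andP[]; lra.
have bf : bmeas f by split => //; exists M.
move: e; rewrite ExD; [|exact: bmeas_intg|exact: intg_cst].
rewrite Ex_cst RintegralD//; [|exact: (i_ f M)|exact: (i_ (fun=> M) `|M|)].
rewrite Rintegral_cst//= lebesgue_measure_itv/= lte_fin ab -EFinD/= mulrDr.
rewrite (_ : (b - a)^-1 * (M * (b - a)) = M); last by field; rewrite gt_eqF.
by move/addIr.
Qed.

Definition right_const k := forall t, 0 <= t -> \forall s \near t^'+, k s = k t.

Definition occupation k t : R := (\int[mu]_(s in `[0%R, t]) spin (k s))%R.

Definition grid a b (N i : nat) : R := a + i%:R * ((b - a) / N.+1%:R).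

(** The path is sampled at the right end of the cell: for fixed s these points approach s from the
    right, where a right-constant path has the value [k s]. *)
Definition stepfun a b k (N : nat) (s : R) : R :=
  \sum_(i < N.+1) spin (k (grid a b N i.+1)) * \1_(`[grid a b N i, grid a b N i.+1[) s.

Lemma grid_last a b N : grid a b N N.+1 = b.
Proof. by rewrite /grid mulrC divfK ?pnatr_eq0// addrC subrK. Qed.

Lemma grid0 a b N : grid a b N 0 = a.
Proof. by rewrite /grid mul0r addr0. Qed.

Lemma grid_lt a b N i j : a < b -> (i < j)%N -> grid a b N i < grid a b N j.
Proof.
by move=> ab ij; rewrite ltrD2l ltr_pM2r ?ltr_nat// divr_gt0// subr_gt0.
Qed.

Lemma grid_le a b N i j : a < b -> (i <= j)%N -> grid a b N i <= grid a b N j.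
Proof.
by move=> ab ij; rewrite lerD2l ler_pM2r ?ler_nat// divr_gt0// subr_gt0.
Qed.

Lemma gridS a b N i : grid a b N i.+1 = grid a b N i + (b - a) / N.+1%:R.
Proof. by rewrite /grid -[i.+1%:R]natr1; ring. Qed.

Lemma grid_find a b N s : a < b -> a <= s < b ->
  exists2 i : 'I_N.+1, grid a b N i <= s & s < grid a b N i.+1.
Proof.
move=> ab /andP[as_ sb].
pose h := (b - a) / N.+1%:R.
have h0 : 0 < h by rewrite divr_gt0// subr_gt0.
have x0 : 0 <= (s - a) / h by rewrite divr_ge0 ?subr_ge0// ltW.
have /andP[i1 i2] := truncn_itv x0.
have iN : (Num.truncn ((s - a) / h) < N.+1)%N.
  rewrite truncn_lt_nat// ltr_pdivrMr// /h mulrCA divff ?pnatr_eq0// mulr1.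
  by rewrite ltrD2r.
exists (Ordinal iN); rewrite /grid /= -/h.
  by rewrite -lerBrDl -ler_pdivlMr.
by rewrite -ltrBlDl -ltr_pdivrMr.
Qed.

Lemma stepfun_in a b k N s (i : 'I_N.+1) : a < b ->
  grid a b N i <= s -> s < grid a b N i.+1 ->
  stepfun a b k N s = spin (k (grid a b N i.+1)).
Proof.
move=> ab s1 s2; rewrite /stepfun (bigD1 i)//= big1 ?addr0.
  by rewrite indicE mem_set ?mulr1//= in_itv/= s1 s2.
move=> j /eqP ji; rewrite indicE memNset ?mulr0//= in_itv/= => /andP[h1 h2].
apply: ji; apply/val_inj => /=; case: (ltngtP j i) => // ij.
  have := grid_le N ab ij => h; have := lt_le_trans h2 h.
  by rewrite ltNge s1.
have := grid_le N ab ij => h; have := lt_le_trans s2 h.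
by rewrite ltNge h1.
Qed.

Lemma stepfun_out a b k N s : a < b -> ~ (a <= s < b) -> stepfun a b k N s = 0.
Proof.
move=> ab hs; rewrite /stepfun big1// => i _.
rewrite indicE memNset ?mulr0//= in_itv/= => /andP[h1 h2]; apply: hs.
have := grid_le N ab (leq0n i); rewrite grid0 => h3.
have := grid_le N ab (ltn_ord i); rewrite grid_last => h4.
by rewrite (le_trans h3 h1) (lt_le_trans h2 h4).
Qed.

Lemma stepfun_le1 a b k N s : a < b -> `|stepfun a b k N s| <= 1.
Proof.
move=> ab; case: (pselect (a <= s < b)) => hs; last by rewrite stepfun_out// normr0.
by have [i h1 h2] := grid_find N ab hs; rewrite (stepfun_in k ab h1 h2) spin_norm.
Qed.

Lemma stepfun_cvg a b k s : a < b -> 0 <= a -> right_const k ->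
  stepfun a b k N s @[N --> \oo] --> \1_(`[a, b[) s * spin (k s).
Proof.
move=> ab a0 hk.
case: (pselect (a <= s < b)) => hs; last first.
  rewrite indicE memNset ?mul0r; last by rewrite /= in_itv.
  under eq_fun do rewrite stepfun_out//.
  exact: cvg_cst.
have /andP[as_ sb] := hs.
rewrite indicE mem_set ?mul1r; last by rewrite /= in_itv.
have [e /= e0 he] := hk s (le_trans a0 as_).
have ba : 0 < b - a by rewrite subr_gt0.
have e1 : 0 < e / (b - a) by rewrite divr_gt0.
apply: cvg_near_cst; near=> N.
have [i h1 h2] := grid_find N ab hs.
rewrite (stepfun_in k ab h1 h2); congr spin; apply: he => //=.
have h3 : (b - a) / N.+1%:R < e.
  rewrite mulrC -ltr_pdivlMr//; near: N; exact: (near_infty_natSinv_lt (PosNum e1)).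
rewrite ltr0_norm ?subr_lt0// opprB; move: h1; rewrite -(lerD2r ((b - a) / N.+1%:R)) -gridS.
by move: (grid a b N i.+1) (_ / _) h3 => g q; lra.
Unshelve. all: by end_near.
Qed.

Lemma riemann a b k : a < b -> 0 <= a -> right_const k ->
  bmfun (fun s => \1_(`[a, b[) s * spin (k s)) /\
  \sum_(i < N.+1) (b - a) / N.+1%:R * spin (k (grid a b N i.+1)) @[N --> \oo] -->
    (\int[mu]_(s in `[a, b]) (\1_(`[a, b[) s * spin (k s)))%R.
Proof.
move=> ab a0 hk.
have ba : 0 < b - a by rewrite subr_gt0.
have bstep N : bmeas (stepfun a b k N).
  by apply: bmeas_sum => i; apply: bmeasZ; exact: bmeas_indic.
have [bF cF] := @Ex_cvg _ _ _ (uniform_prob ab) (stepfun a b k)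
  (fun s => \1_(`[a, b[) s * spin (k s)) 1 (fun N => (bstep N).1)
  (fun N s => stepfun_le1 k N s ab)
  (fun s => @stepfun_cvg a b k s ab a0 hk).
split; first exact: bF.
move: cF; rewrite Ex_uniform//.
have -> : (fun N => Ex (uniform_prob ab) (stepfun a b k N)) =
   (fun N => (b - a)^-1 * \sum_(i < N.+1) (b - a) / N.+1%:R * spin (k (grid a b N i.+1))).
  apply/funext => N; rewrite /stepfun Ex_sum; last first.
    by move=> i; apply: bmeasZ; exact: bmeas_indic.
  rewrite mulr_sumr; apply: eq_bigr => i _.
  rewrite ExZ; last exact/bmeas_intg/bmeas_indic.
  rewrite Ex_uniform; last exact: bmfun_indic.
  rewrite mulrCA; congr (_ * _); rewrite mulrC; congr (_ * _).
  rewrite /Rintegral integral_indic// setIidl.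
    rewrite /= lebesgue_measure_itv/= lte_fin (grid_lt N ab (ltnSn i)) -EFinD/=.
    by rewrite gridS; ring.
  move=> s /=; rewrite !in_itv/= => /andP[h1 h2].
  have := grid_le N ab (leq0n i); rewrite grid0 => h3.
  have := grid_le N ab (ltn_ord i); rewrite grid_last => h4.
  by rewrite (le_trans h3 h1) ltW// (lt_le_trans h2 h4).
move=> /(cvgMl_tmp (a := b - a)); rewrite mulrA divff ?gt_eqF// mul1r.
by under eq_fun do rewrite mulrA divff ?gt_eqF// mul1r.
Qed.

End riemann_sums.

Lemma eq_cvg_nat {R : realType} (u v : nat -> R) (x : R) : (forall n, u n = v n) ->
  u n @[n --> \oo] --> x -> v n @[n --> \oo] --> x.
Proof. by move=> e; have -> : u = v by apply/funext. Qed.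

Section running_integral.
Context {R : realType}.
Local Notation mu := (@lebesgue_measure R).
Implicit Types (g : R -> R) (s t b M c : R).

Definition locally_bounded_integrand g M :=
  (forall b, 0 <= b -> measurable_fun `[0, b] g) /\ (forall s, `|g s| <= M).

Definition running g t : R := (\int[mu]_(s in `[0%R, t]) g s)%R.

Lemma running_integrable g M b : 0 <= b -> locally_bounded_integrand g M ->
  mu.-integrable `[0, b] (EFin \o g).
Proof.
move=> b0 [mg hM]; apply: measurable_bounded_integrable => //.
- by rewrite /= lebesgue_measure_itv/=; case: ifP => _; rewrite ?ltry// -EFinD ltry.
- exact: mg.
- by exists M; split; [exact: num_real|move=> x Nx y _; apply: le_trans (hM y) _; exact: ltW].
Qed.

Lemma running_incr g M t s : locally_bounded_integrand g M -> 0 <= t -> t <= s ->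
  running g s - running g t = (\int[mu]_(u in `]t, s]) g u)%R.
Proof.
move=> hg t0 ts; rewrite /running Rintegral_itvB//.
by apply: (running_integrable _ hg); exact: le_trans ts.
Qed.

Lemma running_incr_integrable g M t s : locally_bounded_integrand g M -> 0 <= t -> t <= s ->
  mu.-integrable `]t, s] (EFin \o g).
Proof.
move=> hg t0 ts; apply: (integrableS _ _ _ (running_integrable (le_trans t0 ts) hg)) => //.
move=> u /=; rewrite !in_itv/= => /andP[h ->]; rewrite andbT.
by rewrite ltW// (le_lt_trans t0).
Qed.

Lemma running_const g M t s c : locally_bounded_integrand g M -> 0 <= t -> t <= s ->
  (forall u, t < u <= s -> g u = c) -> running g s - running g t = c * (s - t).
Proof.
move=> hg t0 ts h; rewrite (running_incr hg)//.
rewrite (@eq_Rintegral _ _ _ mu _ (cst c)); last first.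
  by move=> u; rewrite inE/= in_itv/= => hu; rewrite h.
rewrite Rintegral_cst//= lebesgue_measure_itv/=; case: ifP; rewrite lte_fin.
  by rewrite -EFinD.
move/negbT; rewrite -leNgt => st; have -> : s = t by apply/eqP; rewrite eq_le st ts.
by rewrite subrr.
Qed.

Lemma running_lip g M t s : locally_bounded_integrand g M -> 0 <= t -> t <= s ->
  `|running g s - running g t| <= M * (s - t).
Proof.
move=> hg t0 ts; rewrite (running_incr hg)//.
have i := running_incr_integrable hg t0 ts.
rewrite (le_trans (le_normr_Rintegral _ i))//.
have -> : M * (s - t) = (\int[mu]_(u in `]t, s]) M)%R.
  rewrite Rintegral_cst//= lebesgue_measure_itv/=; case: ifP; rewrite lte_fin.
    by rewrite -EFinD.
  move/negbT; rewrite -leNgt => st; have -> : s = t by apply/eqP; rewrite eq_le st ts.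
  by rewrite subrr.
apply: le_Rintegral => //; last by move=> u _; exact: hg.2.
- exact: (integrable_abse i).
- have hc : locally_bounded_integrand (fun=> M) `|M| by split.
  exact: (running_incr_integrable hc t0 ts).
Qed.

Lemma running0 g : running g 0 = 0.
Proof. by rewrite /running set_itv1 Rintegral_set1. Qed.

Lemma running_cpath g M : locally_bounded_integrand g M -> cpath (running g).
Proof.
move=> hg; have M0 : 0 <= M by apply: le_trans (hg.2 0).
apply/cpathP => t t0 e e0.
have M1 : 0 < M + 1 by lra.
exists (e / (M + 1)); first by rewrite divr_gt0.
move=> s s0; rewrite ltr_pdivlMr// => h; apply: le_lt_trans h.
have key a b : 0 <= a -> a <= b -> `|running g b - running g a| <= `|b - a| * (M + 1).
  move=> a0 ab; apply: (le_trans (running_lip hg a0 ab)).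
  rewrite ger0_norm ?subr_ge0// mulrC ler_wpM2l ?subr_ge0//; lra.
case: (leP t s) => ts; first exact: key.
by rewrite distrC (distrC s); apply: key => //; exact: ltW.
Qed.

(** Take the supremum of the times up to which [f] keeps its initial value: continuity gives that
    value at the supremum, and constancy to the right carries it further. *)
Lemma right_locally_constant (f : R -> R) : cpath f ->
  (forall t, 0 <= t -> exists2 e, 0 < e & forall s, t <= s < t + e -> f s = f t) ->
  forall t, 0 <= t -> f t = f 0.
Proof.
move=> /cpathP cf hf T T0.
pose A := [set t | 0 <= t <= T /\ forall s, 0 <= s <= t -> f s = f 0].
have A0 : A 0.
  split; first by rewrite lexx.
  by move=> s /andP[s0 s1]; congr f; apply/eqP; rewrite eq_le s1 s0.
have supA : has_sup A by split; [exists 0|exists T => t [/andP[]]].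
have S0 : 0 <= sup A by apply: ub_le_sup => //; exact: supA.2.
have ST : sup A <= T by apply: ge_sup; [exists 0|move=> t [/andP[]]].
have below s : 0 <= s -> s < sup A -> f s = f 0.
  move=> s0 sS; have [t [_ ht] st] := sup_gt (ex_intro _ 0 A0) sS.
  by apply: ht; rewrite s0 ltW.
have atS : f (sup A) = f 0.
  apply/eqP; rewrite -subr_eq0 -normr_le0; apply/ler_addgt0Pr => e e0.
  rewrite add0r; have [d d0 hd] := cf (sup A) S0 e e0.
  have [S1|S1] := ltP 0 (sup A); last first.
    by rewrite (_ : sup A = 0) ?subrr ?normr0 ?ltW//; apply/eqP; rewrite eq_le S0 S1.
  pose s := Num.max 0 (sup A - d / 2).
  have s0 : 0 <= s by rewrite le_max lexx.
  have sS : s < sup A by rewrite gt_max S1 ltrBlDr ltrDl divr_gt0.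
  have sd : `|s - sup A| < d.
    rewrite ltr0_norm ?subr_lt0// opprB ltrBlDr -ltrBlDl.
    by rewrite lt_max; apply/orP; right; rewrite ltrD2l ltrN2 ltr_pdivrMr// ltr_pMr// ltr1n.
  by rewrite -(below s s0 sS) distrC ltW// hd.
have [e e0 he] := hf (sup A) S0.
have [ST'|] := ltP (sup A) T; last first.
  by move=> TS; rewrite (_ : T = sup A)//; apply/eqP; rewrite eq_le TS ST.
pose s' := Num.min T (sup A + e / 2).
have ss : sup A < s' by rewrite lt_min ST' ltrDl divr_gt0.
have se : s' < sup A + e.
  by rewrite gt_min; apply/orP; right; rewrite ltrD2l ltr_pdivrMr// ltr_pMr// ltr1n.
have As' : A s'.
  split; first by rewrite (le_trans S0 (ltW ss)) ge_min lexx.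
  move=> s /andP[s0 s1]; have [h|h] := ltP s (sup A); first exact: below.
  by rewrite -atS; apply: he; rewrite h (le_lt_trans s1).
by have := ub_le_sup supA.2 As'; rewrite leNgt ss.
Qed.

End running_integral.

(** * Flip-flop paths, their regulator and their time at zero *)

Section flipflop_path_properties.
Context {R : realType}.
Local Notation mu_ := (@lebesgue_measure R).
Implicit Types (k : R -> 'I_2) (mu sigma l t s : R).

Lemma spin_integrand k : right_const k ->
  locally_bounded_integrand (fun s => spin (k s)) 1.
Proof.
move=> hk; split; last by move=> s; rewrite spin_norm.
move=> b b0; have b1 : 0 < b + 1 by rewrite ltr_wpDl.
have [[mF _] _] := riemann b1 (lexx 0) hk.
apply: (@eq_measurable_fun _ _ _ _ _ (fun s => \1_(`[0, b + 1[) s * spin (k s))).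
  move=> s; rewrite inE/= in_itv/= => /andP[s0 sb].
  by rewrite indicE mem_set ?mul1r//= in_itv/= s0 (le_lt_trans sb)// ltrDl.
exact: measurable_funS mF.
Qed.

Lemma occupation_running k : occupation k = running (fun s => spin (k s)).
Proof. by []. Qed.

(** The walks sample at left ends, since they must read the past; this sum differs from the one over
    right ends by a single boundary term of size O(1 / N). *)
Lemma occupation_riemann a b k : a < b -> 0 <= a -> right_const k ->
  \sum_(i < N.+1) (b - a) / N.+1%:R * spin (k (grid a b N i)) @[N --> \oo] -->
  occupation k b - occupation k a.
Proof.
move=> ab a0 hk; have [[mF [M hM]] c1] := riemann ab a0 hk.
have hs := spin_integrand hk.
have iab : mu_.-integrable `[a, b] (EFin \o (fun s => spin (k s))).
  apply: (integrableS _ _ _ (running_integrable (le_trans a0 (ltW ab)) hs)) => //.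
  by move=> u /=; rewrite !in_itv/= => /andP[h ->]; rewrite (le_trans a0).
have e : (\int[mu_]_(s in `[a, b]) (\1_(`[a, b[) s * spin (k s)))%R =
    occupation k b - occupation k a.
  rewrite occupation_running (running_incr hs)//; last exact: ltW.
  rewrite Rintegral_itv_obnd_cbnd; last exact: (running_incr_integrable hs a0 (ltW ab)).
  have i1 : mu_.-integrable `[a, b[ (EFin \o (fun s => spin (k s))).
    by apply: (integrableS _ _ _ iab) => //; apply: subset_itvl; rewrite bnd_simp.
  have e1 (s : R) : s \in ([set` `[a, b[] : set R) ->
      spin (k s) = \1_(`[a, b[) s * spin (k s) :> R.
    by move=> sab; rewrite indicE sab mul1r.
  rewrite -(Rintegral_itv_bndo_bndc i1) -Rintegral_itv_bndo_bndc.
    by apply: eq_Rintegral => s sab; rewrite -e1.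
  have := @eq_integrable _ _ _ mu_ _ (measurable_itv `[a, b[)
    (EFin \o (fun s => spin (k s))) (EFin \o (fun s => \1_(`[a, b[) s * spin (k s))).
  by apply => // s sab; rewrite /= -e1.
rewrite -e.
have c2 : (b - a) / N.+1%:R * (spin (k a) - spin (k b)) @[N --> \oo] --> (0 : R).
  rewrite -[X in _ --> X](mul0r (spin (k a) - spin (k b))); apply: cvgMr_tmp.
  rewrite -[X in _ --> X](mulr0 (b - a)); apply: cvgMl_tmp.
  exact: eq_cvg_nat (@cvg_harmonic R).
rewrite -[X in _ --> X]addr0; apply: eq_cvg_nat (cvgD c1 c2) => N; rewrite ?fctE /=.
rewrite big_ord_recr /= grid_last big_ord_recl /= grid0.
set S1 := \sum_(i < N) _.
by ring.
Qed.

Lemma flipflop_rateE mu sigma l i :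
  flipflop_rate mu sigma l i = mu + sigma * Num.sqrt l * spin i.
Proof. by rewrite /flipflop_rate /spin; case: ifP => _; rewrite ?mulr1 ?mulrN1. Qed.

Lemma flipflop_pathE mu sigma l k t : right_const k -> 0 <= t ->
  flipflop_path mu sigma l k t = mu * t + sigma * Num.sqrt l * occupation k t.
Proof.
move=> hk t0; have i := running_integrable t0 (spin_integrand hk).
have ic : mu_.-integrable `[0, t] (EFin \o (fun=> mu)).
  have hc : locally_bounded_integrand (fun=> mu : R) `|mu| by split.
  exact: (running_integrable t0 hc).
rewrite /flipflop_path.
under eq_Rintegral do rewrite flipflop_rateE.
rewrite RintegralD//; last first.
  have hc : locally_bounded_integrand (fun s => sigma * Num.sqrt l * spin (k s))
      `|sigma * Num.sqrt l|.
    split=> [b b0|s]; last by rewrite normrM spin_norm mulr1.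
    by apply: measurable_funM => //; exact: (spin_integrand hk).1.
  exact: (running_integrable t0 hc).
rewrite RintegralZl// Rintegral_cst//= lebesgue_measure_itv/= lte_fin.
congr (_ + _); move: t0; rewrite le_eqVlt => /predU1P[<-|t0].
  by rewrite ltxx mulr0.
by rewrite t0 -EFinD/= subr0.
Qed.

Lemma occupation0 k : occupation k 0 = 0.
Proof. exact: running0. Qed.

Lemma flipflop_path0 mu sigma l k : right_const k -> path0 (flipflop_path mu sigma l k).
Proof.
move=> hk; split; last by rewrite flipflop_pathE// occupation0 !mulr0 addr0.
have h : cpath (fun t => mu * t + sigma * Num.sqrt l * occupation k t).
  apply: cpathD; first exact: (cpathZ (c := mu) cpath_id).
  exact: (cpathZ (c := sigma * Num.sqrt l) (running_cpath (spin_integrand hk))).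
move/cpathP : h => h; apply/cpathP => t t0 e e0.
have [d d0 hd] := h t t0 e e0; exists d => // s s0 sd.
by rewrite !flipflop_pathE//; exact: hd.
Qed.

Lemma flipflop_local mu sigma l k t : right_const k -> 0 <= t ->
  exists2 e, 0 < e & forall s, t <= s < t + e -> flipflop_path mu sigma l k s =
    flipflop_path mu sigma l k t + flipflop_rate mu sigma l (k t) * (s - t).
Proof.
move=> hk t0; have [e /= e0 he] := hk t t0; exists e => // s /andP[ts se].
have s0 := le_trans t0 ts.
have := @running_const _ (fun u => spin (k u)) 1 t s (spin (k t)) (spin_integrand hk) t0 ts.
rewrite -occupation_running => h; rewrite !flipflop_pathE// flipflop_rateE.
have {}h : occupation k s - occupation k t = spin (k t) * (s - t).
  apply: h => u /andP[tu us]; congr spin; apply: he => //=.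
  by rewrite ltr0_norm ?subr_lt0// opprB ltrBlDl (le_lt_trans us).
move/eqP: h; rewrite subr_eq => /eqP ->; ring.
Qed.

Lemma zero_set_integrand (z : R -> R) : cpath z ->
  locally_bounded_integrand (\1_[set u | z u = 0]) 1.
Proof.
move=> cz; split; last by move=> s; rewrite indicE; case: (_ \in _); rewrite ?normr1 ?normr0.
move=> b b0; have cz' := cpath_sub (b := b) cz (lexx 0).
have mz : measurable_fun `[0, b] z by exact: (subspace_continuous_measurable_fun _ cz').
have m1 : measurable_fun setT (\1_[set 0 : R] : R -> R) by exact: measurable_indic.
have := measurableT_comp m1 mz; apply: eq_measurable_fun => s _ /=.
rewrite !indicE; congr (_%:R); apply/idP/idP; rewrite !inE.
Qed.

(* Both sides are continuous with the same right derivative at every time. *)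
Lemma regulator_time_at_zero mu sigma l k t : right_const k -> 0 <= t ->
  0 < mu + sigma * Num.sqrt l -> mu - sigma * Num.sqrt l < 0 ->
  regulator (flipflop_path mu sigma l k) t =
  (sigma * Num.sqrt l - mu) * time_at_zero (reflected (flipflop_path mu sigma l k)) t.
Proof.
move=> hk t0 c1 c2; set x := flipflop_path mu sigma l k; set z := reflected x.
have px : path0 x by exact: flipflop_path0.
have cz : cpath z by exact: cpath_reflected.
have hz := zero_set_integrand cz.
pose L := running (\1_[set u | z u = 0]).
have LE u : time_at_zero z u = L u by [].
pose f u := regulator x u + (- (sigma * Num.sqrt l - mu)) * L u.
have cf : cpath f.
  apply: cpathD; first exact: cpath_regulator.
  exact: (cpathZ (c := - (sigma * Num.sqrt l - mu)) (running_cpath hz)).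
suff h : f t = f 0.
  move: h; rewrite /f regulator0// /L running0 mulr0 addr0 mulNr => /eqP.
  by rewrite subr_eq0 => /eqP.
apply: (right_locally_constant cf _ t0) => {t0} {}t t0.
have Lpos s : t <= s -> (forall u, t < u <= s -> 0 < z u) -> L s = L t.
  move=> ts h; apply/eqP; rewrite -subr_eq0; apply/eqP.
  rewrite -(mul0r (s - t)); apply: (running_const hz) => // u hu.
  by rewrite indicE memNset//= => zu; have := h u hu; rewrite zu ltxx.
have [e e0 he] := flipflop_local mu sigma l hk t0.
have z0 : 0 <= z t.
  by have := @regulator_ge _ x t t px; rewrite t0 lexx => /(_ isT); rewrite /z /reflected; lra.
(* While [z] is positive, [x] cannot reach a new minimum, so both terms of [f] stay put. *)
move: z0; rewrite le_eqVlt => /predU1P[z0|z0]; last first.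
  have /cpathP/(_ t t0 (z t) z0) [d d0 hd] := cz.
  exists d => // s /andP[ts sd]; rewrite /f.
  have zpos u : t <= u <= s -> 0 < z u.
    move=> /andP[tu us].
    have := hd u (le_trans t0 tu); rewrite ger0_norm ?subr_ge0// => h.
    have : `|z u - z t| < z t by apply: h; lra.
    by rewrite ltr_norml => /andP[]; lra.
  rewrite Lpos//; last by move=> u /andP[tu us]; apply: zpos; rewrite us ltW.
  congr (_ + _); apply/eqP; rewrite eq_le; apply/andP; split; last first.
    by apply: regulator_mono => //; rewrite t0.
  have [u /andP[u0 us] [Rs _]] := regulator_attained px (le_trans t0 ts).
  case: (leP u t) => ut; first by rewrite Rs; apply: regulator_ge => //; rewrite u0.
  have : 0 < z u by apply: zpos; rewrite us ltW.
  have : regulator x u <= regulator x s by apply: regulator_mono => //; rewrite u0.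
  by rewrite /z /reflected Rs; lra.
have Rt : regulator x t = - x t by move: z0; rewrite /z /reflected; lra.
exists e => // s hs; have /andP[ts se] := hs; have xs := he s hs.
have he' u : t <= u <= s ->
    x u = x t + flipflop_rate mu sigma l (k t) * (u - t).
  by move=> /andP[tu us]; apply: he; rewrite tu (le_lt_trans us).
have rE : flipflop_rate mu sigma l (k t) = (if k t == ord0 then mu + sigma * Num.sqrt l
    else mu - sigma * Num.sqrt l) by [].
(* At 0 in the first state the path rises: the regulator is frozen and [z] leaves 0 at once. *)
case: (ord2E (k t)) => kt; rewrite kt /= in rE he'; rewrite rE in he'.
  have Rs u : t <= u <= s -> regulator x u = regulator x t.
    move=> /andP[tu us]; apply/eqP; rewrite eq_le; apply/andP; split; last first.
      by apply: regulator_mono => //; rewrite t0.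
    have [u' /andP[u'0 u'u] [-> _]] := regulator_attained px (le_trans t0 tu).
    case: (leP u' t) => ut; first by apply: regulator_ge => //; rewrite u'0.
    rewrite he' ?(ltW ut) ?(le_trans u'u)// Rt.
    have : 0 <= (mu + sigma * Num.sqrt l) * (u' - t).
      by rewrite mulr_ge0 ?subr_ge0// ltW.
    by lra.
  rewrite /f Rs ?lexx ?ts// Lpos// => u /andP[tu us].
  rewrite /z /reflected Rs ?us ?ltW// he' ?us ?ltW// Rt.
  have : 0 < (mu + sigma * Num.sqrt l) * (u - t) by rewrite mulr_gt0 ?subr_gt0.
  by lra.
(* At 0 in the second state the path falls and the regulator follows it: [z] stays at 0, and both
   terms of [f] move linearly and cancel. *)
have Rs u : t <= u <= s -> regulator x u = - x u.
  move=> /andP[tu us]; apply/eqP; rewrite eq_le; apply/andP; split; last first.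
    by apply: regulator_ge => //; rewrite lexx (le_trans t0).
  have [u' /andP[u'0 u'u] [-> _]] := regulator_attained px (le_trans t0 tu).
  rewrite lerN2 (he' u) ?tu ?us//.
  have [ut|ut] := leP u' t.
    have h1 : - x u' <= regulator x t by apply: regulator_ge => //; rewrite u'0.
    have : (mu - sigma * Num.sqrt l) * (u - t) <= 0.
      by rewrite mulr_le0_ge0 ?subr_ge0// ltW.
    by move: h1; rewrite Rt; lra.
  by rewrite (he' u') ?(ltW ut) ?(le_trans u'u)// lerD2l ler_wnM2l ?lerB// ltW.
have LS : L s - L t = 1 * (s - t).
  apply: (running_const hz) => // u /andP[tu us].
  rewrite indicE mem_set//= /z /reflected Rs ?us ?(ltW tu)//.
  by rewrite subrr.
rewrite mul1r in LS; rewrite /f Rs ?ts ?lexx// Rt he' ?ts ?lexx//.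
have -> : L s = L t + (s - t) by move: LS; lra.
by ring.
Qed.

(** With L the time at 0, the clock is t + L (sqrt l - a) / a; replacing L by regulator / (sigma
    sqrt l - mu) makes it a sticky clock, and equal clocks have equal inverses. *)
Lemma sticky_flipflop_pathE mu sigma a l k t : right_const k -> 0 <= t ->
  0 < mu + sigma * Num.sqrt l -> mu - sigma * Num.sqrt l < 0 -> 0 < a ->
  a < Num.sqrt l ->
  sticky_flipflop_path mu sigma a l k t =
  sticky_path (a * (sigma * Num.sqrt l - mu) / (Num.sqrt l - a))
    (flipflop_path mu sigma l k) t.
Proof.
move=> hk t0 c1 c2 a0 al; rewrite /sticky_flipflop_path /sticky_path.
congr (reflected _ _); rewrite /time_inverse; congr (xget 0 _).
have clock s : 0 <= s ->
    flipflop_clock a l (reflected (flipflop_path mu sigma l k)) s =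
    sticky_clock (a * (sigma * Num.sqrt l - mu) / (Num.sqrt l - a))
      (flipflop_path mu sigma l k) s.
  move=> s0; rewrite /flipflop_clock /sticky_clock (regulator_time_at_zero hk)//.
  field; rewrite !gt_eqF ?subr_gt0//=.
  by move: c2; rewrite subr_lt0 => h; lra.
by apply/seteqP; split=> s /= [s0 <-]; split => //; rewrite clock.
Qed.

End flipflop_path_properties.

(** * Convergence of the flip-flop increments *)

Section flipflop_noise.
Context {R : realType} {d : measure_display} {T : measurableType d}.
Variable P : probability T R.
Implicit Types (l h t : R) (kappa : R -> T -> 'I_2).

Definition noise l kappa t w : R := Num.sqrt l * occupation (kappa ^~ w) t.

Definition noise_step l kappa h (j : nat) w : R :=
  noise l kappa (j.+1%:R * h) w - noise l kappa (j%:R * h) w.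

(** A block of length h holds N + 1 mesh points, so block j starts at index j (N + 1). *)
Definition mesh kappa h N (k : nat) := kappa (k%:R * (h / N.+1%:R)).

Lemma chain_right_const Q kappa w : markov_chain P Q kappa -> right_const (kappa ^~ w).
Proof. by move=> [_ h _] t t0; exact: h. Qed.

Lemma mesh_measurable Q kappa h N i j : 0 <= h -> markov_chain P Q kappa ->
  measurable [set w | mesh kappa h N i w = j].
Proof. by move=> h0 [m _ _]; apply: m; rewrite mulr_ge0// divr_ge0. Qed.

Lemma mesh_markov l kappa h N i G : 0 <= h ->
  markov_chain P (flipflop_generator l) kappa -> past (mesh kappa h N) i G ->
  Ex P (fun w => G w * spin (mesh kappa h N i.+1 w)) =
  expR (- (2 * l * (h / N.+1%:R))) * Ex P (fun w => G w * spin (mesh kappa h N i w)).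
Proof. by move=> h0 mc pG; apply: markov_chain_past => //; rewrite divr_ge0. Qed.

Lemma walk_noise_step Q l kappa h j w : 0 < h -> markov_chain P Q kappa ->
  walk (mesh kappa h N) (Num.sqrt l * (h / N.+1%:R)) (j * N.+1) N.+1 w @[N --> \oo] -->
  noise_step l kappa h j w.
Proof.
move=> h0 mc; have rc := chain_right_const w mc.
have ab : j%:R * h < j.+1%:R * h by rewrite ltr_pM2r// ltr_nat.
have a0 : 0 <= j%:R * h by rewrite mulr_ge0// ltW.
have := occupation_riemann ab a0 rc => c1.
rewrite /noise_step /noise -mulrBr.
apply: eq_cvg_nat (cvgMl_tmp (a := Num.sqrt l) c1) => N; rewrite /walk mulr_sumr; apply: eq_bigr => i _.
have e : j.+1%:R * h - j%:R * h = h by rewrite -natr1; ring.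
rewrite e mulrA; congr (_ * spin (kappa _ w)).
rewrite /grid e natrD natrM mulrDl; congr (_ + _).
by rewrite -mulrA; congr (_ * _); rewrite mulrC divfK// pnatr_eq0.
Qed.

Lemma walk_bound c (s : R) i n (w : T) : `|walk c s i n w| <= n%:R * `|s|.
Proof.
rewrite /walk; apply: (le_trans (ler_norm_sum _ _ _)).
apply: (@le_trans _ _ (\sum_(j < n) `|s|)).
  by apply: ler_sum => j _; rewrite normrM spin_norm mulr1.
by rewrite sumr_const card_ord mulr_natl.
Qed.

Lemma mesh_walk_bound l kappa h N i w : 0 <= h ->
  `|walk (mesh kappa h N) (Num.sqrt l * (h / N.+1%:R)) i N.+1 w| <= Num.sqrt l * h.
Proof.
move=> h0; apply: (le_trans (walk_bound _ _ _ _ _)).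
rewrite ger0_norm ?mulr_ge0 ?divr_ge0 ?sqrtr_ge0//.
by rewrite mulrCA [X in _ * X]mulrC divfK ?pnatr_eq0.
Qed.

Lemma noise_step_bmeas Q l kappa h j : 0 < h -> markov_chain P Q kappa ->
  bmeas (noise_step l kappa h j).
Proof.
move=> h0 mc.
have [] // := @Ex_cvg _ _ _ P (fun N => walk (mesh kappa h N)
  (Num.sqrt l * (h / N.+1%:R)) (j * N.+1) N.+1) (noise_step l kappa h j) (Num.sqrt l * h).
- move=> N; apply: (past_bmeas (c := mesh kappa h N) _ (walk_past _ _ _ _)).1 => i k.
  by apply: mesh_measurable mc; exact: ltW.
- by move=> N w; apply: mesh_walk_bound; exact: ltW.
- by move=> w; exact: walk_noise_step h0 mc.
Qed.

(** With x = 2 l eta and rho = exp (- x), these are the facts about [rho] that the moment recursion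
    and the corrected step ask for. *)
Lemma expR_mesh_bounds (x : R) : 0 <= x ->
  [/\ 0 <= expR (- x) <= 1, expR (- x) * (1 + x) <= 1, 1 - expR (- x) <= x &
      `|x - (1 - expR (- x))| <= x ^+ 2].
Proof.
move=> x0; have h1 : 1 - x <= expR (- x) by exact: expR_ge1Dx.
have h2 : expR (- x) * (1 + x) <= 1.
  have := @expR_ge1Dx _ x => h; rewrite expRN ler_pdivrMl ?expR_gt0// mulr1.
  exact: h.
have h3 := @expR_ge0 _ (- x).
have h4 : expR (- x) <= 1 by rewrite expR_le1 oppr_le0.
split; [lra|exact: h2|lra|].
rewrite ger0_norm; last by lra.
have : 0 < 1 + x by lra.
move: (expR (- x)) h1 h2 h3 h4 => y h1 h2 h3 h4 hx.
rewrite -(ler_pM2r hx).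
have : 0 <= x ^+ 3 by rewrite exprn_ge0.
by move: h2; nra.
Qed.

Lemma mesh_cvg0 (h : R) : h / N.+1%:R @[N --> \oo] --> (0 : R).
Proof.
rewrite -[X in _ --> X](mulr0 h); apply: cvgMl_tmp.
exact: eq_cvg_nat (@cvg_harmonic R).
Qed.

(** The walk bound depends neither on the mesh nor on [l]. For fixed [l] the fourth powers are
    bounded by (sqrt l * h)^4, so the mesh can be sent to 0 by bounded convergence, once eta < 1 /
    l. *)
Lemma noise_moment4 l kappa h j : 0 < l -> 0 < h ->
  markov_chain P (flipflop_generator l) kappa ->
  Ex P (fun w => noise_step l kappa h j w ^+ 4) <= 32 * h ^+ 2.
Proof.
move=> l0 h0 mc.
pose W N := walk (mesh kappa h N) (Num.sqrt l * (h / N.+1%:R)) (j * N.+1) N.+1.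
have mm N i k : measurable [set w | mesh kappa h N i w = k].
  by apply: mesh_measurable mc; exact: ltW.
have bW N : bmeas (W N) by apply: past_bmeas (mm N) _ _ (walk_past _ _ _ _).
have [_ c] : bmeas (fun w => noise_step l kappa h j w ^+ 4) /\
    Ex P (fun w => W N w ^+ 4) @[N --> \oo] --> Ex P (fun w => noise_step l kappa h j w ^+ 4).
  apply: (@Ex_cvg _ _ _ P (fun N w => W N w ^+ 4) _ ((Num.sqrt l * h) ^+ 4)).
  - by move=> N; exact: (bmeasX 4 (bW N)).1.
  - move=> N w; rewrite normrX lerXn2r ?nnegrE ?mulr_ge0 ?sqrtr_ge0//; first exact: ltW.
    by apply: mesh_walk_bound; exact: ltW.
  - move=> w; have c1 := walk_noise_step (l := l) (j := j) (w := w) h0 mc.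
    rewrite exprS !exprS expr0 mulr1.
    by apply: eq_cvg_nat (cvgM c1 (cvgM c1 (cvgM c1 c1))) => N; rewrite /W /=; ring.
rewrite -(cvg_lim _ c)//; apply: limr_le; first by apply/cvg_ex; eexists; exact: c.
have h2 : 0 < l^-1 by rewrite invr_gt0.
near=> N.
have hN : h / N.+1%:R < l^-1 by near: N; exact: (cvgr_lt _ (mesh_cvg0 h) _ h2).
have eta0 : 0 < h / N.+1%:R by rewrite divr_gt0.
have sl : Num.sqrt l ^+ 2 = l by rewrite sqr_sqrtr// ltW.
have x0 : 0 <= 2 * l * (h / N.+1%:R) by rewrite mulr_ge0 ?mulr_ge0// ltW.
have [b1 b2 _ _] := expR_mesh_bounds x0.
have := @walk_moments _ _ _ P (mesh kappa h N) (mm N) (expR (- (2 * l * (h / N.+1%:R)))) _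
  (Num.sqrt l) (h / N.+1%:R) h (j * N.+1) N.+1; apply => //.
- by move=> i G pG; apply: mesh_markov => //; exact: ltW.
- by rewrite sqrtr_gt0.
- by rewrite sl mulrC -ler_pdivlMr// div1r ltW.
- by rewrite sl; move: b2; rewrite ?mulrA.
- by rewrite mulrC divfK ?pnatr_eq0.
- by rewrite ler_pdivrMr// ler_peMr// ?ler1n// ltW.
Unshelve. all: by end_near. Qed.

Lemma noise_moment2 l kappa h j : 0 < l -> 0 < h ->
  markov_chain P (flipflop_generator l) kappa ->
  Ex P (fun w => noise_step l kappa h j w ^+ 2) <= 1 + 32 * h ^+ 2.
Proof.
move=> l0 h0 mc; have b := noise_step_bmeas l j h0 mc.
have := noise_moment4 j l0 h0 mc => m4.
apply: (@le_trans _ _ (Ex P (fun w => 1 + noise_step l kappa h j w ^+ 4))).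
  apply: Ex_le => [||w]; [exact/bmeas_intg/bmeasX| |].
    by apply/bmeas_intg/bmeasD; [exact: bmeas_cst|exact: bmeasX].
  by move: (noise_step _ _ _ _ w) => x; nra.
rewrite ExD ?Ex_cst ?lerD2l//; first exact: intg_cst.
exact/bmeas_intg/bmeasX.
Qed.

End flipflop_noise.

Section noise_central_limit.
Context {R : realType} {d : measure_display} {T : measurableType d}.
Variable P : probability T R.
Context {d' : measure_display} {T' : measurableType d'}.
Variable Q : probability T' R.
Implicit Types (l h : R) (kappa : R -> T -> 'I_2) (f : nat -> R -> R).

Lemma cvg_prod_nat (u : nat -> nat -> R) (x : nat -> R) m :
  (forall j, u j n @[n --> \oo] --> x j) ->
  \prod_(j < m) u j n @[n --> \oo] --> \prod_(j < m) x j.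
Proof.
move=> h; elim: m => [|m IH].
  rewrite big_ord0; apply: eq_cvg_nat (@cvg_cst _ (1 : R) _ \oo _) => n.
  by rewrite big_ord0.
rewrite big_ord_recr /=; apply: eq_cvg_nat (cvgM IH (h m)) => n.
by rewrite big_ord_recr.
Qed.

Lemma prod_bound (C : R) f m (x : nat -> R) : (forall j y, `|f j y| <= C) ->
  `|\prod_(j < m) f j (x j)| <= C ^+ m.
Proof.
move=> hC; rewrite normr_prod.
apply: (@le_trans _ _ (\prod_(j < m) C)); last by rewrite prodr_const card_ord.
by apply: ler_prod => j _; rewrite normr_ge0 hC.
Qed.

Lemma noise_prod_cvg Q' l kappa h C (m : nat) f f1 f2 :
  0 < h -> markov_chain P Q' kappa -> (forall j, smooth2 C (f j) (f1 j) (f2 j)) ->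
  Ex P (fun w => \prod_(j < m) f j (walk (mesh kappa h N) (Num.sqrt l * (h / N.+1%:R))
     (j * N.+1) N.+1 w)) @[N --> \oo] -->
  Ex P (fun w => \prod_(j < m) f j (noise_step l kappa h j w)).
Proof.
move=> h0 mc sf.
have cf j : continuous (f j).
  by have [h1 _ _] := smooth2_lip (sf j); exact: lip_continuous h1.
have fC j x : `|f j x| <= C by have [[b _ _] _] := sf j; exact: b.
have [|||//] := @Ex_cvg _ _ _ P (fun N w => \prod_(j < m) f j (walk (mesh kappa h N)
  (Num.sqrt l * (h / N.+1%:R)) (j * N.+1) N.+1 w))
  (fun w => \prod_(j < m) f j (noise_step l kappa h j w)) (C ^+ m).
- move=> N; apply: (bmeas_prod _ _ _).1 => j.
  apply: (past_bmeas (c := mesh kappa h N) _ (past_comp (f j) (walk_past _ _ _ _))) => i k.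
  by apply: mesh_measurable mc; exact: ltW.
- move=> N w; exact: (@prod_bound _ _ m (fun j => walk (mesh kappa h N)
    (Num.sqrt l * (h / N.+1%:R)) (j * N.+1) N.+1 w) fC).
- move=> w; apply: (@cvg_prod_nat (fun j N => f j (walk (mesh kappa h N)
    (Num.sqrt l * (h / N.+1%:R)) (j * N.+1) N.+1 w))
    (fun j => f j (noise_step l kappa h j w))) => j.
  exact: (cvg_comp _ _ (walk_noise_step h0 mc) (cf j _)).
Qed.

(** Here n = h / eta. All per-step errors but one are of order above eta and disappear with the
    mesh; eta / (2 s) sums to h / (2 s) and remains, next to the boundary term 1 / s. *)
Lemma clt_error_bound (M C s h eta : R) (n : R) : 0 <= M -> 0 <= C -> 0 < s -> 0 < eta ->
  eta <= 1 -> 0 <= h -> n * eta = h ->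
  M * (C / s) + n * (M * (C * (2 * s ^+ 3 * eta ^+ 2 + 2 * s ^+ 2 * eta ^+ 2 +
     s ^+ 3 * eta ^+ 3 + s * eta ^+ 2 / 2 + 49 * eta * Num.sqrt eta + eta / (2 * s)))) <=
  M * C * (1 + h) / s +
  h * (M * C * (3 * s ^+ 3 + 2 * s ^+ 2 + s + 49)) * Num.sqrt eta.
Proof.
move=> M0 C0 s0 e0 e1 h0 nh.
have q0 : 0 <= Num.sqrt eta by exact: sqrtr_ge0.
have qq : Num.sqrt eta ^+ 2 = eta by rewrite sqr_sqrtr// ltW.
have q1 : Num.sqrt eta <= 1 by rewrite -sqrtr1 ler_wsqrtr.
have eq1 : eta <= Num.sqrt eta by rewrite -{1}qq expr2 ler_piMl.
move: (Num.sqrt eta) q0 qq q1 eq1 => q q0 qq q1 eq1.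
have -> : n * (M * (C * (2 * s ^+ 3 * eta ^+ 2 + 2 * s ^+ 2 * eta ^+ 2 +
     s ^+ 3 * eta ^+ 3 + s * eta ^+ 2 / 2 + 49 * eta * q + eta / (2 * s)))) =
  h * (M * C * ((2 * s ^+ 3 + 2 * s ^+ 2 + s ^+ 3 * eta + s / 2) * eta + 49 * q)) +
  h * (M * C) / (2 * s).
  by rewrite -nh; field; rewrite gt_eqF.
have p0 : 0 <= M * C by rewrite mulr_ge0.
have -> : M * (C / s) = M * C / s by rewrite mulrA.
have l1 : M * C / s + h * (M * C) / (2 * s) <= M * C * (1 + h) / s.
  rewrite -subr_ge0 (_ : _ - _ = h * (M * C) / (2 * s)); last by field; rewrite gt_eqF.
  by rewrite divr_ge0 ?mulr_ge0// ltW.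
have l2 : h * (M * C * ((2 * s ^+ 3 + 2 * s ^+ 2 + s ^+ 3 * eta + s / 2) * eta + 49 * q)) <=
    h * (M * C * (3 * s ^+ 3 + 2 * s ^+ 2 + s + 49)) * q.
  rewrite -!mulrA; do 3 apply: ler_wpM2l => //.
  rewrite [leRHS]mulrDl lerD2r; apply: ler_pM; rewrite ?(ltW e0)//.
    by rewrite !addr_ge0 ?mulr_ge0 ?exprn_ge0// ltW.
  have : s ^+ 3 * eta <= s ^+ 3 by rewrite ler_piMr// exprn_ge0// ltW.
  by move: s0; lra.
by move: l1 l2; lra.
Qed.

(** Adds one block: the factors of the earlier blocks form the weight [G] of [walk_clt], and the
    heat flow started at [f m] supplies the functions [U0], [U1], [U2]. Letting the mesh tend to 0
    for fixed [l] leaves the error in 1 / sqrt l. *)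
Lemma noise_clt_step l kappa h mu sigma (X : R -> T' -> R) C (m : nat) f f1 f2 :
  0 < l -> 0 < h -> 1 <= C -> 0 < sigma ->
  markov_chain P (flipflop_generator l) kappa -> brownian_motion Q mu (sigma ^+ 2) X ->
  (forall j, smooth2 C (f j) (f1 j) (f2 j)) ->
  `|Ex P (fun w => \prod_(j < m.+1) f j (noise_step l kappa h j w)) -
    Ex P (fun w => \prod_(j < m) f j (noise_step l kappa h j w)) *
    Ex Q (fun w => f m (increment mu sigma X 0 h w))| <=
  C ^+ m.+1 * (1 + h) / Num.sqrt l.
Proof.
move=> l0 h0 C1 s0 mc bm sf.
have C0 : 0 <= C by exact: le_trans C1.
have sl : Num.sqrt l ^+ 2 = l by rewrite sqr_sqrtr// ltW.
have sp : 0 < Num.sqrt l by rewrite sqrtr_gt0.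
have fC j x : `|f j x| <= C by have [[b _ _] _] := sf j; exact: b.
pose eta N : R := h / N.+1%:R.
pose W N j := walk (mesh kappa h N) (Num.sqrt l * eta N) (j * N.+1) N.+1.
pose A := Ex Q (fun w => f m (increment mu sigma X 0 h w)).
have cc k : Ex P (fun w => \prod_(j < k) f j (W N j w)) @[N --> \oo] -->
    Ex P (fun w => \prod_(j < k) f j (noise_step l kappa h j w)).
  exact: noise_prod_cvg mc sf.
have c1 : `|Ex P (fun w => \prod_(j < m.+1) f j (W N j w)) -
      Ex P (fun w => \prod_(j < m) f j (W N j w)) * A| @[N --> \oo] -->
    `|Ex P (fun w => \prod_(j < m.+1) f j (noise_step l kappa h j w)) -
      Ex P (fun w => \prod_(j < m) f j (noise_step l kappa h j w)) * A|.
  by apply: eq_cvg_nat (cvg_norm (cvgB (cc m.+1) (cvgMr_tmp (b := A) (cc m)))) => N.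
pose K := h * (C ^+ m * C * (3 * Num.sqrt l ^+ 3 + 2 * Num.sqrt l ^+ 2 + Num.sqrt l + 49)).
have c2 : C ^+ m * C * (1 + h) / Num.sqrt l + K * Num.sqrt (eta N) @[N --> \oo] -->
    C ^+ m * C * (1 + h) / Num.sqrt l.
  rewrite -[X in _ --> X]addr0; apply: cvgD; first exact: cvg_cst.
  rewrite -[X in _ --> X](mulr0 K); apply: cvgMl_tmp; rewrite -[X in _ --> X]sqrtr0.
  exact: (cvg_comp _ _ (mesh_cvg0 h) (@sqrt_continuous R 0)).
rewrite exprSr; refine (ler_cvg_to c1 c2 _).
near=> N.
have eta0 : 0 < eta N by rewrite divr_gt0.
have eta1 : eta N <= 1 by near: N; apply: cvgr_le (mesh_cvg0 h) _ ltr01.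
have nE : N.+1%:R * eta N = h by rewrite mulrC divfK ?pnatr_eq0.
have x0 : 0 <= 2 * l * eta N by rewrite mulr_ge0 ?mulr_ge0// ltW.
have [b1 _ b3 b4] := expR_mesh_bounds x0.
have b3' : 1 - expR (- (2 * l * eta N)) <= 2 * Num.sqrt l ^+ 2 * eta N by rewrite sl.
have b4' : `|2 * Num.sqrt l ^+ 2 * eta N - (1 - expR (- (2 * l * eta N)))| <=
    (2 * Num.sqrt l ^+ 2 * eta N) ^+ 2 by rewrite sl.
have mm i k : measurable [set w | mesh kappa h N i w = k].
  by apply: mesh_measurable mc; exact: ltW.
(* Block j < m reads indices below (j + 1) (N + 1), which is at most m (N + 1). *)
have pG : past (mesh kappa h N) (m * N.+1) (fun w => \prod_(j < m) f j (W N j w)).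
  apply: (past_prod (F := fun j w => f j (W N j w))) => j jm; apply: past_comp.
  by apply: past_le (walk_past _ _ _ _); rewrite -mulSnr leq_pmul2r.
have GM w : `|\prod_(j < m) f j (W N j w)| <= C ^+ m.
  exact: (@prod_bound _ _ m (fun j => W N j w) fC).
have gD : gaussian_mgf Q (increment mu sigma X 0 (eta N)) (eta N).
  by have := increment_gaussian s0 bm (lexx 0) eta0; rewrite subr0.
have hs k := heat_smooth2 k eta0 bm (sf m).
have hS k (g : R -> R) : g \in [:: f m; f1 m; f2 m] -> forall x,
    heat Q mu sigma X (eta N) k.+1 g x =
    avg Q (increment mu sigma X 0 (eta N)) (heat Q mu sigma X (eta N) k g) x.
  by move=> gi x; exact: heatS eta0 bm (sf m) gi.
have := @walk_clt _ _ _ P (mesh kappa h N) mm (expR (- (2 * l * eta N)))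
  (fun i G => mesh_markov (ltW h0) mc) C (C ^+ m) (Num.sqrt l) (eta N) N.+1 (m * N.+1)
  (fun w => \prod_(j < m) f j (W N j w)) (fun k => heat Q mu sigma X (eta N) k (f m))
  (fun k => heat Q mu sigma X (eta N) k (f1 m)) (fun k => heat Q mu sigma X (eta N) k (f2 m))
  sp eta0 b1.
move=> /(_ b4' b3' hs) key.
have {}key := key _ _ pG GM.
apply: le_trans (clt_error_bound (n := N.+1%:R) _ _ sp eta0 eta1 (ltW h0) nE) => //; last first.
  by rewrite exprn_ge0.
apply: le_trans (key _ _).
- rewrite le_eqVlt; apply/orP; left; apply/eqP; congr (`|_ - _ * _|).
    by apply: Ex_eq => w; rewrite big_ord_recr /= heat0.
  by rewrite /A /heat /avg nE; apply: Ex_eq => w; rewrite add0r.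
- move=> k x; rewrite hS ?mem_head//; exact: (avg_expand x eta0 gD (hs k)).1.
- move=> k x; rewrite hS ?inE ?eqxx ?orbT//; exact: (avg_expand x eta0 gD (hs k)).2.
Unshelve. all: by end_near. Qed.

End noise_central_limit.

(** * Continuous functions of finitely many increments *)

Section bounded_test_functions.
Context {R : realType} {d : measure_display} {T : measurableType d}.
Variable P : probability T R.
Implicit Types (g : (nat -> R) -> R) (D : nat -> T -> R) (M : nat).

Lemma quasi_interp_measurable M L J e g D : (forall k, measurable_fun setT (D k)) ->
  measurable_fun setT (fun w => quasi_interp M L J e g (D ^~ w)).
Proof.
move=> mD; apply: (bmeas_sum _ _ _).1 => p; apply: bmeasZ; apply: bmeas_prod => k.
apply: eq_bmeas (bmfun_bmeas (bmfun_bump e (J%:R - (p k)%:R)) (mD k)) => w.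
by rewrite addrA.
Qed.

Lemma box_measurable M g D : box_ucont M g -> (forall k, measurable_fun setT (D k)) ->
  measurable_fun setT (fun w => g (D ^~ w)).
Proof.
move=> ug mD; apply: (measurable_fun_cvg (h := fun n w => smooth_approx M g n (D ^~ w))).
  by move=> n; exact: quasi_interp_measurable.
move=> w _; apply/cvgrPdist_le => e e0.
have := smooth_approx_cvg (\sum_(k < M) `|D k w|) ug e0; apply: filterS => n hn.
rewrite distrC; apply: hn => k kM.
by rewrite (bigD1 (Ordinal kM))//= lerDl sumr_ge0.
Qed.

(** Chebyshev's argument: off the box the two functions differ by at most 2 B, and there 1 <= (D
    k)^2 / K^2 for some coordinate k. *)
Lemma box_approx M g D B S K e n : (forall v, `|g v| <= B) -> 0 < K -> 0 <= e ->
  (forall v, (forall k, (k < M)%N -> `|v k| <= K) -> `|smooth_approx M g n v - g v| <= e) ->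
  box_ucont M g -> (forall k, measurable_fun setT (D k)) ->
  (forall k, intg P (fun w => D k w ^+ 2)) -> (forall k, Ex P (fun w => D k w ^+ 2) <= S) ->
  `|Ex P (fun w => g (D ^~ w)) - Ex P (fun w => smooth_approx M g n (D ^~ w))| <=
  e + 2 * B * (M%:R * S) / K ^+ 2.
Proof.
move=> gB K0 e0 hn ug mD iD ED.
have B0 : 0 <= B by exact: le_trans (gB (fun=> 0)).
have i1 : intg P (fun w => g (D ^~ w)).
  by apply/bmeas_intg; split; [exact: box_measurable ug mD|exists B].
have i2 : intg P (fun w => smooth_approx M g n (D ^~ w)).
  apply/bmeas_intg; split; first exact: quasi_interp_measurable.
  by exists B => w; exact: quasi_interp_bound.
rewrite -ExB//.
have isum m : intg P (fun w => \sum_(k < m) D k w ^+ 2) /\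
    Ex P (fun w => \sum_(k < m) D k w ^+ 2) <= m%:R * S.
  elim: m => [|m [IH1 IH2]].
    have e1 : (fun w => \sum_(k < 0) D k w ^+ 2) = (fun=> 0).
      by apply/funext => w; rewrite big_ord0.
    by rewrite e1 Ex_cst mul0r; split => //; exact: intg_cst.
  have e1 : (fun w => \sum_(k < m.+1) D k w ^+ 2) =
      (fun w => \sum_(k < m) D k w ^+ 2 + D m w ^+ 2).
    by apply/funext => w; rewrite big_ord_recr.
  rewrite e1 ExD//; split; first exact: intgD.
  by rewrite -natr1 mulrDl mul1r lerD.
have [is_ Es] := isum M.
apply: (@le_trans _ _ (Ex P (fun w => e + 2 * B / K ^+ 2 * \sum_(k < M) D k w ^+ 2))).
  apply: Ex_abs_le => [||w]; first exact: intgB.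
    by apply: intgD; [exact: intg_cst|exact: intgZ].
  have s0 (s : pred 'I_M) : 0 <= \sum_(k < M | s k) D k w ^+ 2.
    by apply: sumr_ge0 => k _; exact: sqr_ge0.
  have c0 : 0 <= 2 * B / K ^+ 2 by apply: divr_ge0; [rewrite mulr_ge0|exact: sqr_ge0].
  have [h|] := pselect (forall k, (k < M)%N -> `|D k w| <= K).
    by rewrite distrC (le_trans (hn _ h))// lerDl mulr_ge0.
  move/existsNP => [k /not_implyP[kM /negP]]; rewrite -ltNge => h.
  apply: (@le_trans _ _ (2 * B)).
    rewrite (le_trans (ler_normB _ _))// mulr2n mulrDl mul1r lerD//.
    exact: quasi_interp_bound.
  rewrite -[leLHS]add0r lerD// -mulrA ler_peMr ?mulr_ge0//.
  rewrite mulrC ler_pdivlMr ?exprn_gt0// mul1r.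
  apply: (@le_trans _ _ (D k w ^+ 2)).
    by rewrite -(real_normK (num_real (D k w))) lerXn2r ?nnegrE// ltW.
  by rewrite (bigD1 (Ordinal kM))//= lerDl.
rewrite ExD ?Ex_cst ?ExZ//; [|exact: intg_cst|exact: intgZ].
rewrite lerD2l -[leRHS]mulrA [X in _ <= _ * X]mulrC mulrA ler_wpM2l//.
by apply: divr_ge0; [rewrite mulr_ge0|exact: sqr_ge0].
Qed.

End bounded_test_functions.

Section noise_convergence.
Context {R : realType} {d' : measure_display} {T' : measurableType d'}.
Variable Q : probability T' R.
Implicit Types (l h : R).

Lemma noise_fdd (d : measure_display) (T : measurableType d) (P : probability T R)
    l (kappa : R -> T -> 'I_2) h mu sigma (X : R -> T' -> R) C (m : nat) (f f1 f2 : nat -> R -> R) :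
  0 < l -> 0 < h -> 1 <= C -> 0 < sigma ->
  markov_chain P (flipflop_generator l) kappa -> brownian_motion Q mu (sigma ^+ 2) X ->
  (forall j, smooth2 C (f j) (f1 j) (f2 j)) ->
  `|Ex P (fun w => \prod_(j < m) f j (noise_step l kappa h j w)) -
    Ex Q (fun w => \prod_(j < m) f j (increment mu sigma X (j%:R * h) (j.+1%:R * h) w))| <=
  m%:R * C ^+ m * (1 + h) / Num.sqrt l.
Proof.
move=> l0 h0 C1 s0 mc bm sf.
have C0 : 0 <= C by exact: le_trans C1.
have fC j x : `|f j x| <= C by have [[b _ _] _] := sf j; exact: b.
have bf j : bmfun (f j) by have [b _ _] := smooth2_bmfun (sf j).
have -> : Ex Q (fun w => \prod_(j < m) f j (increment mu sigma X (j%:R * h) (j.+1%:R * h) w))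
    = \prod_(j < m) Ex Q (fun w => f j (increment mu sigma X 0 h w)).
  have := @increments_indep _ _ _ Q mu sigma X m (fun j => j%:R * h) f bm.
  rewrite mul0r => -> //; last by move=> i j ij; rewrite ler_pM2r// ler_nat.
  apply: eq_bigr => j _; apply: increment_law bm _ _ _ _ (bf j) => //.
  - by rewrite mulr_ge0// ltW.
  - by rewrite ltr_pM2r// ltr_nat.
  - by rewrite -natr1; ring.
elim: m => [|m IH].
  rewrite !big_ord0 !mul0r (_ : (fun w : T => \prod_(j < 0) _) = fun=> 1); last first.
    by apply/funext => w; rewrite big_ord0.
  by rewrite Ex_cst subrr normr0.
rewrite [X in _ - X]big_ord_recr /=.
have h1 := noise_clt_step m l0 h0 C1 s0 mc bm sf.
set A := Ex P (fun w => \prod_(j < m.+1) _) in h1 *.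
set A' := Ex P (fun w => \prod_(j < m) _) in h1 IH *.
set b := Ex Q _ in h1 *.
have bC : `|b| <= C.
  apply: Ex_abs_bound => [|w]; last exact: fC.
  by apply: bmfun_bmeas (bf m) _; apply: (increment_measurable bm) => //; exact: ltW.
set B := \prod_(j < m) _ in IH *.
(* The last block is replaced by its Brownian mean first; the induction then handles the earlier
   blocks, at the price of a factor C. *)
rewrite (_ : A - B * b = (A - A' * b) + (A' - B) * b); last by ring.
apply: (le_trans (ler_normD _ _)); rewrite normrM.
have -> : m.+1%:R * C ^+ m.+1 * (1 + h) / Num.sqrt l =
    C ^+ m.+1 * (1 + h) / Num.sqrt l + m%:R * C ^+ m * (1 + h) / Num.sqrt l * C.
  by rewrite -[m.+1%:R]natr1 exprSr; ring.
by apply: lerD => //; apply: ler_pM.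
Qed.

Lemma noise_quasi_interp (d : measure_display) (T : measurableType d) (P : probability T R)
    l (kappa : R -> T -> 'I_2) h mu sigma (X : R -> T' -> R) M L J e g :
  0 < l -> 0 < h -> 0 < sigma ->
  markov_chain P (flipflop_generator l) kappa -> brownian_motion Q mu (sigma ^+ 2) X ->
  `|Ex P (fun w => quasi_interp M L J e g (fun j => noise_step l kappa h j w)) -
    Ex Q (fun w => quasi_interp M L J e g
      (fun j => increment mu sigma X (j%:R * h) (j.+1%:R * h) w))| <=
  (\sum_(p : {ffun 'I_M -> 'I_L}) `|g (knots J e p)|) *
  (M%:R * (200 * (1 + `|e^-1|) ^+ 3) ^+ M * (1 + h)) / Num.sqrt l.
Proof.
move=> l0 h0 s0 mc bm.
set C := 200 * _.
have C1 : 1 <= C.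
  have : 1 <= (1 + `|e^-1|) ^+ 3 by rewrite exprn_ege1// lerDl.
  by rewrite /C; lra.
pose q (p : {ffun 'I_M -> 'I_L}) (j : nat) : R := oapp (fun i => (p i)%:R) 0 (insub j).
pose f p j x := bump (e^-1 * x + (J%:R - q p j)).
pose f1 p j x := e^-1 * bspline (fun x => 3 * pos x ^+ 2) (e^-1 * x + (J%:R - q p j)).
pose f2 p j x := e^-1 ^+ 2 * bspline (fun x => 6 * pos x) (e^-1 * x + (J%:R - q p j)).
have sf p j : smooth2 C (f p j) (f1 p j) (f2 p j) := smooth2_affine _ _ (@smooth2_bump R).
have bf p j : bmfun (f p j) by have [b _ _] := smooth2_bmfun (sf p j).
have fE (p : {ffun 'I_M -> 'I_L}) (v : nat -> R) :
    \prod_(k < M) bump (v k / e + J%:R - (p k)%:R) = \prod_(k < M) f p k (v k).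
  by apply: eq_bigr => k _; rewrite /f /q valK/= addrA [e^-1 * _]mulrC.
have qE (d1 : measure_display) (T1 : measurableType d1) (P1 : probability T1 R)
    (D : nat -> T1 -> R) : (forall k, measurable_fun setT (D k)) ->
    Ex P1 (fun w => quasi_interp M L J e g (D ^~ w)) =
    \sum_(p : {ffun 'I_M -> 'I_L}) g (knots J e p) *
      Ex P1 (fun w => \prod_(k < M) f p k (D k w)).
  move=> mD.
  have bp p : bmeas (fun w => \prod_(k < M) f p k (D k w)).
    by apply: bmeas_prod => k; exact: bmfun_bmeas (bf p k) (mD k).
  transitivity (Ex P1 (fun w => \sum_(p : {ffun 'I_M -> 'I_L})
      g (knots J e p) * \prod_(k < M) f p k (D k w))).
    by apply: Ex_eq => w; apply: eq_bigr => p _; congr (_ * _); exact: (fE p (D ^~ w)).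
  rewrite (@Ex_sum _ _ _ P1 _ _ _
    (fun p w => g (knots J e p) * \prod_(k < M) f p k (D k w))).
    by apply: eq_bigr => p _; rewrite ExZ//; exact: bmeas_intg.
  by move=> p; exact: bmeasZ.
rewrite (qE _ _ P (noise_step l kappa h)); last first.
  by move=> k; exact: (noise_step_bmeas l k h0 mc).1.
rewrite (qE _ _ Q (fun j => increment mu sigma X (j%:R * h) (j.+1%:R * h))); last first.
  by move=> k; apply: (increment_measurable bm); rewrite mulr_ge0// ltW.
rewrite -sumrB; apply: (le_trans (ler_norm_sum _ _ _)).
rewrite -mulrA mulr_suml; apply: ler_sum => p _.
rewrite -mulrBr normrM ler_wpM2l//.
exact: (noise_fdd M l0 h0 C1 s0 mc bm (sf p)).
Qed.

(** The order of quantifiers is the point: [l0] depends on [h], [g] and [e], but not on the chain or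
    on its probability space, which vary with [l]. *)
Lemma noise_weak_cvg h mu sigma (X : R -> T' -> R) M g B e :
  0 < h -> 0 < sigma -> brownian_motion Q mu (sigma ^+ 2) X ->
  box_ucont M g -> (forall v, `|g v| <= B) -> 0 < e ->
  exists2 l0, 0 < l0 & forall l, l0 < l -> forall (d : measure_display)
    (T : measurableType d) (P : probability T R) (kappa : R -> T -> 'I_2),
    markov_chain P (flipflop_generator l) kappa ->
    `|Ex P (fun w => g (fun j => noise_step l kappa h j w)) -
      Ex Q (fun w => g (fun j => increment mu sigma X (j%:R * h) (j.+1%:R * h) w))| <= e.
Proof.
move=> h0 s0 bm ug gB e0.
have B0 : 0 <= B by exact: le_trans (gB (fun=> 0)).
have e8 : 0 < e / 8 by rewrite divr_gt0.
(* A common bound for the second moments of the noise steps, 1 + 32 h^2, and of the Brownian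
   increments, h. Next, [z] is chosen so that the Chebyshev term for the box of half-width 1 + z is
   at most e / 8. *)
pose S := 1 + h + 32 * h ^+ 2.
have S0 : 0 < S by rewrite /S; have := sqr_ge0 h; lra.
pose z := 8 * (2 * B * (M%:R * S)) / e.
have z0 : 0 <= z by rewrite divr_ge0 ?mulr_ge0// ltW.
have zK : 2 * B * (M%:R * S) / (1 + z) ^+ 2 <= e / 8.
  rewrite ler_pdivrMr ?exprn_gt0 ?ltr_pwDl//.
  have zE : 2 * B * (M%:R * S) = z * (e / 8) by rewrite /z; field; rewrite gt_eqF.
  rewrite zE mulrC ler_wpM2l ?(ltW e8)//.
  by move: z0; move: z {zE} => z z0; nra.
have K0 : 0 < 1 + z by rewrite ltr_pwDl.
have [n hn] : exists n, forall v, (forall k, (k < M)%N -> `|v k| <= 1 + z) ->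
    `|smooth_approx M g n v - g v| <= e / 8.
  have [n _ hn] := smooth_approx_cvg (1 + z) ug e8.
  by exists n; apply: hn => /=.
have gD k : gaussian_mgf Q (increment mu sigma X (k%:R * h) (k.+1%:R * h)) h.
  have k0 : 0 <= k%:R * h by rewrite mulr_ge0// ltW.
  have kk : k%:R * h < k.+1%:R * h by rewrite ltr_pM2r// ltr_nat.
  have := increment_gaussian s0 bm k0 kk.
  by rewrite (_ : _ - _ = h)// -natr1; ring.
have h2 := box_approx (P := Q) (S := S) gB K0 (ltW e8) hn ug (fun k => (gD k).1)
  (fun k => gaussian_intg_sqr (gD k)).
have {}h2 := h2 (fun k => _).
pose Z := (\sum_(p : {ffun 'I_M -> 'I_(2 * (n.+1 * n.+1 + 3))})
    `|g (knots (n.+1 * n.+1 + 3) n.+1%:R^-1 p)|) *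
  (M%:R * (200 * (1 + `|(n.+1%:R^-1 : R)^-1|) ^+ 3) ^+ M * (1 + h)).
have Z0 : 0 <= Z.
  rewrite mulr_ge0 ?sumr_ge0// !mulr_ge0 ?exprn_ge0 ?mulr_ge0 ?exprn_ge0 ?addr_ge0//.
  exact: ltW.
have w0 : 0 <= 2 * Z / e.
  by apply: divr_ge0; [apply: mulr_ge0|exact: ltW].
exists ((2 * Z / e + 1) ^+ 2); first by apply: exprn_gt0; rewrite ltr_wpDl.
move=> l ll d T P kappa mc.
have l0 : 0 < l by rewrite (le_lt_trans _ ll)// exprn_ge0// addr_ge0.
have sl : 2 * Z / e < Num.sqrt l.
  apply: (@lt_le_trans _ _ (2 * Z / e + 1)); first by rewrite ltrDl.
  have -> : 2 * Z / e + 1 = Num.sqrt ((2 * Z / e + 1) ^+ 2).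
    by rewrite sqrtr_sqr ger0_norm// addr_ge0.
  by rewrite ler_wsqrtr// ltW.
have ZE : Z / Num.sqrt l <= e / 2.
  rewrite ler_pdivrMr ?sqrtr_gt0//.
  by move/ltW: sl; rewrite ler_pdivrMr//; lra.
have h1 := box_approx (P := P) (S := S) (D := noise_step l kappa h) gB K0 (ltW e8) hn ug
  (fun k => (noise_step_bmeas l k h0 mc).1)
  (fun k => bmeas_intg P (bmeasX 2 (noise_step_bmeas l k h0 mc))).
have {}h1 := h1 (fun k => _).
have h3 := noise_quasi_interp M (2 * (n.+1 * n.+1 + 3)) (n.+1 * n.+1 + 3) n.+1%:R^-1 g
  l0 h0 s0 mc bm.
rewrite -/Z in h3.
have {}h1 : `|Ex P (fun w => g (fun j => noise_step l kappa h j w)) -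
    Ex P (fun w => smooth_approx M g n (fun j => noise_step l kappa h j w))| <= e / 8 + e / 8.
  apply: le_trans (h1 _) _; last by rewrite lerD2l.
  move=> k; apply: (le_trans (noise_moment2 k l0 h0 mc)); rewrite /S; lra.
have {}h2 : `|Ex Q (fun w => g (fun j => increment mu sigma X (j%:R * h) (j.+1%:R * h) w)) -
    Ex Q (fun w => smooth_approx M g n
      (fun j => increment mu sigma X (j%:R * h) (j.+1%:R * h) w))| <= e / 8 + e / 8.
  apply: le_trans (h2 _) _; last by rewrite lerD2l.
  move=> k; rewrite (gaussian_var h0 (gD k)) /S; have := sqr_ge0 h; lra.
have {}h3 := le_trans h3 ZE.
move: h1 h2 h3; rewrite /smooth_approx.
move: (Ex P _) (Ex Q _) (Ex P _) (Ex Q _) => a b c q.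
rewrite !ler_norml => /andP[? ?] /andP[? ?] /andP[? ?].
by apply/andP; split; lra.
Qed.

End noise_convergence.

(** * Tightness and Lipschitz functionals *)

Section polygonal_paths.
Context {R : realType}.
Implicit Types (x xi : R -> R) (mu sigma om h e d t K L : R) (v : nat -> R) (G : (R -> R) -> R).

(* [G] only depends on the restriction of the path to [0, N]. *)
Definition sup_lipschitz (N : R) L G := forall x y e, cpath x -> cpath y -> 0 <= e ->
  (forall t, 0 <= t <= N -> `|x t - y t| <= e) -> `|G x - G y| <= L * e.

(** [v] lists increments of the noise; only the noise is interpolated, the drift is kept exact. *)
Definition poly_path mu sigma h M v t : R :=
  mu * t + sigma * interp h M (fun i => \sum_(j < i.+1) v j) t.

Definition steps xi h (j : nat) : R := xi (j.+1%:R * h) - xi (j%:R * h).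

Lemma sum_steps xi h n : \sum_(j < n) steps xi h j = xi (n%:R * h) - xi 0.
Proof.
elim: n => [|n IH]; first by rewrite big_ord0 mul0r subrr.
by rewrite big_ord_recr /= IH /steps; ring.
Qed.

Lemma poly_path0 mu sigma h M v : 0 < h -> path0 (poly_path mu sigma h M v).
Proof.
move=> h0; have [c0 z0] := @interp_path0 _ h M (fun i => \sum_(j < i.+1) v j) h0.
split; last by rewrite /poly_path z0 !mulr0 addr0.
by apply: cpathD; [exact: (cpathZ (c := mu) cpath_id)|exact: (cpathZ (c := sigma) c0)].
Qed.

(** [d] is the shift allowed to the changed time: it must absorb the change of stickiness and the
    distance sigma e2 of the regulators divided by [om']. Then [e1] is the oscillation of the noise
    at scale [d], and [e2] its oscillation at the mesh. *)
Lemma sticky_poly_close mu sigma om om' h M x xi (N d e1 e2 : R) :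
  0 < sigma -> 0 < om -> 0 < om' -> 0 < h -> M%:R * h = N -> path0 x -> xi 0 = 0 ->
  (forall t, 0 <= t -> x t = mu * t + sigma * xi t) ->
  (forall s t, 0 <= s <= N -> 0 <= t <= N -> `|s - t| <= d -> `|xi s - xi t| <= e1) ->
  (forall s t, 0 <= s <= N -> 0 <= t <= N -> `|s - t| <= h -> `|xi s - xi t| <= e2) ->
  (forall t, 0 <= t <= N -> regulator x t * `|om^-1 - om'^-1| + sigma * e2 / om' <= d) ->
  forall t, 0 <= t <= N ->
  `|sticky_path om x t - sticky_path om' (poly_path mu sigma h M (steps xi h)) t| <=
    2 * (`|mu| * d + sigma * e1) + 2 * (sigma * e2).
Proof.
move=> s0 om0 om'0 h0 MN px xi0 xE m1 m2 hR.
have py := poly_path0 mu sigma M (steps xi h) h0.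
set y := poly_path mu sigma h M (steps xi h).
have close t : 0 <= t <= N -> `|x t - y t| <= sigma * e2.
  move=> tN; have /andP[t0 _] := tN.
  rewrite xE// /y /poly_path opprD addrACA subrr add0r -mulrBr normrM gtr0_norm//.
  rewrite ler_pM2l// distrC.
  have e : interp h M (fun i => \sum_(j < i.+1) steps xi h j) t =
      interp h M (fun i => xi (i.+1%:R * h)) t.
    by rewrite /interp; apply: eq_bigr => i _; rewrite sum_steps xi0 subr0.
  rewrite e; apply: interp_approx => //; rewrite MN// => s sN st.
  exact: m2.
apply: (sticky_dist (d := d)) => // [s t sN tN st|t tN].
  have /andP[s1 _] := sN; have /andP[t1 _] := tN.
  rewrite !xE// (_ : _ - _ = mu * (s - t) + sigma * (xi s - xi t)); last by ring.
  rewrite (le_trans (ler_normD _ _))// !normrM (gtr0_norm s0); apply: lerD.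
    by rewrite ler_wpM2l.
  by rewrite ler_pM2l//; exact: m1.
apply: le_trans (hR t tN); have /andP[t0 tN'] := tN.
rewrite (_ : _ - _ = regulator x t * (om^-1 - om'^-1) +
  (regulator x t - regulator y t) / om'); last by ring.
rewrite (le_trans (ler_normD _ _))// !normrM lerD//.
  by rewrite (ger0_norm (_ : 0 <= regulator x t)) ?normr_ge0.
rewrite (gtr0_norm (_ : 0 < om'^-1)) ?invr_gt0// ler_pM2r ?invr_gt0//.
apply: regulator_dist => // s /andP[s1 st]; apply: close.
by rewrite s1 (le_trans st).
Qed.

Lemma poly_box_ucont mu sigma om h M N L G : 0 < sigma -> 0 < om -> 0 < h -> 0 <= L ->
  sup_lipschitz N L G ->
  box_ucont M (fun v => G (sticky_path om (poly_path mu sigma h M v))).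
Proof.
move=> s0 om0 h0 L0 lG K e e0.
(* [lam] is a Lipschitz constant, uniform over the box, of the polygonal path; below, [eta] bounds
   the sup distance of the two polygonal paths and eta / om that of their clocks. *)
pose lam := `|mu| + sigma * (M%:R * (M%:R * `|K| * (2 / h))).
have lam0 : 0 <= lam.
  by rewrite /lam addr_ge0// mulr_ge0 ?(ltW s0)// !mulr_ge0 ?invr_ge0 ?(ltW h0).
pose Z := L * ((2 * lam / om + 2) * (sigma * (M%:R * M%:R))).
have Z0 : 0 <= Z.
  have h1 : 0 <= 2 * lam / om by rewrite divr_ge0 ?(ltW om0)// mulr_ge0.
  by rewrite /Z mulr_ge0// mulr_ge0 ?addr_ge0// mulr_ge0 ?(ltW s0)// mulr_ge0.
have Z1 : 0 < Z + 1 by rewrite ltr_wpDl.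
exists (e / (Z + 1)); first by rewrite divr_gt0.
move=> v w hvw.
have pv := poly_path0 mu sigma M v h0; have pw := poly_path0 mu sigma M w h0.
pose dd := e / (Z + 1).
have dd0 : 0 <= dd by rewrite divr_ge0// ltW.
have sumle (u : nat -> R) c i : 0 <= c -> (forall k, (k < M)%N -> `|u k| <= c) -> (i < M)%N ->
    `|\sum_(j < i.+1) u j| <= M%:R * c.
  move=> c0 hu iM; rewrite (le_trans (ler_norm_sum _ _ _))//.
  apply: (@le_trans _ _ (\sum_(j < i.+1) c)).
    by apply: ler_sum => j _; apply: hu; exact: leq_trans (ltn_ord j) iM.
  by rewrite sumr_const card_ord -[c *+ _]mulr_natl ler_wpM2r// ler_nat.
have mod_v s t : `|poly_path mu sigma h M v s - poly_path mu sigma h M v t| <=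
    lam * `|s - t|.
  rewrite /poly_path (_ : _ - _ = mu * (s - t) + sigma *
    (interp h M (fun i => \sum_(j < i.+1) v j) s - interp h M (fun i => \sum_(j < i.+1) v j) t));
    last by ring.
  rewrite (le_trans (ler_normD _ _))// !normrM (gtr0_norm s0) /lam mulrDl lerD2l -[leRHS]mulrA ler_pM2l//.
  apply: interp_lip => // i iM; apply: sumle => // k kM.
  by have [h1 _ _] := hvw k kM; apply: le_trans h1 (ler_norm _).
pose eta := sigma * (M%:R * (M%:R * dd)).
have eta0 : 0 <= eta.
  by apply: mulr_ge0; [exact: ltW|apply: mulr_ge0 => //; exact: mulr_ge0].
have close t : `|poly_path mu sigma h M v t - poly_path mu sigma h M w t| <= eta.
  rewrite /poly_path opprD addrACA subrr add0r -mulrBr normrM gtr0_norm// ler_pM2l//.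
  apply: interp_dist => i iM; rewrite -sumrB.
  by apply: (sumle (fun j => v j - w j)) => // k kM; have [_ _] := hvw k kM.
have etaom : 0 <= eta / om by rewrite divr_ge0// ltW.
have sd t : 0 <= t <= N -> `|sticky_path om (poly_path mu sigma h M v) t -
    sticky_path om (poly_path mu sigma h M w) t| <= 2 * (lam * (eta / om)) + 2 * eta.
  apply: (sticky_dist (d := eta / om)) => // [s u _ _ su|u /andP[u0 uN]].
    by rewrite (le_trans (mod_v _ _))// ler_wpM2l.
  rewrite -mulrBl normrM (gtr0_norm (_ : 0 < om^-1)) ?invr_gt0// ler_pM2r ?invr_gt0//.
  exact: regulator_dist.
apply: (le_trans (lG _ _ _ _ _ _ sd)).
- exact: cpath_sticky.
- exact: cpath_sticky.
- by rewrite addr_ge0// mulr_ge0// mulr_ge0.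
rewrite (_ : L * _ = Z * dd); last by rewrite /Z /eta; ring.
rewrite /dd mulrA ler_pdivrMr// mulrC ler_pM2l//.
by rewrite lerDl.
Qed.

Lemma poly_approx mu sigma om x xi (N : nat) L G : 0 < sigma -> 0 < om -> 0 <= L ->
  sup_lipschitz N%:R L G -> path0 x -> cpath xi -> xi 0 = 0 ->
  (forall t, 0 <= t -> x t = mu * t + sigma * xi t) ->
  G (sticky_path om (poly_path mu sigma (2 ^+ n)^-1 (N * 2 ^ n) (steps xi (2 ^+ n)^-1)))
    @[n --> \oo] --> G (sticky_path om x).
Proof.
move=> s0 om0 L0 lG px cxi xi0 xE; apply/cvgrPdist_le => e e0.
pose q := e / (8 * (L + 1) * (sigma + `|mu|)).
have sm : 0 < sigma + `|mu| by rewrite ltr_pwDl.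
have L1 : 0 < L + 1 by rewrite ltr_wpDl.
have q0 : 0 < q by rewrite divr_gt0// mulr_gt0// mulr_gt0.
have [d1 d10 hd1] := cpath_unif N%:R cxi q0.
pose d := Num.min d1 q.
have d0 : 0 < d by rewrite lt_min d10.
pose e2 := Num.min q (d * om / sigma).
have e20 : 0 < e2 by rewrite lt_min q0 divr_gt0// mulr_gt0.
have [d2 d20 hd2] := cpath_unif N%:R cxi e20.
have c2 : ((2 : R) ^+ n)^-1 @[n --> \oo] --> (0 : R).
  apply: eq_cvg_nat (cvg_expr (z := 2^-1 : R) _) => [n|]; first exact: exprVn.
  by rewrite ger0_norm ?invr_ge0// invf_lt1 ?ltr1n.
near=> n.
have p0 : 0 < ((2 : R) ^+ n)^-1 by rewrite invr_gt0 exprn_gt0.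
have hn : ((2 : R) ^+ n)^-1 <= d2 by near: n; apply: (cvgr_le _ c2).
apply: (le_trans (lG _ _ (2 * (`|mu| * d + sigma * q) + 2 * (sigma * e2)) _ _ _ _)).
- exact: cpath_sticky.
- by apply: cpath_sticky => //; exact: poly_path0.
- have h1 : 0 <= `|mu| * d by apply: mulr_ge0 => //; exact: ltW.
  have h2 : 0 <= sigma * q by apply: mulr_ge0; exact: ltW.
  have h3 : 0 <= sigma * e2 by apply: mulr_ge0; exact: ltW.
  by apply: addr_ge0; apply: mulr_ge0 => //; exact: addr_ge0.
- apply: sticky_poly_close => //.
  + by rewrite natrM natrX mulrK// unitfE expf_neq0.
  + by move=> s t sN tN st; apply: hd1 => //; apply: le_trans st _; rewrite ge_min lexx.
  + by move=> s t sN tN st; apply: hd2 => //; exact: le_trans st _.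
  + move=> t tN; rewrite subrr normr0 mulr0 add0r ler_pdivrMr// mulrC.
    by rewrite -ler_pdivlMr// ge_min lexx orbT.
have dq : d <= q by rewrite ge_min lexx orbT.
have e2q : e2 <= q by rewrite ge_min lexx.
apply: (@le_trans _ _ (L * (4 * (sigma + `|mu|) * q))).
  apply: ler_wpM2l => //.
  have h1 : `|mu| * d <= `|mu| * q by rewrite ler_wpM2l.
  have h2 : sigma * e2 <= sigma * q by rewrite ler_pM2l.
  have h3 : 0 <= `|mu| * q by rewrite mulr_ge0// ltW.
  by move: h1 h2 h3; rewrite mulrDr mulrDl; lra.
have -> : L * (4 * (sigma + `|mu|) * q) = (L / (L + 1)) * (e / 2).
  by rewrite /q; field; rewrite !gt_eqF.
apply: (@le_trans _ _ (e / 2)); last by lra.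
rewrite ler_piMl//; first by lra.
by rewrite ler_pdivrMr// mul1r lerDl.
Unshelve. all: by end_near. Qed.

End polygonal_paths.

Section sticky_functionals.
Context {R : realType} {d : measure_display} {T : measurableType d}.
Variable P : probability T R.
Implicit Types (x xi : T -> R -> R) (mu sigma om L : R) (G : (R -> R) -> R).

Definition affine_image mu sigma x xi := forall w,
  [/\ path0 (x w), cpath (xi w), xi w 0 = 0 & forall t, 0 <= t -> x w t = mu * t + sigma * xi w t].

Lemma steps_measurable xi h j : 0 <= h ->
  (forall t, 0 <= t -> measurable_fun setT (xi ^~ t)) ->
  measurable_fun setT (fun w => steps (xi w) h j).
Proof.
by move=> h0 mxi; apply: measurable_funB; apply: mxi; rewrite mulr_ge0.
Qed.

(** Neither the time change nor [G] is measured directly: the composite is the pointwise limit of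
    continuous functions of finitely many increments. *)
Lemma sticky_functional_measurable mu sigma om x xi (N : nat) L G : 0 < sigma -> 0 < om -> 0 <= L ->
  sup_lipschitz N%:R L G -> affine_image mu sigma x xi ->
  (forall t, 0 <= t -> measurable_fun setT (xi ^~ t)) ->
  measurable_fun setT (fun w => G (sticky_path om (x w))).
Proof.
move=> s0 om0 L0 lG ax mxi.
apply: (measurable_fun_cvg (h := fun n w =>
  G (sticky_path om (poly_path mu sigma (2 ^+ n)^-1 (N * 2 ^ n) (steps (xi w) (2 ^+ n)^-1))))).
  move=> n; have p0 : 0 < ((2 : R) ^+ n)^-1 by rewrite invr_gt0 exprn_gt0.
  have := @box_measurable _ _ T (N * 2 ^ n) _ (fun j w => steps (xi w) (2 ^+ n)^-1 j)
    (poly_box_ucont mu (N * 2 ^ n) s0 om0 p0 L0 lG).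
  by apply => k; apply: steps_measurable mxi; exact: ltW.
by move=> w _; have [px cxi xi0 xE] := ax w; exact: (poly_approx s0 om0 L0 lG px cxi xi0 xE).
Qed.

Lemma sticky_functional_Ex_cvg mu sigma om x xi (N : nat) L G B : 0 < sigma -> 0 < om -> 0 <= L ->
  sup_lipschitz N%:R L G -> (forall y, cpath y -> `|G y| <= B) -> affine_image mu sigma x xi ->
  (forall t, 0 <= t -> measurable_fun setT (xi ^~ t)) ->
  Ex P (fun w => G (sticky_path om
    (poly_path mu sigma (2 ^+ n)^-1 (N * 2 ^ n) (steps (xi w) (2 ^+ n)^-1)))) @[n --> \oo] -->
  Ex P (fun w => G (sticky_path om (x w))).
Proof.
move=> s0 om0 L0 lG GB ax mxi.
have [|||//] := @Ex_cvg _ _ _ P (fun n w => G (sticky_path om (poly_path mu sigma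
  (2 ^+ n)^-1 (N * 2 ^ n) (steps (xi w) (2 ^+ n)^-1)))) (fun w => G (sticky_path om (x w))) B.
- move=> n; have p0 : 0 < ((2 : R) ^+ n)^-1 by rewrite invr_gt0 exprn_gt0.
  have := @box_measurable _ _ T (N * 2 ^ n) _ (fun j w => steps (xi w) (2 ^+ n)^-1 j)
    (poly_box_ucont mu (N * 2 ^ n) s0 om0 p0 L0 lG).
  by apply => k; apply: steps_measurable mxi; exact: ltW.
- move=> n w; apply: GB; apply: cpath_sticky => //; apply: poly_path0.
  by rewrite invr_gt0 exprn_gt0.
- by move=> w; have [px cxi xi0 xE] := ax w; exact: (poly_approx s0 om0 L0 lG px cxi xi0 xE).
Qed.

End sticky_functionals.

(** * Tightness of the noise, uniformly in the switching rate *)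

Section noise_tightness.
Context {R : realType}.
Local Notation r := (@chain_ratio R).

Lemma geometric_bound (q : R) n : 0 <= q <= 4 / 5 -> \sum_(j < n) q ^+ j <= 5 - 5 * q ^+ n.
Proof.
move=> /andP[q0 q1]; elim: n => [|n IH]; first by rewrite big_ord0 expr0; lra.
rewrite big_ord_recr /= exprS; have := exprn_ge0 n q0.
by move: (q ^+ n) IH => y IH y0; nra.
Qed.

Lemma chain_ratio_ge0 : 0 <= r.
Proof. by rewrite /chain_ratio; lra. Qed.

Lemma chain_geometric_small (c e : R) : 0 < e -> \forall n \near \oo, c * r ^+ n <= e.
Proof.
move=> e0.
have c1 : r ^+ n @[n --> \oo] --> (0 : R).
  by apply: cvg_expr; rewrite /chain_ratio ger0_norm; lra.
have c2 : c * r ^+ n @[n --> \oo] --> (0 : R).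
  by rewrite -[X in _ --> X](mulr0 c); exact: cvgMl_tmp.
exact: (cvgr_le _ c2).
Qed.

Lemma half_le_chain n : ((2 : R) ^+ n)^-1 <= r ^+ n.
Proof. by rewrite -exprVn lerXn2r ?nnegrE// /chain_ratio; lra. Qed.

Context {d : measure_display} {T : measurableType d}.
Variable P : probability T R.
Implicit Types (l : R) (kappa : R -> T -> 'I_2).

Lemma noise_path0 l kappa w Q : markov_chain P Q kappa -> path0 (noise l kappa ^~ w).
Proof.
move=> mc; have hs := spin_integrand (chain_right_const w mc).
split; last by rewrite /noise occupation0 mulr0.
exact: (cpathZ (c := Num.sqrt l) (running_cpath hs)).
Qed.

Definition large_steps l kappa N K (j : nat) : set T :=
  \bigcup_(i in `I_(N * 2 ^ j)) [set w | K * r ^+ j < `|noise_step l kappa (2 ^+ j)^-1 i w|].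

Lemma large_steps_measurable l kappa N K j Q : markov_chain P Q kappa ->
  measurable (large_steps l kappa N K j).
Proof.
move=> mc; apply: bigcup_measurable => i _.
have h0 : 0 < ((2 : R) ^+ j)^-1 by rewrite invr_gt0 exprn_gt0.
have [m _] := bmeas_norm (noise_step_bmeas l i h0 mc).
rewrite -[X in measurable X]setTI.
have := m measurableT _ (measurable_itv `]K * r ^+ j, +oo[).
by congr (measurable (_ `&` _)); apply/seteqP; split => w /=; rewrite in_itv/= andbT.
Qed.

(** Markov's inequality for fourth moments: level j has N 2^j steps, each exceeding K r^j with
    probability at most 32 * 4^-j / (K r^j)^4. The levels form a geometric series of ratio 1 / (2
    r^4), about 0.76, hence of sum at most 5, and 160 = 32 * 5. The infinite union is the limit of
    the finite ones. *)
Lemma noise_tight l kappa N K : 0 < l -> 0 < K -> markov_chain P (flipflop_generator l) kappa ->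
  measurable (\bigcup_j large_steps l kappa N K j) /\
  Ex P (\1_(\bigcup_j large_steps l kappa N K j)) <= 160 * N%:R / K ^+ 4.
Proof.
move=> l0 K0 mc; set S := large_steps l kappa N K.
have mS j : measurable (S j) by exact: large_steps_measurable mc.
have mU : measurable (\bigcup_j S j) by exact: bigcupT_measurable.
split=> //.
pose U J := \bigcup_(j in `I_J) S j.
have mUJ J : measurable (U J) by apply: bigcup_measurable => j _.
have r0 : 0 < r by rewrite /chain_ratio; lra.
pose F j i w := noise_step l kappa (2 ^+ j)^-1 i w ^+ 4 / (K * r ^+ j) ^+ 4.
have h0 j : 0 < ((2 : R) ^+ j)^-1 by rewrite invr_gt0 exprn_gt0.
have Kr j : 0 < K * r ^+ j by rewrite mulr_gt0// exprn_gt0.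
have bF j i : bmeas (F j i).
  have := bmeasZ (((K * r ^+ j) ^+ 4)^-1) (bmeasX 4 (noise_step_bmeas l i (h0 j) mc)).
  by apply: eq_bmeas => w; rewrite mulrC.
have F0 j i w : 0 <= F j i w.
  by apply: divr_ge0; [exact: exprn_even_ge0|rewrite exprn_ge0// ltW].
have UF J w : (\1_(U J) w : R) <= \sum_(j < J) \sum_(i < N * 2 ^ j) F j i w.
  rewrite indicE; case: (boolP (w \in U J)) => [|_]; last first.
    by apply: sumr_ge0 => j _; exact: sumr_ge0.
  rewrite inE => -[j /= jJ [i /= iN Fi]].
  rewrite (bigD1 (Ordinal jJ))//= (bigD1 (Ordinal iN))//=.
  have h1 : 1 <= F j i w.
    rewrite /F ler_pdivlMr ?exprn_gt0// mul1r.
    have -> : noise_step l kappa (2 ^+ j)^-1 i w ^+ 4 = `|noise_step l kappa (2 ^+ j)^-1 i w| ^+ 4.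
      by rewrite -normrX ger0_norm// exprn_even_ge0.
    by rewrite lerXn2r ?nnegrE ?(ltW (Kr j))// ltW.
  rewrite -addrA ler_wpDr// addr_ge0// sumr_ge0// => j' _.
  exact: sumr_ge0.
have EF j i : Ex P (F j i) <= 32 / K ^+ 4 * (((2 : R) ^+ j)^-1 * (2 * r ^+ 4)^-1 ^+ j).
  have := noise_moment4 i l0 (h0 j) mc => m4.
  have -> : Ex P (F j i) = ((K * r ^+ j) ^+ 4)^-1 *
      Ex P (fun w => noise_step l kappa (2 ^+ j)^-1 i w ^+ 4).
    rewrite -ExZ; last exact: (bmeas_intg P (bmeasX 4 (noise_step_bmeas l i (h0 j) mc))).
    by apply: Ex_eq => w; rewrite mulrC.
  apply: (@le_trans _ _ (((K * r ^+ j) ^+ 4)^-1 * (32 * ((2 ^+ j)^-1) ^+ 2))).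
    by rewrite ler_pM2l// invr_gt0 exprn_gt0.
  rewrite le_eqVlt; apply/orP; left; apply/eqP.
  have -> : (K * r ^+ j) ^+ 4 = K ^+ 4 * (r ^+ 4) ^+ j by rewrite exprMn -!exprM mulnC.
  have -> : (2 * r ^+ 4)^-1 ^+ j = ((2 : R) ^+ j)^-1 * ((r ^+ 4) ^+ j)^-1.
    by rewrite exprVn exprMn invfM.
  have x0 : K ^+ 4 != 0 by rewrite expf_neq0// gt_eqF.
  have y0 : (r ^+ 4) ^+ j != 0 by rewrite !expf_neq0// gt_eqF.
  have z0 : (2 : R) ^+ j != 0 by rewrite expf_neq0.
  move: (K ^+ 4) ((r ^+ 4) ^+ j) ((2 : R) ^+ j) x0 y0 z0 => x y z x0 y0 z0.
  by field; rewrite x0 y0 z0.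
have EU J : Ex P (\1_(U J)) <= 160 * N%:R / K ^+ 4.
  have b1 j : bmeas (fun w => \sum_(i < N * 2 ^ j) F j i w).
    by apply: (@bmeas_sum _ _ _ _ _ _ (fun (i : 'I_(N * 2 ^ j)) w => F j i w)) => i.
  have b2 : bmeas (fun w => \sum_(j < J) \sum_(i < N * 2 ^ j) F j i w).
    by apply: (@bmeas_sum _ _ _ _ _ _ (fun (j : 'I_J) w => \sum_(i < N * 2 ^ j) F j i w)) => j.
  apply: (@le_trans _ _ (Ex P (fun w => \sum_(j < J) \sum_(i < N * 2 ^ j) F j i w))).
    by apply: Ex_le => //; apply: bmeas_intg => //; exact: bmeas_indic.
  rewrite (@Ex_sum _ _ _ P _ _ _ (fun (j : 'I_J) w => \sum_(i < N * 2 ^ j) F j i w))//.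
  apply: (@le_trans _ _ (\sum_(j < J) N%:R * (32 / K ^+ 4) * (2 * r ^+ 4)^-1 ^+ j)).
    apply: ler_sum => j _.
    rewrite (@Ex_sum _ _ _ P _ _ _ (fun (i : 'I_(N * 2 ^ j)) w => F j i w))//.
    apply: (@le_trans _ _ (\sum_(i < N * 2 ^ j) 32 / K ^+ 4 *
        (((2 : R) ^+ j)^-1 * (2 * r ^+ 4)^-1 ^+ j))); first by apply: ler_sum => i _.
    rewrite sumr_const card_ord -[_ *+ (N * 2 ^ j)]mulr_natl natrM natrX.
    rewrite le_eqVlt; apply/orP; left; apply/eqP; move: ((2 * r ^+ 4)^-1 ^+ j) => y.
    by field; rewrite !expf_neq0 ?gt_eqF.
  rewrite -mulr_sumr.
  have q0 : 0 <= (2 * r ^+ 4)^-1 <= 4 / 5.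
    by rewrite /chain_ratio; apply/andP; split; lra.
  have := geometric_bound J q0; have /andP[q1 _] := q0; have := exprn_ge0 J q1.
  set Sg := \sum_(j < J) _ => y0 hS.
  have S5 : Sg <= 5 by lra.
  have c0 : 0 <= N%:R * (32 / K ^+ 4).
    by rewrite mulr_ge0// divr_ge0// exprn_ge0// ltW.
  have -> : 160 * N%:R / K ^+ 4 = N%:R * (32 / K ^+ 4) * 5.
    by field; rewrite gt_eqF.
  by rewrite ler_wpM2l.
have [|||_ c] := @Ex_cvg _ _ _ P (fun J => \1_(U J)) (\1_(\bigcup_j S j)) 1.
- by move=> J; exact: measurable_indic.
- by move=> J w; rewrite indicE; case: (_ \in _); rewrite ?normr1 ?normr0.
- move=> w; apply/cvgrPdist_le => e e0.
  case: (boolP (w \in \bigcup_j S j)) => wU; rewrite indicE.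
    move: (wU); rewrite inE => -[j _ Sj]; exists j.+1 => // J /= jJ.
    by rewrite indicE wU mem_set ?subrr ?normr0 ?ltW//; exists j.
  apply: nearW => J; rewrite indicE (negbTE wU) memNset ?subrr ?normr0 ?ltW//.
  by move=> [j _ Sj]; move/negP: wU; apply; rewrite inE; exists j.
rewrite -(cvg_lim _ c)//; apply: limr_le; first by apply/cvg_ex; eexists; exact: c.
exact: nearW.
Qed.

(** Off the exceptional event the steps satisfy the hypothesis of [dyadic_chaining]. For the sup
    bound, at most N unit steps of size K lead to the integer part of t, and the modulus at k = 0
    adds 19 K. *)
Lemma noise_modulus l kappa N K w Q : 0 <= K -> markov_chain P Q kappa ->
  ~ (\bigcup_j large_steps l kappa N K j) w ->
  (forall k s t, 0 <= s <= N%:R -> 0 <= t <= N%:R -> `|s - t| <= (2 ^+ k)^-1 ->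
    `|noise l kappa s w - noise l kappa t w| <= 19 * K * r ^+ k) /\
  (forall t, 0 <= t <= N%:R -> `|noise l kappa t w| <= (N%:R + 19) * K).
Proof.
move=> K0 mc nS; have [cx x0] := noise_path0 l w mc.
have small j i : (i < N * 2 ^ j)%N -> `|noise l kappa (i.+1%:R / 2 ^+ j) w -
    noise l kappa (i%:R / 2 ^+ j) w| <= K * r ^+ j.
  move=> iN; rewrite leNgt; apply/negP => h; apply: nS; exists j => //; exists i => //.
have mod := dyadic_chaining cx K0 small; split=> // t /andP[t0 tN].
have int i : (i <= N)%N -> `|noise l kappa i%:R w| <= i%:R * K.
  elim: i => [|i IH] iN; first by rewrite x0 normr0 mul0r.
  have := small 0%N i; rewrite expn0 muln1 expr0 !divr1 mulr1 => /(_ iN) h.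
  apply: (@le_trans _ _ (`|noise l kappa i.+1%:R w - noise l kappa i%:R w| +
      `|noise l kappa i%:R w|)).
    by apply: le_trans (ler_normD _ _); rewrite subrK.
  rewrite -[i.+1%:R in leRHS]natr1 mulrDl mul1r [leRHS]addrC; apply: lerD => //.
  by apply: IH; exact: ltnW.
have /andP[f1 f2] := truncn_itv t0.
have fN : (Num.truncn t <= N)%N.
  by rewrite -(ler_nat R); exact: le_trans f1 tN.
apply: (@le_trans _ _ (`|noise l kappa t w - noise l kappa (Num.truncn t)%:R w| +
    `|noise l kappa (Num.truncn t)%:R w|)).
  by apply: le_trans (ler_normD _ _); rewrite subrK.
rewrite mulrDl addrC lerD//.
  by apply: (le_trans (int _ fN)); rewrite ler_wpM2r// ler_nat.
have := mod 0%N t (Num.truncn t)%:R; rewrite expr0 mulr1; apply.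
- by rewrite t0.
- by rewrite ler0n ler_nat.
- by rewrite invr1 ger0_norm ?subr_ge0// lerBlDr addrC natr1 ltW.
Qed.

End noise_tightness.

Section sticky_convergence.
Context {R : realType} {d' : measure_display} {T' : measurableType d'}.
Variable Q : probability T' R.
Local Notation r := (@chain_ratio R).

Lemma dist_chain (u v x y e : R) : 0 < e -> `|u - v| <= e / 8 + e / 8 -> `|v - x| <= e / 8 ->
  `|y - x| <= e / 8 -> `|u - y| <= e.
Proof.
move=> e0; rewrite !ler_norml => /andP[? ?] /andP[? ?] /andP[? ?].
by apply/andP; split; lra.
Qed.

Definition flipflop_stickiness (mu sigma a l : R) : R :=
  a * (sigma * Num.sqrt l - mu) / (Num.sqrt l - a).

Lemma flipflop_stickiness_gt0 mu sigma a l : mu < 0 -> 0 < sigma -> 0 < a -> a < Num.sqrt l ->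
  0 < flipflop_stickiness mu sigma a l.
Proof.
move=> m0 s0 a0 al; have l0 : 0 < Num.sqrt l by exact: lt_trans al.
rewrite divr_gt0 ?subr_gt0// mulr_gt0// subr_gt0 (lt_trans m0)// mulr_gt0//.
Qed.

(** Compared through inverses, since these multiply the regulator in the clocks. *)
Lemma flipflop_stickiness_dist mu sigma a l : mu < 0 -> 0 < sigma -> 0 < a -> a < Num.sqrt l ->
  `|(flipflop_stickiness mu sigma a l)^-1 - (a * sigma)^-1| <=
  (a * sigma - mu) / (a * sigma * sigma) / Num.sqrt l.
Proof.
move=> m0 s0 a0 al; have l0 : 0 < Num.sqrt l by exact: lt_trans al.
have s1 : 0 < sigma * Num.sqrt l by rewrite mulr_gt0.
have s2 : 0 < sigma * Num.sqrt l - mu by rewrite subr_gt0 (lt_trans m0).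
have as0 : 0 < a * sigma by rewrite mulr_gt0.
have al' : 0 < Num.sqrt l - a by rewrite subr_gt0.
have -> : (flipflop_stickiness mu sigma a l)^-1 - (a * sigma)^-1 =
    - ((a * sigma - mu) / (a * sigma * (sigma * Num.sqrt l - mu))).
  by rewrite /flipflop_stickiness; field; rewrite !gt_eqF.
have p0 : 0 < a * sigma - mu by rewrite subr_gt0 (lt_trans m0).
rewrite normrN gtr0_norm; last by rewrite divr_gt0// mulr_gt0.
have h : a * sigma * sigma * Num.sqrt l <= a * sigma * (sigma * Num.sqrt l - mu).
  by rewrite -[leLHS]mulrA ler_pM2l// lerDl oppr_ge0 ltW.
rewrite -[leRHS]mulrA -invfM ler_pM2l// lef_pV2// posrE.
  by rewrite mulr_gt0.
by apply: mulr_gt0 => //; exact: mulr_gt0.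
Qed.

Lemma normalized_affine_image mu sigma (X : R -> T' -> R) : 0 < sigma ->
  brownian_motion Q mu (sigma ^+ 2) X ->
  affine_image mu sigma (fun w t => X t w) (fun w t => normalized mu sigma X t w).
Proof.
move=> s0 [[mX cX] X0 _ _] w; split.
- by split; [exact: cX|exact: X0].
- have h : cpath (fun t => sigma^-1 * X t w + (- (mu / sigma)) * t).
    apply: cpathD; first exact: (cpathZ (c := sigma^-1) (cX w)).
    exact: (cpathZ (c := - (mu / sigma)) cpath_id).
  by move: h; congr cpath; apply/funext => t; rewrite /normalized; ring.
- by rewrite /normalized X0 mulr0 subr0 mul0r.
- by move=> t _; rewrite /normalized; field; rewrite gt_eqF.
Qed.

Lemma normalized_measurable mu sigma (X : R -> T' -> R) t :
  brownian_motion Q mu (sigma ^+ 2) X -> 0 <= t ->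
  measurable_fun setT (normalized mu sigma X t).
Proof.
move=> bm t0; apply: measurable_funM => //.
by apply: measurable_funB => //; exact: (bm_measurable bm).
Qed.

Lemma noise_affine_image (d : measure_display) (T : measurableType d) (P : probability T R)
    mu sigma l (kappa : R -> T -> 'I_2) A : markov_chain P A kappa ->
  affine_image mu sigma (fun w => flipflop_path mu sigma l (kappa ^~ w))
    (fun w => noise l kappa ^~ w).
Proof.
move=> mc w; have hr := chain_right_const w mc; have [cn n0] := noise_path0 l w mc.
split=> //; first exact: flipflop_path0.
by move=> t t0; rewrite flipflop_pathE// /noise mulrA.
Qed.

Lemma noise_measurable (d : measure_display) (T : measurableType d) (P : probability T R)
    l (kappa : R -> T -> 'I_2) A t : markov_chain P A kappa -> 0 <= t ->
  measurable_fun setT (noise l kappa t).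
Proof.
move=> mc; rewrite le_eqVlt => /predU1P[<-|t0].
  have -> : noise l kappa 0 = fun=> 0.
    by apply/funext => w; exact: (noise_path0 l w mc).2.
  exact: measurable_cst.
have [m _] := noise_step_bmeas l 0 t0 mc.
move: m; congr measurable_fun; apply/funext => w.
by rewrite /noise_step mul1r mul0r (noise_path0 l w mc).2 subr0.
Qed.

(** The parameters are chosen in the order K, p, n, l: K makes the exceptional event rare, 2^-p is
    the tolerated shift of the changed time, the mesh 2^-n uses at most half of that shift, and a
    large [l] keeps the change of stickiness within the other half. The finitely many increments at
    mesh 2^-n are then compared by [noise_weak_cvg]. *)
Lemma lipschitz_sticky_cvg mu sigma a (X : R -> T' -> R) (N : nat) L G B e :
  mu < 0 -> 0 < sigma -> 0 < a -> 0 <= L -> brownian_motion Q mu (sigma ^+ 2) X ->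
  sup_lipschitz N%:R L G -> (forall y, cpath y -> `|G y| <= B) -> 0 < e ->
  exists2 l0, 0 < l0 & forall l, l0 < l -> forall (d : measure_display)
    (T : measurableType d) (P : probability T R) (kappa : R -> T -> 'I_2),
    markov_chain P (flipflop_generator l) kappa ->
    `|Ex P (fun w => G (sticky_path (flipflop_stickiness mu sigma a l)
        (flipflop_path mu sigma l (kappa ^~ w)))) -
      Ex Q (fun w => G (sticky_path (a * sigma) (X ^~ w)))| <= e.
Proof.
move=> m0 s0 a0 L0 bm lG GB e0.
have B0 : 0 <= B by exact: le_trans (GB _ cpath_id).
have om0 : 0 < a * sigma by rewrite mulr_gt0.
have e8 : 0 < e / 8 by rewrite divr_gt0.
have e16 : 0 < e / 16 by rewrite divr_gt0.
have [K K1 hK] : exists2 K : R, 1 <= K & 2 * B * (160 * N%:R / K ^+ 4) <= e / 8.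
  pose z := 2 * B * (160 * N%:R) * 8 / e.
  have z0 : 0 <= z by apply: divr_ge0; [rewrite !mulr_ge0|exact: ltW].
  exists (1 + z); first by rewrite lerDl.
  have zp : 0 < 1 + z by rewrite ltr_pwDl.
  rewrite mulrA ler_pdivrMr ?exprn_gt0//.
  have -> : 2 * B * (160 * N%:R) = z * (e / 8) by rewrite /z; field; rewrite gt_eqF.
  rewrite mulrC ler_wpM2l ?(ltW e8)//.
  move: z z0 {zp} => z z0; have h : 1 + z <= (1 + z) ^+ 4.
    by rewrite -[leLHS]expr1 ler_weXn2l// lerDl.
  by apply: le_trans h; rewrite lerDr.
have K0 : 0 < K by exact: lt_le_trans K1.
have mu0 : 0 < - mu by rewrite oppr_gt0.
have muE : `|mu| = - mu by rewrite ltr0_norm.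
have [p hp] : exists p, L * 2 * (- mu + sigma * (19 * K)) * r ^+ p <= e / 16.
  have [p _ hp] := chain_geometric_small (L * 2 * (- mu + sigma * (19 * K))) e16.
  by exists p; apply: hp => /=.
have p2 : 0 < ((2 : R) ^+ p)^-1 by rewrite invr_gt0 exprn_gt0.
have ax := normalized_affine_image s0 bm.
have cB := sticky_functional_Ex_cvg (P := Q) s0 om0 L0 lG GB ax
  (fun t t0 => normalized_measurable bm t0).
have [n [hn1 hn2 hn3]] : exists n, [/\ L * 2 * (sigma * (19 * K)) * r ^+ n <= e / 16,
    sigma * (19 * K) / (a * sigma) * r ^+ n <= (2 ^+ p)^-1 / 2 &
    `|Ex Q (fun w => G (sticky_path (a * sigma) (X ^~ w))) -
      Ex Q (fun w => G (sticky_path (a * sigma) (poly_path mu sigma (2 ^+ n)^-1 (N * 2 ^ n)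
        (steps (fun t => normalized mu sigma X t w) (2 ^+ n)^-1))))| <= e / 8].
  have p3 : 0 < ((2 : R) ^+ p)^-1 / 2 by rewrite divr_gt0.
  have /cvgrPdist_le/(_ _ e8) c3 := cB.
  have := filterI (chain_geometric_small (L * 2 * (sigma * (19 * K))) e16)
    (filterI (chain_geometric_small (sigma * (19 * K) / (a * sigma)) p3) c3).
  by move=> [n _ hn]; exists n; have [] := hn n (leqnn n) => ? [].
have n2 : 0 < ((2 : R) ^+ n)^-1 by rewrite invr_gt0 exprn_gt0.
pose g v := G (sticky_path (a * sigma) (poly_path mu sigma (2 ^+ n)^-1 (N * 2 ^ n) v)).
have ug : box_ucont (N * 2 ^ n) g := poly_box_ucont mu (N * 2 ^ n) s0 om0 n2 L0 lG.
have gB v : `|g v| <= B by apply: GB; apply: cpath_sticky => //; exact: poly_path0.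
have [l1 l10 hl1] := noise_weak_cvg n2 s0 bm ug gB e8.
(* A bound for the regulator on [0, N] off the exceptional event, from the drift and the sup bound
   of the noise. With [z] below, sqrt l >= z gives Xi * c / sqrt l <= 2^-p / 2. *)
pose Xi := - mu * N%:R + sigma * ((N%:R + 19) * K).
have Xi0 : 0 <= Xi.
  apply: addr_ge0; first by rewrite mulr_ge0// ltW.
  by rewrite mulr_ge0 ?(ltW s0)// mulr_ge0 ?(ltW K0)// addr_ge0.
pose c := (a * sigma - mu) / (a * sigma * sigma).
have c0 : 0 < c.
  rewrite divr_gt0//; last by rewrite mulr_gt0.
  by rewrite subr_gt0 (lt_trans m0).
pose z := 2 * (Xi * c) / (2 ^+ p)^-1.
have z0 : 0 <= z.
  apply: divr_ge0; last exact: ltW.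
  by apply: mulr_ge0 => //; apply: mulr_ge0 => //; exact: ltW.
exists (l1 + (a + z + 1) ^+ 2).
  by rewrite ltr_pwDl// sqr_ge0.
move=> l ll d T P kappa mc.
have az : 0 < a + z + 1 by rewrite ltr_wpDl// addr_ge0// ltW.
have l1l : l1 < l by apply: le_lt_trans ll; rewrite lerDl sqr_ge0.
have l0 : 0 < l by exact: lt_trans l1l.
have sl : a + z + 1 <= Num.sqrt l.
  have -> : a + z + 1 = Num.sqrt ((a + z + 1) ^+ 2).
    by rewrite sqrtr_sqr ger0_norm// ltW.
  rewrite ler_wsqrtr// ltW//; apply: le_lt_trans ll; rewrite lerDr; exact: ltW.
have al : a < Num.sqrt l.
  by apply: lt_le_trans sl; rewrite -addrA ltrDl ltr_wpDl.
have zl : z <= Num.sqrt l.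
  by apply: le_trans sl; rewrite -addrA addrCA lerDl addr_ge0// ltW.
have sl0 : 0 < Num.sqrt l by rewrite sqrtr_gt0.
have oml := flipflop_stickiness_gt0 m0 s0 a0 al.
have ax' := noise_affine_image mu sigma l mc.
pose Y w := sticky_path (flipflop_stickiness mu sigma a l)
  (flipflop_path mu sigma l (kappa ^~ w)).
have GYB w : `|G (Y w)| <= B.
  by apply: GB; apply: cpath_sticky => //; have [] := ax' w.
have bGY : bmeas (fun w => G (Y w)).
  split; last by exists B => w; exact: GYB.
  exact: (sticky_functional_measurable s0 oml L0 lG ax'
    (fun t t0 => noise_measurable l mc t0)).
have bg : bmeas (fun w => g (fun j => noise_step l kappa (2 ^+ n)^-1 j w)).
  split; last by exists B => w; exact: gB.
  apply: (box_measurable (D := noise_step l kappa (2 ^+ n)^-1) ug) => k.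
  exact: (noise_step_bmeas l k n2 mc).1.
have [mS ES] := noise_tight N l0 K0 mc.
set S := \bigcup_j _ in mS ES.
have close w : ~ S w -> `|G (Y w) - g (fun j => noise_step l kappa (2 ^+ n)^-1 j w)| <= e / 8.
  move=> nS; have [md bd] := noise_modulus (ltW K0) mc nS.
  have [px cn n0 xE] := ax' w.
  have e10 q : 0 <= sigma * (19 * K * r ^+ q).
    apply: mulr_ge0; first exact: ltW.
    by apply: mulr_ge0; [rewrite mulr_ge0// ltW|exact: exprn_ge0 chain_ratio_ge0].
  have sc : forall t, 0 <= t <= N%:R -> `|Y w t - sticky_path (a * sigma) (poly_path mu sigma
      (2 ^+ n)^-1 (N * 2 ^ n) (steps (noise l kappa ^~ w) (2 ^+ n)^-1)) t| <=
      2 * (`|mu| * (2 ^+ p)^-1 + sigma * (19 * K * r ^+ p)) + 2 * (sigma * (19 * K * r ^+ n)).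
    apply: sticky_poly_close => //.
    - by rewrite natrM natrX mulrK// unitfE expf_neq0.
    - by move=> s t sN tN st; exact: md.
    - by move=> s t sN tN st; exact: md.
    - move=> t /andP[t0 tN].
      have Rx : regulator (flipflop_path mu sigma l (kappa ^~ w)) t <= Xi.
        apply: regulator_le => // s /andP[s1 st].
        have sN := le_trans st tN.
        rewrite xE// opprD -mulNr lerD//; first by rewrite ler_pM2l.
        rewrite -mulrN ler_pM2l//; apply: le_trans (bd s _); last by rewrite s1.
        by rewrite -normrN ler_norm.
      have h1 := flipflop_stickiness_dist m0 s0 a0 al.
      have R0 : 0 <= regulator (flipflop_path mu sigma l (kappa ^~ w)) t by exact: normr_ge0.
      have h2 := ler_pM R0 (normr_ge0 _) Rx h1.
      have h3 : Xi * ((a * sigma - mu) / (a * sigma * sigma) / Num.sqrt l) <= (2 ^+ p)^-1 / 2.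
        rewrite -/c mulrA ler_pdivrMr//.
        have -> : Xi * c = (2 ^+ p)^-1 / 2 * z by rewrite /z; field; rewrite gt_eqF// exprn_gt0.
        by rewrite ler_pM2l// divr_gt0.
      have h4 : sigma * (19 * K * r ^+ n) / (a * sigma) <= (2 ^+ p)^-1 / 2.
        by apply: le_trans hn2; rewrite le_eqVlt; apply/orP; left; apply/eqP; ring.
      apply: (@le_trans _ _ ((2 ^+ p)^-1 / 2 + (2 ^+ p)^-1 / 2)); last first.
        by rewrite -splitr.
      by apply: lerD => //; exact: le_trans h2 h3.
  apply: (le_trans (lG _ _ _ _ _ _ sc)).
  - exact: cpath_sticky.
  - by apply: cpath_sticky => //; exact: poly_path0.
  - by rewrite addr_ge0// mulr_ge0// addr_ge0// mulr_ge0// ltW.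
  have h5 : L * 2 * (- mu * (2 ^+ p)^-1 + sigma * (19 * K * r ^+ p)) <= e / 16.
    apply: le_trans hp; rewrite -[leRHS]mulrA; apply: ler_wpM2l; first by rewrite mulr_ge0.
    rewrite [leRHS]mulrDl; apply: lerD; last by rewrite !mulrA.
    by rewrite ler_pM2l// half_le_chain.
  have h6 : L * 2 * (sigma * (19 * K * r ^+ n)) <= e / 16.
    by apply: le_trans hn1; rewrite !mulrA.
  rewrite muE mulrDr !mulrA in h5 h6 *.
  by move: h5 h6; lra.
have step1 : `|Ex P (fun w => G (Y w)) -
    Ex P (fun w => g (fun j => noise_step l kappa (2 ^+ n)^-1 j w))| <= e / 8 + e / 8.
  have bS : bmeas (\1_S : T -> R) by exact: bmeas_indic.
  rewrite -ExB; [|exact: bmeas_intg|exact: bmeas_intg].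
  apply: (@le_trans _ _ (Ex P (fun w => e / 8 + 2 * B * \1_S w))).
    apply: Ex_abs_le => [||w]; first exact/bmeas_intg/bmeasB.
      by apply/bmeas_intg/bmeasD; [exact: bmeas_cst|exact: bmeasZ].
    rewrite indicE; case: (boolP (w \in S)) => wS.
      rewrite mulr1 (le_trans (ler_normB _ _))// [2 * B]mulr_natl mulr2n.
      rewrite -[leLHS]add0r lerD ?(ltW e8)// lerD//; exact: gB.
    rewrite mulr0 addr0; apply: close => Sw; move/negP: wS; apply.
    by rewrite inE.
  rewrite ExD; [|exact: intg_cst|exact/bmeas_intg/bmeasZ].
  rewrite Ex_cst ExZ; last exact: bmeas_intg.
  rewrite lerD2l; apply: le_trans hK; rewrite ler_wpM2l// mulr_ge0//.
exact: (dist_chain e0 step1 (hl1 l l1l d T P kappa mc) hn3).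
Qed.

End sticky_convergence.

(** * Continuous functionals *)

Section path_functionals.
Context {R : realType}.
Implicit Types (x y : R -> R) (e M : R) (Phi : (R -> R) -> R) (k n : nat).

(** Continuity on path space by basic neighbourhoods, a single index giving both the horizon n and
    the precision 1 / (n + 1); paths stay functions on the whole line, compared on [0, n] only. *)
Definition locally_continuous Phi := forall x e, cpath x -> 0 < e -> exists n,
  forall y, cpath y -> (forall t, 0 <= t <= n%:R -> `|x t - y t| <= n.+1%:R^-1) ->
  `|Phi x - Phi y| <= e.

Lemma halfline_path_continuous x : cpath x <-> continuous (halfline_path x).
Proof. exact: subspace_sigL_continuousP. Qed.

Lemma compact_halfline_bounded (A : set (halfline R)) : compact A ->
  exists n, forall s, A s -> 0 <= set_val s <= n%:R.
Proof.
move=> cA; have : compact (set_val @` A).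
  apply: continuous_compact cA; apply: continuous_subspaceT.
  exact: initial_continuous.
move=> /compact_bounded [M [_ hM]].
exists (Num.truncn (M + 1)).+1 => s As.
have : `|set_val s| <= M + 1 by apply: (hM (M + 1)); [rewrite ltrDl|exists s].
have : set_val s \in `[0, +oo[ by have := set_valP s.
rewrite in_itv/= andbT => s0; rewrite ger0_norm// => sM; rewrite s0.
by apply: (le_trans sM); rewrite ltW// truncnS_gt.
Qed.

(** By contradiction: if every n admits a bad path [y n], these paths converge to [x] uniformly on
    compact sets, because a compact subset of the half-line is bounded. *)
Lemma family_continuous_local (F : {family compact, halfline R -> R} -> R) :
  {within [set x : {family compact, halfline R -> R} | continuous (x : halfline R -> R)],
    continuous F} ->
  locally_continuous (fun x => F (halfline_path x)).
Proof.
move=> cF x e cx e0; apply: contrapT => /forallNP h.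
have /choice [y hy] n : exists y, [/\ cpath y,
    (forall t, 0 <= t <= n%:R -> `|x t - y t| <= n.+1%:R^-1) &
    e < `|F (halfline_path x) - F (halfline_path y)|].
  apply: contrapT => nh; apply: (h n) => y cy hxy; rewrite leNgt; apply/negP => hy.
  by apply: nh; exists y.
pose z n : {family compact, halfline R -> R} := halfline_path (y n).
have cz : z n @[n --> \oo] --> (halfline_path x : {family compact, halfline R -> R}).
  apply/fam_cvgP => A cA U /uniform_nbhs[E [entE EU]].
  have [N hN] := compact_halfline_bounded cA.
  move: entE => [d /= d0 hd].
  have c0 : harmonic n @[n --> \oo] --> (0 : R) by exact: cvg_harmonic.
  have near_E : \forall n \near \oo, forall s, A s -> E (halfline_path x s, z n s).
    near=> n => s As; apply: hd => /=; rewrite /ball/=.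
    have [_ hxy _] := hy n.
    apply: (@le_lt_trans _ _ (n.+1%:R^-1)).
      apply: hxy; have /andP[-> sN] := hN s As; rewrite (le_trans sN)// ler_nat.
      by near: n; exact: nbhs_infty_ge.
    by near: n; exact: (cvgr_lt _ c0).
  by move: near_E; apply: filterS => n; exact: EU.
have cx' : continuous (halfline_path x) by apply/halfline_path_continuous.
have /subspace_continuousP/(_ (halfline_path x) cx')/cvgrPdist_le/(_ _ e0) := cF.
move=> /cz [n _ hn]; have [cy _] := hy n.
rewrite ltNge => /negP; apply; apply: hn => //=.
by apply/halfline_path_continuous.
Unshelve. all: by end_near. Qed.

(* The largest minorant of [Phi] that is [k]-Lipschitz for the sup norm on [0, k]. *)
Definition envelope k Phi x : R :=
  inf [set v | exists y e, [/\ cpath y, 0 <= e,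
    (forall t, 0 <= t <= k%:R -> `|x t - y t| <= e) & v = Phi y + k%:R * e]].

Section envelope_properties.
Variables (Phi : (R -> R) -> R) (M : R).
Hypothesis PhiM : forall x, cpath x -> `|Phi x| <= M.

Lemma envelope_le k x y e : cpath y -> 0 <= e ->
  (forall t, 0 <= t <= k%:R -> `|x t - y t| <= e) -> envelope k Phi x <= Phi y + k%:R * e.
Proof.
move=> cy e0 h; apply: ge_inf; last by exists y, e.
exists (- M) => _ [y' [e' [cy' e'0 _ ->]]].
have := PhiM cy'; rewrite ler_norml => /andP[h1 _].
by rewrite (le_trans h1)// lerDl mulr_ge0.
Qed.

Lemma envelope_ge k x c : cpath x ->
  (forall y e, cpath y -> 0 <= e -> (forall t, 0 <= t <= k%:R -> `|x t - y t| <= e) ->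
    c <= Phi y + k%:R * e) -> c <= envelope k Phi x.
Proof.
move=> cx h; apply: lb_le_inf; last by move=> _ [y [e [cy e0 hy ->]]]; exact: h.
by exists (Phi x + k%:R * 0), x, 0; split => // t _; rewrite subrr normr0.
Qed.

Lemma envelope_minor k x : cpath x -> envelope k Phi x <= Phi x.
Proof.
move=> cx; have := @envelope_le k x x 0 cx (lexx 0).
by rewrite mulr0 addr0; apply => t _; rewrite subrr normr0.
Qed.

Lemma envelope_bound k x : cpath x -> `|envelope k Phi x| <= M.
Proof.
move=> cx; rewrite ler_norml; apply/andP; split; last first.
  apply: (le_trans (envelope_minor k cx)).
  by have := PhiM cx; rewrite ler_norml => /andP[].
apply: envelope_ge => // y e cy e0 _; have := PhiM cy; rewrite ler_norml => /andP[h _].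
by rewrite (le_trans h)// lerDl mulr_ge0.
Qed.

Lemma envelope_lipschitz k : sup_lipschitz k%:R k%:R (envelope k Phi).
Proof.
have key x x' e : cpath x -> cpath x' -> 0 <= e ->
    (forall t, 0 <= t <= k%:R -> `|x t - x' t| <= e) ->
    envelope k Phi x' <= envelope k Phi x + k%:R * e.
  move=> cx cx' e0 h; rewrite -lerBlDr; apply: envelope_ge => // y e' cy e'0 hy.
  rewrite lerBlDr -addrA -mulrDr; apply: envelope_le => //; first exact: addr_ge0.
  move=> t tk; rewrite (_ : x' t - y t = (x t - y t) + - (x t - x' t)); last by ring.
  by rewrite (le_trans (ler_normD _ _))// normrN lerD ?hy ?h.
move=> x x' e cx cx' e0 h.
have h1 := key x x' e cx cx' e0 h.
have h2 : envelope k Phi x <= envelope k Phi x' + k%:R * e.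
  by apply: key => // t tk; rewrite distrC h.
by rewrite ler_norml; apply/andP; split; lra.
Qed.

(** A competitor y within 1 / (n + 1) of x has [Phi y] close to [Phi x] by continuity; a farther one
    pays a penalty k e' of at least 2 M, which already exceeds the possible gain. *)
Lemma envelope_cvg x : locally_continuous Phi -> cpath x ->
  envelope k Phi x @[k --> \oo] --> Phi x.
Proof.
move=> lc cx; apply/cvgrPdist_le => e e0.
have [n hn] := lc x e cx e0.
have M0 : 0 <= M by exact: le_trans (PhiM cx).
near=> k.
have kn : (n <= k)%N by near: k; exact: nbhs_infty_ge.
have kM : 2 * M * n.+1%:R <= k%:R.
  near: k; exists (Num.truncn (2 * M * n.+1%:R)).+1 => // k /= hk.
  by rewrite ltW// (lt_le_trans (truncnS_gt _))// ler_nat.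
rewrite ger0_norm ?subr_ge0 ?envelope_minor// lerBlDr -lerBlDl.
apply: envelope_ge => // y e' cy e'0 hy.
have k0 : 0 <= k%:R * e' by rewrite mulr_ge0.
case: (leP e' n.+1%:R^-1) => he.
  have := hn y cy; rewrite ler_norml => h.
  have /h/andP[_ h1] : forall t, 0 <= t <= n%:R -> `|x t - y t| <= n.+1%:R^-1.
    move=> t /andP[t0 tn]; apply: le_trans he; apply: hy.
    by rewrite t0 (le_trans tn)// ler_nat.
  by lra.
have h1 : 2 * M <= k%:R * e'.
  apply: (@le_trans _ _ (k%:R * n.+1%:R^-1)); last by rewrite ler_wpM2l// ltW.
  by rewrite ler_pdivlMr.
have := PhiM cx; have := PhiM cy; rewrite !ler_norml => /andP[? ?] /andP[? ?].
by lra.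
Unshelve. all: by end_near. Qed.

End envelope_properties.

End path_functionals.

Section sticky_weak_convergence.
Context {R : realType} {d' : measure_display} {T' : measurableType d'}.
Variable Q : probability T' R.

(** For a merely continuous functional both measurability and the limit come from its envelopes,
    which are Lipschitz and have a common bound. *)
Lemma sticky_functional_bmeas (d : measure_display) (T : measurableType d) (P : probability T R)
    mu sigma om (x xi : T -> R -> R) (Phi : (R -> R) -> R) M :
  0 < sigma -> 0 < om -> (forall y, cpath y -> `|Phi y| <= M) -> locally_continuous Phi ->
  affine_image mu sigma x xi -> (forall t, 0 <= t -> measurable_fun setT (xi ^~ t)) ->
  bmeas (fun w => Phi (sticky_path om (x w))) /\
  Ex P (fun w => envelope k Phi (sticky_path om (x w))) @[k --> \oo] -->
    Ex P (fun w => Phi (sticky_path om (x w))).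
Proof.
move=> s0 om0 PM lc ax mxi.
have cp w : cpath (sticky_path om (x w)).
  by apply: cpath_sticky => //; have [] := ax w.
apply: (@Ex_cvg _ _ _ P (fun k w => envelope k Phi (sticky_path om (x w))) _ M).
- move=> k; apply: (sticky_functional_measurable s0 om0 _ (@envelope_lipschitz _ Phi M PM k) ax mxi).
  exact: ler0n.
- by move=> k w; exact: (envelope_bound PM).
- by move=> w; exact: (envelope_cvg PM).
Qed.

(** Only a lower bound, because the envelopes lie below [Phi]: the mean of [Phi] dominates that of
    an envelope, which converges in [l], and on the Brownian side the envelope can be taken to lose
    at most e / 2. *)
Lemma sticky_liminf mu sigma a (X : R -> T' -> R) (Phi : (R -> R) -> R) M e :
  mu < 0 -> 0 < sigma -> 0 < a -> brownian_motion Q mu (sigma ^+ 2) X ->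
  (forall y, cpath y -> `|Phi y| <= M) -> locally_continuous Phi -> 0 < e ->
  exists2 l0, 0 < l0 & forall l, l0 < l -> forall (d : measure_display)
    (T : measurableType d) (P : probability T R) (kappa : R -> T -> 'I_2),
    markov_chain P (flipflop_generator l) kappa ->
    Ex Q (fun w => Phi (sticky_path (a * sigma) (X ^~ w))) - e <=
    Ex P (fun w => Phi (sticky_path (flipflop_stickiness mu sigma a l)
        (flipflop_path mu sigma l (kappa ^~ w)))).
Proof.
move=> m0 s0 a0 bm PM lc e0.
have om0 : 0 < a * sigma by rewrite mulr_gt0.
have e2 : 0 < e / 2 by rewrite divr_gt0.
have ax := normalized_affine_image s0 bm.
have [_ cE] := sticky_functional_bmeas Q s0 om0 PM lc ax
  (fun t t0 => normalized_measurable bm t0).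
have [k hk] : exists k, `|Ex Q (fun w => Phi (sticky_path (a * sigma) (X ^~ w))) -
    Ex Q (fun w => envelope k Phi (sticky_path (a * sigma) (X ^~ w)))| <= e / 2.
  by have /cvgrPdist_le/(_ _ e2) [k _ hk] := cE; exists k; exact: (hk k (leqnn k)).
have [l1 l10 hl1] := lipschitz_sticky_cvg m0 s0 a0 (ler0n R k) bm (@envelope_lipschitz _ Phi M PM k)
  (fun y cy => @envelope_bound _ Phi M PM k y cy) e2.
exists (l1 + a ^+ 2); first by rewrite ltr_wpDr// sqr_ge0.
move=> l ll d T P kappa mc.
have l1l : l1 < l by apply: le_lt_trans ll; rewrite lerDl sqr_ge0.
have al : a < Num.sqrt l.
  rewrite -[a]ger0_norm ?(ltW a0)// -sqrtr_sqr ltr_sqrt; last exact: lt_trans l1l.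
  by apply: lt_trans ll; rewrite ltrDr.
have oml := flipflop_stickiness_gt0 m0 s0 a0 al.
have ax' := noise_affine_image mu sigma l mc.
have [bY _] := sticky_functional_bmeas P s0 oml PM lc ax' (fun t t0 => noise_measurable l mc t0).
have mE := sticky_functional_measurable s0 oml (ler0n R k) (@envelope_lipschitz _ Phi M PM k) ax'
  (fun t t0 => noise_measurable l mc t0).
have cp w : cpath (sticky_path (flipflop_stickiness mu sigma a l)
    (flipflop_path mu sigma l (kappa ^~ w))).
  by apply: cpath_sticky => //; have [] := ax' w.
have hle : Ex P (fun w => envelope k Phi (sticky_path (flipflop_stickiness mu sigma a l)
    (flipflop_path mu sigma l (kappa ^~ w)))) <=
    Ex P (fun w => Phi (sticky_path (flipflop_stickiness mu sigma a l)
        (flipflop_path mu sigma l (kappa ^~ w)))).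
  apply: Ex_le => [||w]; [|exact: bmeas_intg|exact: (envelope_minor PM)].
  by apply: bmeas_intg; split=> //; exists M => w; exact: (envelope_bound PM).
have := hl1 l l1l d T P kappa mc; move: hk hle.
move: (Ex P _) (Ex P _) (Ex Q _) (Ex Q _) => u v x y.
by rewrite !ler_norml => /andP[? ?] ? /andP[? ?]; lra.
Qed.

Lemma sticky_path_evaluation (d : measure_display) (T : measurableType d)
    mu sigma om (x xi : T -> R -> R) t : 0 < sigma -> 0 < om ->
  affine_image mu sigma x xi -> (forall t, 0 <= t -> measurable_fun setT (xi ^~ t)) ->
  0 <= t -> measurable_fun setT (fun w => sticky_path om (x w) t).
Proof.
move=> s0 om0 ax mxi t0.
apply: (@sticky_functional_measurable _ _ _ mu sigma om x xi (Num.truncn t).+1 1 (fun y => y t)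
  s0 om0 ler01 _ ax mxi).
move=> y z e cy cz e0 h; rewrite mul1r; apply: h.
by rewrite t0 ltW// truncnS_gt.
Qed.

End sticky_weak_convergence.

Theorem theorem2p1 (R : realType) (mu sigma a : R)
    (d : measure_display) (T : measurableType d) (P : probability T R)
    (X : R -> T -> R)
    (d_ : R -> measure_display) (T_ : forall l : R, measurableType (d_ l))
    (P_ : forall l : R, probability (T_ l) R)
    (kappa : forall l : R, R -> T_ l -> 'I_2) :
  mu < 0 -> 0 < sigma -> 0 < a ->
  brownian_motion P mu (sigma ^+ 2) X ->
  (forall l : R, 0 < l -> 0 < mu + sigma * Num.sqrt l ->
    markov_chain (P_ l) (flipflop_generator l) (kappa l)) ->
  weak_cvg_pinfty P_
    (fun l => sticky_flipflop_process mu sigma a l (kappa l))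
    P (sticky_process (a * sigma) X).
Proof.
move=> m0 s0 a0 bm mc.
have om0 : 0 < a * sigma by rewrite mulr_gt0.
(* Beyond this threshold sqrt l exceeds both [a], which makes the stickiness positive, and - mu /
   sigma, which makes the first state increasing. *)
pose L := (a + - mu / sigma) ^+ 2.
have mu0 : 0 < - mu / sigma by rewrite divr_gt0// oppr_gt0.
have big l : L < l -> [/\ 0 < l, 0 < mu + sigma * Num.sqrt l,
    mu - sigma * Num.sqrt l < 0 & a < Num.sqrt l].
  move=> Ll; have l0 : 0 < l by apply: le_lt_trans Ll; exact: sqr_ge0.
  have sl : a + - mu / sigma < Num.sqrt l.
    have -> : a + - mu / sigma = Num.sqrt L by rewrite sqrtr_sqr gtr0_norm// addr_gt0.
    by rewrite ltr_sqrt.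
  have h : - mu / sigma < Num.sqrt l by apply: lt_trans sl; rewrite ltrDr.
  split=> //.
  - by move: h; rewrite ltr_pdivrMr// mulrC; lra.
  - by rewrite subr_lt0 (lt_trans m0)// mulr_gt0// sqrtr_gt0.
  - by apply: lt_trans sl; rewrite ltrDl.
have YE l w t : L < l -> 0 <= t -> sticky_flipflop_process mu sigma a l (kappa l) t w =
    sticky_path (flipflop_stickiness mu sigma a l) (flipflop_path mu sigma l (kappa l ^~ w)) t.
  move=> /big[l0 c1 c2 al] t0.
  rewrite /sticky_flipflop_process (sticky_flipflop_pathE (mu := mu) (sigma := sigma) (l := l))//.
  exact: chain_right_const (mc l l0 c1).
have ax := normalized_affine_image s0 bm.
split.
- exists L; split; first exact: num_real.
  move=> l Ll; have [l0 c1 c2 al] := big l Ll.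
  have oml := flipflop_stickiness_gt0 m0 s0 a0 al.
  have ax' := noise_affine_image mu sigma l (mc l l0 c1).
  split=> [t t0|w].
    have := sticky_path_evaluation s0 oml ax' (fun t t0 => noise_measurable l (mc l l0 c1) t0) t0.
    by congr measurable_fun; apply/funext => w; rewrite YE.
  have [px _ _ _] := ax' w.
  have /cpathP h := cpath_sticky oml px.
  apply/cpathP => t t0 e e0; have [dd d0 hd] := h t t0 e e0.
  by exists dd => // s sp sd; rewrite !YE//; exact: hd.
- split=> [t t0|w].
    exact: (sticky_path_evaluation s0 om0 ax (fun t t0 => normalized_measurable bm t0) t0).
  by apply: cpath_sticky => //; have [] := ax w.
move=> F cF [M FM].
pose Phi (x : R -> R) : R := F (halfline_path x).
have lc : locally_continuous Phi by exact: family_continuous_local.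
have PM x : cpath x -> `|Phi x| <= M.
  by move=> /halfline_path_continuous cx; exact: FM.
have lcN : locally_continuous (fun x => - Phi x).
  move=> x e cx e0; have [n hn] := lc x e cx e0; exists n => y cy h.
  by rewrite -opprD normrN; exact: hn.
have PMN x : cpath x -> `|- Phi x| <= M by move=> cx; rewrite normrN PM.
have [bY _] := sticky_functional_bmeas P s0 om0 PM lc ax
  (fun t t0 => normalized_measurable bm t0).
have -> : ('E_P[fun w => F (halfline_path ((sticky_process (a * sigma) X) ^~ w))])%E =
    (Ex P (fun w => Phi (sticky_path (a * sigma) (X ^~ w))))%:E.
  exact: (expectation_Ex (bmeas_intg P bY)).
have EE l : L < l ->
  bmeas (fun w => Phi (sticky_path (flipflop_stickiness mu sigma a l)
    (flipflop_path mu sigma l (kappa l ^~ w)))) /\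
  ('E_(P_ l)[fun w => F (halfline_path
     ((sticky_flipflop_process mu sigma a l (kappa l)) ^~ w))])%E =
  (Ex (P_ l) (fun w => Phi (sticky_path (flipflop_stickiness mu sigma a l)
    (flipflop_path mu sigma l (kappa l ^~ w)))))%:E.
  move=> Ll; have [l0 c1 c2 al] := big l Ll.
  have oml := flipflop_stickiness_gt0 m0 s0 a0 al.
  have ax' := noise_affine_image mu sigma l (mc l l0 c1).
  have [b _] := sticky_functional_bmeas (P_ l) s0 oml PM lc ax'
    (fun t t0 => noise_measurable l (mc l l0 c1) t0).
  split=> //; rewrite -(expectation_Ex (bmeas_intg (P_ l) b)).
  congr ('E_(P_ l)[_])%E; apply/funext => w; rewrite /Phi; congr F.
  apply/funext => t; rewrite /halfline_path YE//.
  by have := set_valP t; rewrite /= in_itv/= andbT.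
apply: cvg_EFin.
  by exists L; split; [exact: num_real|move=> l Ll; rewrite (EE l Ll).2].
apply/cvgrPdist_le => e e0.
(* Applied to [Phi] for the lower bound, then to its opposite for the upper one. *)
have [l1 l10 h1] := sticky_liminf m0 s0 a0 bm PM lc e0.
have [l2 l20 h2] := sticky_liminf m0 s0 a0 bm PMN lcN e0.
exists (L + l1 + l2); split; first exact: num_real.
move=> l Ll; have L0 : 0 <= L by exact: sqr_ge0.
have LL : L < l by apply: le_lt_trans Ll; rewrite -addrA lerDl addr_ge0// ltW.
have l1l : l1 < l by apply: le_lt_trans Ll; rewrite addrAC lerDr addr_ge0// ltW.
have l2l : l2 < l by apply: le_lt_trans Ll; rewrite lerDr addr_ge0// ltW.
have [l0 c1 _ _] := big l LL; have [b E] := EE l LL; have m := mc l l0 c1.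
have {}h1 := h1 l l1l _ _ (P_ l) (kappa l) m.
have {}h2 := h2 l l2l _ _ (P_ l) (kappa l) m.
rewrite /= E /=; move: h1 h2.
rewrite ExN; last exact: bmeas_intg.
rewrite ExN; last exact: bmeas_intg.
move: (Ex P _) (Ex (P_ l) _) => u v h1 h2.
by rewrite ler_norml; apply/andP; split; lra.
Qed.
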